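(* Consider the matrix flow $H_t=T+V+\Phi_t$ described in the context and the Green function $G_t(x,y;z)=\langle\delta_y,(H_t-z)^{-1}\delta_x\rangle$. For every $c>0$ there exists $C<\infty$, depending only on $c$ and $C_V$, such that \[\frac1N\sum_{y=1}^N\mathbb{E}\,\big|G_t(x,y;E+i\eta)-G_0(x,y;E+i\eta)\big|\le C N^{-c/2}\Big(1+\frac{1}{N\eta}+\frac{1}{(N\eta)^3}\Big)\] for all $N$, all $t\le N^{-(1+c)}$, $E\in\mathbb{R}$, $\eta>0$ and $x\in\{1,\dots,N\}$.
   Context: $H_t=T+V+\Phi_t$ is an $N\times N$ real symmetric random matrix flow. $\Phi_t$ has entries $\langle\delta_y,\Phi_t\delta_x\rangle=\sqrt{(1+\delta_{xy})/N}\,B_{xy}(t)$, where $B_{xy}(t)=B_{yx}(t)$, $x\le y$, are independent standard Brownian motions. $V=\sum_x V(x)|\delta_x\rangle\langle\delta_x|$ is a random diagonal potential, independent of the Brownian motions, whose conditional distributions satisfy $\mathbb{P}(V(x)\in I\mid\{V(y)\}_{y\ne x})\le C_V|I|$ for all Borel $I\subset\mathbb{R}$ and all $x$, with $C_V<\infty$ independent of $N$. $T$ is a (possibly random) real symmetric $N\times N$ matrix, and $T$, $V$, $(\Phi_t)$ are independent. *)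

(* Defs.v *)
From HB Require Import structures.
From mathcomp Require Import all_boot all_order all_algebra.
From mathcomp Require Import all_classical all_reals all_analysis.
From mathcomp Require Import complex.
Set Implicit Arguments. Unset Strict Implicit. Unset Printing Implicit Defensive.
Import Order.TTheory GRing.Theory Num.Theory.
Import numFieldTopology.Exports.
Local Open Scope classical_set_scope.
Local Open Scope ring_scope.

Section flow_defs.
Context {R : realType} {d : measure_display} {Omega : measurableType d}.
Variable P : probability Omega R.

Definition gen_sigma (I : Type) (D : set I) (X : I -> Omega -> R) : set (set Omega) :=
  <<s \bigcup_(i in D) [set X i @^-1` A | A in (@measurable _ R)] >>.

Definition indep_sigmas (J : eqType) (F : J -> set (set Omega)) (ok : J -> Prop) : Prop :=
  forall (js : seq J) (A : J -> set Omega), uniq js ->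
    (forall j, j \in js -> ok j /\ F j (A j)) ->
    P (\bigcap_(j in [set` js]) A j) = (\prod_(j <- js) P (A j))%E.

Definition std_BM (B : R -> Omega -> R) : Prop :=
  [/\ forall w, B 0 w = 0,
      forall w, {within `[0, +oo[%classic, continuous (fun t => B t w)},
      forall t, measurable_fun setT (B t),
      forall s t, 0 <= s -> s < t -> forall A : set R, measurable A ->
        P ((fun w => B t w - B s w) @^-1` A) = normal_prob 0 (Num.sqrt (t - s)) A &
      forall n (tau : 'I_n.+1 -> R), 0 <= tau ord0 ->
        (forall i : 'I_n, tau (widen_ord (leqnSn n) i) < tau (lift ord0 i)) ->
        indep_sigmas (fun i : 'I_n => gen_sigma setT
           (fun _ : unit => fun w => B (tau (lift ord0 i)) w - B (tau (widen_ord (leqnSn n) i)) w))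
          (fun _ => True)].

Definition flow_sigmas (N : nat) (T : 'I_N -> 'I_N -> Omega -> R) (V : 'I_N -> Omega -> R)
  (B : 'I_N -> 'I_N -> R -> Omega -> R) (j : option (option ('I_N * 'I_N))) : set (set Omega) :=
  match j with
  | None => gen_sigma setT (fun ij : 'I_N * 'I_N => T ij.1 ij.2)
  | Some None => gen_sigma setT V
  | Some (Some xy) => gen_sigma `[0, +oo[%classic (B xy.1 xy.2)
  end.

Definition flow_ok (N : nat) (j : option (option ('I_N * 'I_N))) : Prop :=
  match j with Some (Some xy) => (xy.1 <= xy.2)%N | _ => True end.

Definition flow_hyps (C_V : R) (N : nat) (T : 'I_N -> 'I_N -> Omega -> R) (V : 'I_N -> Omega -> R)
  (B : 'I_N -> 'I_N -> R -> Omega -> R) : Prop :=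
  [/\
      (forall i j, measurable_fun setT (T i j)) /\ (forall i j w, T i j w = T j i w),
      (* V is a random diagonal potential with bounded conditional densities *)
      (forall x, measurable_fun setT (V x)),
      (forall (x : 'I_N) (I : set R), measurable I ->
         forall A, gen_sigma [set y | y != x] V A ->
           (P (V x @^-1` I `&` A) <= C_V%:E * lebesgue_measure I * P A)%E),
      (forall x y : 'I_N, (x <= y)%N -> std_BM (B x y)) &
      indep_sigmas (flow_sigmas T V B) (@flow_ok N)].

End flow_defs.

Local Open Scope complex_scope.

Definition Hflow {R : realType} {Omega : Type} (N : nat) (T : 'I_N -> 'I_N -> Omega -> R)
  (V : 'I_N -> Omega -> R) (B : 'I_N -> 'I_N -> R -> Omega -> R) (t : R) (w : Omega)
  : 'M[R[i]]_N :=
  \matrix_(i, j) ((T i j w + (i == j)%:R * V i w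
      + Num.sqrt ((1 + (i == j)%:R) / N%:R)
        * (if (i <= j)%N then B i j t w else B j i t w))%:C)%R.

Definition Green {R : realType} {Omega : Type} (N : nat) (T : 'I_N -> 'I_N -> Omega -> R)
  (V : 'I_N -> Omega -> R) (B : 'I_N -> 'I_N -> R -> Omega -> R) (t : R) (z : R[i])
  (w : Omega) (x y : 'I_N) : R[i] :=
  invmx (Hflow T V B t w - z%:M)%R y x.

(* Main.v *)
Require Import Defs.
From HB Require Import structures.
From mathcomp Require Import all_boot all_order all_algebra.
From mathcomp Require Import all_classical all_reals all_analysis.
From mathcomp Require Import measurable_realfun complex ring lra.
Import Order.TTheory GRing.Theory Num.Theory.
Import numFieldNormedType.Exports.
Set Implicit Arguments. Unset Strict Implicit. Unset Printing Implicit Defensive.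
Local Open Scope classical_set_scope.
Local Open Scope ring_scope.
Local Open Scope complex_scope.
Local Notation nc := Normc.normc.
Local Notation Re := complex.Re.
Local Notation Im := complex.Im.

(* Split [0, t] into K steps of length D and follow the smoothed modulus
   u |-> sqrt (|u|^2 + a^2) of u = G_s(x,y) - G_0(x,y). Over one step, expand the
   resolvent to second order in the increment F of the noise. Since F is centred,
   independent of the past, and has covariance of size D/N concentrated on the
   pairs {i,j} = {k,l}, the mean growth is at most a multiple of D/N times
   [step_bound], a quadratic expression in the resolvent at time s, plus an error
   O(D^(3/2)). As K -> oo the error disappears: this replaces Ito's formula.
   The mean of [step_bound], summed over y, is bounded at each fixed s by
   averaging over V alone. The rank-one formula makes every relevant quantity
   1/|V(x) + zeta| with zeta depending on the other sites only, so the bounded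
   conditional density gives Wegner's estimate, Minami's estimate for
   Im G_xx Im G_yy - (Im G_xy)^2, and a bound eta^(-2e) on the mean of
   |G_xx G_yy - G_xy^2|. Finally a = N^(-c/2), and 2e <= min(1, c/2). *)

(** The deviation starts at 0, exactly where the modulus is not differentiable. Smoothing at scale
    [a] costs [a] at time 0, and by concavity of the square root it leaves a second-order term of
    size [|du|^2 / (2 a)]. The two costs balance: up to powers of [1 / (N eta)], the second is of
    order [t N / a], and [t N <= N^(-c) = a^2]. The static estimates are uniform in the symmetric
    matrix to which [V] is added. Since [Phi_s] is independent of [V], it can be frozen and counted
    with [T], so nothing about the law of [H_s] beyond that of [V] is used at a fixed time. The
    obstacle is the contraction [G_xi G_jj G_iy] of the noise covariance. It leaves [|G_jj|] instead
    of [Im G_jj], and the mean of [1 / |V + zeta|] need not be bounded as [eta] tends to 0, because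
    [1 / |v|] is not integrable near 0. Passing to the power [1 + e] costs a factor [eta^(-e)] for
    each of the two sites involved, and part of the decay [N^(-c/2)] pays for it. *)

Section Complex.
Variable R : realType.
Implicit Types z w : R[i].

Lemma ncE2 z : nc z ^+ 2 = Re z ^+ 2 + Im z ^+ 2.
Proof. by case: z => a b /=; rewrite sqr_sqrtr // addr_ge0 ?sqr_ge0. Qed.

Lemma nc_ge0 z : 0 <= nc z.
Proof. by case: z => a b; rewrite /= sqrtr_ge0. Qed.

Lemma nc_sum (I : Type) (r : seq I) (P : pred I) (F : I -> R[i]) :
  nc (\sum_(i <- r | P i) F i) <= \sum_(i <- r | P i) nc (F i).
Proof.
elim/big_rec2: _ => [|i a z _ h]; first by rewrite Normc.normc0.
by apply: (le_trans (le_normcD _ _)); rewrite lerD2l.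
Qed.

Lemma Re_le_nc z : `|Re z| <= nc z.
Proof. by case: z => a b /=; rewrite -sqrtr_sqr ler_wsqrtr // lerDl sqr_ge0. Qed.

Lemma Im_le_nc z : `|Im z| <= nc z.
Proof. by case: z => a b /=; rewrite -sqrtr_sqr ler_wsqrtr // lerDr sqr_ge0. Qed.

Lemma nc_gt0 z : (0 < nc z) = (z != 0).
Proof.
rewrite lt_def nc_ge0 andbT; apply/idP/idP; apply: contraNN => /eqP h.
  by rewrite h Normc.normc0.
by apply/eqP/Normc.eq0_normc.
Qed.

Lemma nc_real (x : R) : nc x%:C = `|x|.
Proof. by rewrite /= expr0n addr0 sqrtr_sqr. Qed.

Lemma mul_conj_nc z : z * conjc z = (nc z ^+ 2)%:C.
Proof. by rewrite ncE2; case: z => a b; simpc; congr (_ +i* _); ring. Qed.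

Lemma cReD z w : Re (z + w) = Re z + Re w. Proof. by case: z; case: w. Qed.
Lemma cImD z w : Im (z + w) = Im z + Im w. Proof. by case: z; case: w. Qed.
Lemma cReN z : Re (- z) = - Re z. Proof. by case: z. Qed.
Lemma cImN z : Im (- z) = - Im z. Proof. by case: z. Qed.
Lemma cReM z w : Re (z * w) = Re z * Re w - Im z * Im w. Proof. by case: z; case: w. Qed.
Lemma cImM z w : Im (z * w) = Re z * Im w + Im z * Re w. Proof. by case: z => a b; case: w => c d. Qed.
Lemma cIm_conj z : Im (conjc z) = - Im z. Proof. by case: z. Qed.
Lemma cRe_conj z : Re (conjc z) = Re z. Proof. by case: z. Qed.
Lemma cRe_sum (I : Type) (r : seq I) (P : pred I) (F : I -> R[i]) :
  Re (\sum_(i <- r | P i) F i) = \sum_(i <- r | P i) Re (F i).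
Proof. by elim/big_rec2: _ => // i a z _ h; rewrite cReD h. Qed.
Lemma cRe_real (x : R) z : Re (x%:C * z) = x * Re z.
Proof. by rewrite cReM /= mul0r subr0. Qed.

Lemma cImV z : Im z^-1 = - Im z / nc z ^+ 2.
Proof. by rewrite ncE2; case: z => a b /=; rewrite mulNr. Qed.

Lemma cReV z : Re z^-1 = Re z / nc z ^+ 2.
Proof. by rewrite ncE2; case: z. Qed.

Lemma nc_conj z : nc (conjc z) = nc z.
Proof. by case: z => a b /=; rewrite sqrrN. Qed.

End Complex.

(** * Resolvents of symmetric matrices *)

Section Resolvent.
Variables (R : realType) (n : nat).
Implicit Types (h : 'I_n -> 'I_n -> R) (z : R[i]).

Definition cmx h : 'M[R[i]]_n := \matrix_(i, j) (h i j)%:C.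
Definition resolvent h z : 'M[R[i]]_n := invmx (cmx h - z%:M).

Definition symf h := forall i j, h i j = h j i.

(** The sum is [r (h - z)] paired with the conjugate of [r]. The contribution of [h] is real because
    [h] is real symmetric, so only [z |r|^2] has an imaginary part. Invertibility, the Ward identity
    and positivity of Schur complements all follow by choosing [r]. *)
Lemma Im_quadratic_form h z (r : 'rV[R[i]]_n) : symf h ->
  Im (\sum_i (r *m (cmx h - z%:M)) 0 i * conjc (r 0 i))
  = - (Im z * \sum_i nc (r 0 i) ^+ 2).
Proof.
move=> hs.
have -> : \sum_i (r *m (cmx h - z%:M)) 0 i * conjc (r 0 i) =
  \sum_i \sum_j (h j i)%:C * (r 0 j * conjc (r 0 i))
  - z * (\sum_i nc (r 0 i) ^+ 2)%:C.
  rewrite rmorph_sum mulr_sumr -sumrB; apply: eq_bigr => i _.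
  rewrite mulmxBr mul_mx_scalar !mxE mulrBl -mulrA mul_conj_nc; congr (_ - _).
  by rewrite mulr_suml; apply: eq_bigr => j _; rewrite !mxE; ring.
rewrite cImD cImN cImM [Im (real_complex _ _)]/= [Re (real_complex _ _)]/= mulr0 add0r.
set S := \sum_i _; suff -> : Im S = 0 by rewrite add0r.
have : S = conjc S.
  rewrite /S rmorph_sum exchange_big; apply: eq_bigr => i _.
  rewrite rmorph_sum; apply: eq_bigr => j _.
  rewrite !rmorphM /= conjcK hs -[_ -i* 0]/(conjc (_%:C)) conjc_real; ring.
by move=> /(congr1 (@Im R)); rewrite cIm_conj; lra.
Qed.

Section Fixed.
Variables (h : 'I_n -> 'I_n -> R) (z : R[i]).
Hypothesis hs : symf h.
Hypothesis z_gt0 : 0 < Im z.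
Local Notation G := (resolvent h z).

Lemma resolvent_unit : cmx h - z%:M \in unitmx.
Proof.
rewrite -row_free_unit; apply: inj_row_free => v hv.
have := Im_quadratic_form z v hs; rewrite hv.
rewrite big1 => [/=|i _]; last by rewrite mxE mul0r.
move/esym/eqP; rewrite oppr_eq0 mulf_eq0 (gt_eqF z_gt0) /= psumr_eq0 => [/allP hall|i _].
  apply/rowP => i; rewrite mxE.
  have := hall i (mem_index_enum _).
  by rewrite sqrf_eq0 => /eqP /Normc.eq0_normc.
by rewrite sqr_ge0.
Qed.

Lemma resolvent_sym i j : G i j = G j i.
Proof.
suff e : G^T = G by rewrite -[in LHS]e mxE.
rewrite /resolvent trmx_inv; congr invmx.
by apply/matrixP => k l; rewrite !mxE (hs l k) (eq_sym l k).
Qed.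

(** For [r] the row [i] of [G], [r (h - z)] is the [i]-th unit vector, and the quadratic form
    reduces to the conjugate of [G i i]. *)
Lemma Im_resolvent i : Im (G i i) = Im z * \sum_j nc (G i j) ^+ 2.
Proof.
have := Im_quadratic_form z (row i G) hs.
have -> : row i G *m (cmx h - z%:M) = row i 1%:M.
  by rewrite -row_mul mulVmx // resolvent_unit.
rewrite (bigD1 i) //= big1 => [|k hk]; last first.
  by rewrite !mxE eq_sym (negPf hk) mul0r.
rewrite !mxE eqxx mul1r addr0 cIm_conj => /oppr_inj ->.
by congr (_ * _); apply: eq_bigr => j _; rewrite mxE.
Qed.

Lemma Im_resolvent_ge0 i : 0 <= Im (G i i).
Proof.
by rewrite Im_resolvent mulr_ge0 ?(ltW z_gt0) // sumr_ge0 // => j _; exact: sqr_ge0.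
Qed.

Lemma Ward i : \sum_j nc (G i j) ^+ 2 = Im (G i i) / Im z.
Proof. by rewrite Im_resolvent mulrAC mulfV ?mul1r // gt_eqF. Qed.

Lemma sqr_nc_resolvent_le i j : nc (G i j) ^+ 2 <= Im (G i i) / Im z.
Proof.
rewrite -Ward (bigD1 j) //= lerDl sumr_ge0 // => k _; exact: sqr_ge0.
Qed.

(** On the diagonal, [|G_ii|^2 <= Im G_ii / Im z <= |G_ii| / Im z] can be divided by [|G_ii|]. Off
    the diagonal, the Ward bound at [i] is applied once more. *)
Lemma nc_resolvent_le i j : nc (G i j) <= (Im z)^-1.
Proof.
have hii : nc (G i i) <= (Im z)^-1.
  have := sqr_nc_resolvent_le i i.
  have := le_trans (ler_norm _) (Im_le_nc (G i i)).
  have := nc_ge0 (G i i); rewrite le_eqVlt => /orP[/eqP<- _ _|p0 h1 h2].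
    by rewrite invr_ge0 ltW.
  rewrite -(ler_pM2l p0) -expr2; apply: (le_trans h2).
  by rewrite ler_pM2r // invr_gt0.
have h1 := sqr_nc_resolvent_le i j.
rewrite -(@ler_pXn2r _ 2) ?nnegrE ?nc_ge0 ?invr_ge0 ?(ltW z_gt0) //.
apply: (le_trans h1); rewrite expr2 ler_pM2r ?invr_gt0 //.
exact: le_trans (le_trans (ler_norm _) (Im_le_nc (G i i))) hii.
Qed.

Lemma Im_resolvent_gt0 i : 0 < Im (G i i).
Proof.
rewrite lt_def Im_resolvent_ge0 andbT Im_resolvent mulf_eq0 (gt_eqF z_gt0) /=.
rewrite psumr_eq0 => [|j _]; last exact: sqr_ge0.
apply/negP => /allP hall.
have : row i (1%:M : 'M[R[i]]_n) = 0.
  rewrite -(mulVmx resolvent_unit) row_mul.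
  have -> : row i G = 0; last by rewrite mul0mx.
  apply/rowP => j; rewrite !mxE; apply/Normc.eq0_normc/eqP.
  by have := hall j (mem_index_enum _); rewrite sqrf_eq0.
by move/rowP/(_ i); rewrite !mxE eqxx => /eqP; rewrite oner_eq0.
Qed.

Lemma resolvent_diag_neq0 i : G i i != 0.
Proof. by apply: contraTneq (Im_resolvent_gt0 i) => ->; rewrite ltxx. Qed.

(* [K] is the Green function at [j] of the matrix with site [i] removed. *)
Lemma Im_schur i j : i != j ->
  let K := G j j - G i j ^+ 2 / G i i in
  0 < Im K /\ Im z * nc K ^+ 2 <= Im K.
Proof.
(* [k] is chosen so that [r] vanishes at [i]. Then [r (h - z) = e_j - k e_i] is tested only at [j],
   and the quadratic form is the conjugate of [K]. *)
move=> ij K; pose k := G i j / G i i.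
pose r := row j G - k *: row i G.
have rE l : r 0 l = G j l - k * G i l by rewrite !mxE.
have := Im_quadratic_form z r hs.
have -> : r *m (cmx h - z%:M) = row j 1%:M - k *: row i 1%:M.
  by rewrite mulmxBl -scalemxAl -!row_mul mulVmx // resolvent_unit.
have ri : r 0 i = 0.
  by rewrite rE /k mulfVK ?resolvent_diag_neq0 // resolvent_sym subrr.
have rj : r 0 j = K by rewrite rE /K /k expr2 mulrAC.
rewrite (bigD1 j) //= big1 => [|l lj]; last first.
  have [->|li] := eqVneq l i; first by rewrite ri conjc0 mulr0.
  by rewrite !mxE eq_sym (negPf lj) eq_sym (negPf li) mulr0 subr0 mul0r.
rewrite rj !mxE eqxx (negPf ij) mulr0 subr0 mul1r addr0 cIm_conj => /oppr_inj e.
have hK : Im z * nc K ^+ 2 <= Im K.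
  rewrite e ler_pM2l // (bigD1 j) //= rj lerDl sumr_ge0 // => l _; exact: sqr_ge0.
split=> //; rewrite lt_def; apply/andP; split; last first.
  by apply: le_trans hK; rewrite mulr_ge0 ?sqr_ge0 ?ltW.
rewrite e mulf_eq0 (gt_eqF z_gt0) /= psumr_eq0 => [|l _]; last exact: sqr_ge0.
apply/negP => /allP hall.
have r0 : r = 0.
  apply/rowP => l; rewrite [RHS]mxE; apply/Normc.eq0_normc/eqP.
  by have := hall l (mem_index_enum _); rewrite sqrf_eq0.
have : row j (1%:M : 'M[R[i]]_n) - k *: row i 1%:M = 0.
  by rewrite -(mulVmx resolvent_unit) !row_mul scalemxAl -mulmxBl -/r r0 mul0mx.
move/rowP/(_ j); rewrite !mxE eqxx (negPf ij) mulr0 subr0 => /eqP.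
by rewrite oner_eq0.
Qed.

End Fixed.

Lemma resolvent_identity h h' z : symf h -> symf h' -> 0 < Im z ->
  resolvent h' z - resolvent h z
  = - (resolvent h z *m (cmx h' - cmx h) *m resolvent h' z).
Proof.
move=> hs hs' z0.
have e : cmx h' - cmx h = (cmx h' - z%:M) - (cmx h - z%:M).
  by rewrite opprB addrA subrK.
rewrite e mulmxBr mulmxBl -mulmxA mulmxV ?resolvent_unit //.
by rewrite mulmx1 mulVmx ?resolvent_unit // mul1mx opprB.
Qed.

End Resolvent.

(** * Rank-one perturbation at a single site *)

Section RankOne.
Variables (R : realType) (n : nat).
Implicit Types (h : 'I_n -> 'I_n -> R).

Definition add_site h x v i j : R := h i j + v *+ ((i == x) && (j == x)).

Lemma add_site_sym h x v : symf h -> symf (add_site h x v).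
Proof. by move=> hs i j; rewrite /add_site hs andbC. Qed.

(** With [M] the block with rows [(p, r)] and [(r, q)], a real shift [v E] at the first site gives
    [M' = M (1 + v E M)^-1]. Then [Im M'] is congruent to [Im M] through [(1 + v E M)^-1], whose
    determinant is [1 / D], hence the factor [|D|^-2]. *)
Lemma det_Im_rank_one (p q r : R[i]) (v : R) : 1 + v%:C * p != 0 ->
  let D := 1 + v%:C * p in
  Im (p / D) = Im p / nc D ^+ 2 /\
  Im (p / D) * Im (q - v%:C * r ^+ 2 / D) - Im (r / D) ^+ 2
  = (Im p * Im q - Im r ^+ 2) / nc D ^+ 2.
Proof.
move=> D0 D; have : nc D ^+ 2 != 0 by rewrite sqrf_eq0 gt_eqF // nc_gt0.
rewrite ncE2 /D {D D0}; case: p => p1 p2; case: q => q1 q2; case: r => r1 r2.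
simpc => /= N0; split; by field; rewrite ?N0.
Qed.

Variables (h : 'I_n -> 'I_n -> R) (z : R[i]).
Hypothesis hs : symf h.
Hypothesis z_gt0 : 0 < Im z.
Variables (x : 'I_n) (v : R).
Local Notation G := (resolvent h z).
Local Notation G' := (resolvent (add_site h x v) z).

Lemma resolvent_add_site i j : G' i j = G i j - v%:C * G i x * G' x j.
Proof.
have := resolvent_identity hs (add_site_sym x v hs) z_gt0.
move/matrixP/(_ i j); rewrite !mxE => /eqP; rewrite subr_eq => /eqP ->.
rewrite addrC; congr (_ - _).
rewrite (bigD1 x) //= big1 => [|k kx]; last first.
  rewrite !mxE big1 ?mul0r // => l _.
  by rewrite !mxE /add_site (negPf kx) andbF mulr0n addr0 subrr mulr0.
rewrite addr0 !mxE (bigD1 x) //= big1 => [|k kx]; last first.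
  by rewrite !mxE /add_site (negPf kx) mulr0n addr0 subrr mulr0.
by rewrite !mxE /add_site !eqxx mulr1n addr0 rmorphD /=; ring.
Qed.

Local Notation D := (1 + v%:C * G x x).

Lemma resolvent_add_siteM j : G' x j * D = G x j.
Proof. by rewrite {1}resolvent_add_site; have := resolvent_add_site x j => e; rewrite mulrDr mulr1 -e; rewrite {1}e; ring. Qed.

Lemma rank_one_neq0 : D != 0.
Proof.
apply/eqP => e; have := resolvent_add_siteM x; rewrite e mulr0 => /esym/eqP.
by rewrite (negPf (resolvent_diag_neq0 hs z_gt0 x)).
Qed.

Lemma resolvent_add_siteE j : G' x j = G x j / D.
Proof. by rewrite -resolvent_add_siteM mulfK // rank_one_neq0. Qed.

Lemma resolvent_add_site_other j : G' j j = G j j - v%:C * G x j ^+ 2 / D.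
Proof.
by rewrite resolvent_add_site resolvent_add_siteE (resolvent_sym z hs j x); ring.
Qed.

Lemma resolvent_add_site_diag : G' x x = (v%:C + (G x x)^-1)^-1.
Proof.
rewrite resolvent_add_siteE -invf_div; congr (_^-1).
by rewrite mulrDl mul1r mulfK ?resolvent_diag_neq0 // addrC.
Qed.

Lemma nc_resolvent_add_site_diag :
  nc (G' x x) = (nc (v%:C + (G x x)^-1))^-1.
Proof. by rewrite resolvent_add_site_diag Normc.normcV. Qed.

Lemma Im_resolvent_add_site_diag :
  Im (G' x x) = - Im (G x x)^-1 / nc (v%:C + (G x x)^-1) ^+ 2.
Proof. by rewrite resolvent_add_site_diag [LHS]cImV cImD /= add0r. Qed.

(** Since [- Im (1 / G) = Im G / |G|^2], this is the Ward bound in another form. It provides the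
    lower bound [eta] on the width [b] in the averaging lemmas. *)
Lemma ImV_resolvent_diag : Im z <= - Im (G x x)^-1.
Proof.
rewrite cImV mulNr opprK ler_pdivlMr ?exprn_gt0 ?nc_gt0 ?resolvent_diag_neq0 //.
by rewrite mulrC -ler_pdivlMr // sqr_nc_resolvent_le.
Qed.

(* Both Im (G' x x) and det (Im G') are |D|^-2 times their value at [v = 0], so their
   quotient does not depend on [v]: this decouples the two sites. *)
Lemma minor_Im_le j :
  Im (G' x x) * Im (G' j j) - Im (G' x j) ^+ 2 <= Im (G' x x) * Im (G j j).
Proof.
rewrite (resolvent_add_site_other j) !resolvent_add_siteE.
have [e1 ->] := det_Im_rank_one (G j j) (G x j) rank_one_neq0.
rewrite e1 [leRHS]mulrAC ler_pM2r ?invr_gt0 ?exprn_gt0 ?nc_gt0 ?rank_one_neq0 //.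
by rewrite lerBlDr lerDl sqr_ge0.
Qed.

(** The second factor is the Green function at [j] with site [x] removed, hence free of [v]: the
    mean of the minor becomes a product of two single-site averages. *)
Lemma minor_resolvent j :
  G' x x * G' j j - G' x j ^+ 2 = G' x x * (G j j - G x j ^+ 2 / G x x).
Proof.
rewrite (resolvent_add_site_other j) !resolvent_add_siteE.
by field; rewrite rank_one_neq0 resolvent_diag_neq0.
Qed.

End RankOne.

(** * The Green function with one site removed *)

Section Schur.
Variables (R : realType) (n : nat) (h : 'I_n -> 'I_n -> R) (z : R[i]).
Hypothesis hs : symf h.
Hypothesis z_gt0 : 0 < Im z.

(** The reciprocal is taken because a shift [w] of the diagonal at [y] then acts by addition of [w],
    see [schur_add_site]. *)
Definition schur_gamma (x y : 'I_n) : R[i] :=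
  let G := resolvent h z in (G y y - G x y ^+ 2 / G x x)^-1.

Lemma schur_add_site (x y : 'I_n) (w : R) : x != y ->
  let G' := resolvent (add_site h y w) z in
  nc (G' y y - G' x y ^+ 2 / G' x x) = (nc (w%:C + schur_gamma x y))^-1.
Proof.
move=> xy G'; rewrite -Normc.normcV; congr nc.
have D0 := rank_one_neq0 hs z_gt0 y w.
have Gx' := resolvent_diag_neq0 (add_site_sym y w hs) z_gt0 x.
have Gx := resolvent_diag_neq0 hs z_gt0 x.
have [ImK _] := Im_schur hs z_gt0 xy.
set G := resolvent h z in D0 Gx ImK *.
have Gs : G x y = G y x by rewrite /G (resolvent_sym z hs).
have K0 : G y y * G x x - G x y ^+ 2 != 0.
  apply: contraTneq ImK => e; rewrite -(mulfK Gx (G y y)) -mulrBl e mul0r.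
  by rewrite ltxx.
have e1 := resolvent_add_site_other hs z_gt0 y w x.
have e2 := resolvent_add_siteE hs z_gt0 y w x.
have e3 := resolvent_add_siteE hs z_gt0 y w y.
have e4 := resolvent_sym z (add_site_sym y w hs) x y.
rewrite -/G -/G' in e1 e2 e3 e4 Gx'.
rewrite e4 e3 e2; rewrite e1 in Gx' *.
rewrite /schur_gamma -/G -Gs in Gx' *.
set a := G x x in D0 Gx K0 Gx' *; set b := G y y in D0 K0 Gx' *.
set c := G x y in K0 Gx' *.
have N0 : a * (1 + w%:C * b) - w%:C * c ^+ 2 != 0.
  apply: contraNneq Gx' => e.
  by rewrite -(mulfK D0 a) -mulrBl e mul0r.
have -> : (w%:C + (b - c ^+ 2 / a)^-1) = (a * (1 + w%:C * b) - w%:C * c ^+ 2) / (b * a - c ^+ 2).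
  by field; rewrite Gx K0.
rewrite invf_div; field.
by apply/andP; split; [exact: N0 | exact: D0].
Qed.

Lemma Im_schur_gamma (x y : 'I_n) : x != y -> Im z <= - Im (schur_gamma x y).
Proof.
move=> xy; have [K0 Kle] := Im_schur hs z_gt0 xy.
rewrite /schur_gamma cImV mulNr opprK ler_pdivlMr //.
rewrite exprn_gt0 // nc_gt0; by apply: contraTneq K0 => ->; rewrite ltxx.
Qed.

End Schur.

(** * Second-order expansion of the resolvent *)

Section Expansion.
Variables (R : realType) (n : nat).
Variables (h h' : 'I_n -> 'I_n -> R) (z : R[i]).
Hypotheses (hs : symf h) (hs' : symf h') (z_gt0 : 0 < Im z).
Local Notation G := (resolvent h z).
Local Notation G' := (resolvent h' z).
Local Notation F i j := (h' i j - h i j).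

Lemma mulmx3E (A M B : 'M[R[i]]_n) x y :
  (A *m M *m B) x y = \sum_i \sum_j M i j * (A x i * B j y).
Proof.
rewrite mxE exchange_big; apply: eq_bigr => j _; rewrite mxE mulr_suml.
by apply: eq_bigr => i _; ring.
Qed.

Lemma nc_mulmx3_le (A M B : 'M[R[i]]_n) (a b : R) x y :
  (forall i, nc (A x i) <= a) -> (forall j, nc (B j y) <= b) ->
  nc ((A *m M *m B) x y) <= (\sum_i \sum_j nc (M i j)) * (a * b).
Proof.
move=> ha hb; rewrite mulmx3E mulr_suml; apply: (le_trans (nc_sum _ _ _)).
apply: ler_sum => i _; rewrite mulr_suml; apply: (le_trans (nc_sum _ _ _)).
apply: ler_sum => j _; rewrite !Normc.normcM ler_wpM2l ?nc_ge0 //.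
by rewrite ler_pM ?nc_ge0.
Qed.

(** [r2] is the whole remainder after the linear term. Where it enters squared, its bound by
    [S^2 / eta^3] suffices; where it enters linearly, its quadratic part must be explicit and only
    [r3] is an error. *)
Lemma resolvent_expand : exists r2 r3 : 'I_n -> 'I_n -> R[i],
  forall x y,
  [/\ G' x y - G x y = - (\sum_i \sum_j (F i j)%:C * (G x i * G j y)) + r2 x y,
   r2 x y = \sum_i \sum_j \sum_k \sum_l
     (F i j)%:C * (G x i * ((F k l)%:C * (G j k * G l y))) - r3 x y,
   nc (r2 x y) <= (\sum_i \sum_j `|F i j|) ^+ 2 / Im z ^+ 3 &
   nc (r3 x y) <= (\sum_i \sum_j `|F i j|) ^+ 3 / Im z ^+ 4].
Proof.
pose M := cmx h' - cmx h.
have ME i j : M i j = (F i j)%:C by rewrite !mxE rmorphB.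
have eG : G' = G - G *m M *m G'.
  by have /eqP := resolvent_identity hs hs' z_gt0; rewrite subr_eq addrC => /eqP.
move: M ME eG => M ME eG.
pose A1 := G *m M *m G; pose A2 := G *m M *m A1.
pose r2 := G *m M *m (G *m M *m G').
pose r3 := G *m M *m r2.
have e1 : G' - G = - A1 + r2.
  rewrite {1}eG {1}eG mulmxBr /A1 /r2 opprB addrC addrA addNr add0r.
  by rewrite addrC.
have e2 : r2 = A2 - r3.
  by rewrite /r2 {1}eG !(mulmxBr (G *m M)).
set S := \sum_i \sum_j `|F i j|.
have SE : S = \sum_i \sum_j nc (M i j).
  by apply: eq_bigr => i _; apply: eq_bigr => j _; rewrite ME nc_real.
have b1 i j : nc ((G *m M *m G') i j) <= S * ((Im z)^-1 * (Im z)^-1).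
  by rewrite SE nc_mulmx3_le // => k; rewrite nc_resolvent_le.
have b2 i j : nc (r2 i j) <= S * ((Im z)^-1 * (S * ((Im z)^-1 * (Im z)^-1))).
  rewrite {1}SE /r2 nc_mulmx3_le // => k.
  by rewrite nc_resolvent_le.
have b3 i j : nc (r3 i j) <= S * ((Im z)^-1 * (S * ((Im z)^-1 * (S * ((Im z)^-1 * (Im z)^-1))))).
  rewrite {1}SE /r3 nc_mulmx3_le // => k.
  by rewrite nc_resolvent_le.
have addE (A B : 'M[R[i]]_n) i j : (A + B) i j = A i j + B i j by rewrite mxE.
have oppE (A : 'M[R[i]]_n) i j : (- A) i j = - A i j by rewrite mxE.
exists (fun x y => r2 x y), (fun x y => r3 x y) => x y; split.
- move/matrixP: e1 => /(_ x y); rewrite !addE !oppE => ->; congr (- _ + _).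
  by rewrite /A1 mulmx3E; apply: eq_bigr => i _; apply: eq_bigr => j _; rewrite ME.
- move/matrixP: e2 => /(_ x y) ->; rewrite addE oppE; congr (_ - _).
  rewrite /A2 mulmx3E; apply: eq_bigr => i _; apply: eq_bigr => j _.
  rewrite /A1 mulmx3E ME !mulr_sumr; apply: eq_bigr => k _.
  by rewrite !mulr_sumr; apply: eq_bigr => l _; rewrite ME.
- by apply: (le_trans (b2 x y)); rewrite le_eqVlt; apply/orP; left; apply/eqP; rewrite -exprVn; ring.
- by apply: (le_trans (b3 x y)); rewrite le_eqVlt; apply/orP; left; apply/eqP; rewrite -exprVn; ring.
Qed.

End Expansion.

(** * Averages over a variable with bounded conditional density *)

Section Independence.
Local Open Scope ereal_scope.
Context d d1 d2 (Omega : measurableType d) (S1 : measurableType d1)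
  (S2 : measurableType d2) (R : realType) (P : probability Omega R).
Variables (X : {mfun Omega >-> S1}) (Y : {mfun Omega >-> S2}).
Hypothesis indep : forall A B, measurable A -> measurable B ->
  P (X @^-1` A `&` Y @^-1` B) = P (X @^-1` A) * P (Y @^-1` B).

Let Z w := (X w, Y w).
Let mZ : measurable_fun setT Z.
Proof. by apply/measurable_fun_pairP; split; exact: measurable_funPT. Qed.
HB.instance Definition _ := isMeasurableFun.Build _ _ _ _ Z mZ.

Lemma ge0_integral_indep (f : S1 * S2 -> \bar R) :
  measurable_fun [set: S1 * S2] f -> (forall s, 0 <= f s) ->
  \int[P]_w f (X w, Y w) = \int[P]_w \int[P]_w' f (X w, Y w').
Proof.
move=> mf f0.
have -> : \int[P]_w f (X w, Y w) = integral (distribution P Z) setT f.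
  by rewrite ge0_integral_distribution.
rewrite (eq_measure_integral (distribution P X \x distribution P Y)) => [|A mA _]; last first.
  by apply/esym; apply: product_measure_unique => // A' B' mA' mB'; exact: indep.
rewrite fubini_tonelli1 // ge0_integral_distribution //=; first last.
- by move=> y; apply: integral_ge0.
- exact: measurable_fun_fubini_tonelli_F.
apply: eq_integral => w _; rewrite /fubini_F ge0_integral_distribution //.
exact: measurableT_comp mf (measurable_pair1 _).
Qed.

End Independence.

Section Averaging.
Local Open Scope ereal_scope.
Context d d' (Omega : measurableType d) (S : measurableType d') (R : realType)
  (P : probability Omega R).
Variables (V : {mfun Omega >-> R}) (W : {mfun Omega >-> S}) (C : R).
Hypothesis C_ge0 : (0 <= C)%R.
Hypothesis density : forall I A, measurable I -> measurable A ->
  P (V @^-1` I `&` W @^-1` A) <= C%:E * lebesgue_measure I * P (W @^-1` A).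

(** On [S], the law of [W] restricted to the event [V in I] is at most [C * l] times the law of [W];
    integrals of nonnegative functions inherit the comparison. *)
Lemma ge0_integral_density (I : set R) (l : R) (f : S -> \bar R) :
  measurable I -> lebesgue_measure I = l%:E ->
  measurable_fun setT f -> (forall s, 0 <= f s) ->
  \int[P]_(w in V @^-1` I) f (W w) <= (C * l)%:E * \int[P]_w f (W w).
Proof.
move=> mI Il mf f0.
have l0 : (0 <= l)%R by rewrite -lee_fin -Il.
have Cl0 : (0 <= C * l)%R by rewrite mulr_ge0.
have mVI : measurable (V @^-1` I) by rewrite -[X in measurable X]setTI; exact: measurable_funPT.
have mfW : measurable_fun setT (f \o W) by exact: measurableT_comp.
pose m1 : {measure set Omega -> \bar R} := mrestr P mVI.
pose k : {nonneg R} := NngNum Cl0.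
have mW : measurable_fun setT W by exact: measurable_funPT.
pose p1 : {measure set S -> \bar R} :=
  measure_function_pushforward__canonical__measure_function_Measure m1 mW.
pose p2 : {measure set S -> \bar R} := mscale k (distribution P W).
have -> : \int[P]_(w in V @^-1` I) f (W w) = \int[m1]_(w in V @^-1` I) f (W w).
  apply: eq_measure_integral => A mA AVI.
  by rewrite /m1 /= /mrestr; congr (P _); apply/esym/setIidl.
apply: (@le_trans _ _ (\int[m1]_w f (W w))).
  by apply: ge0_subset_integral.
have -> : \int[m1]_w f (W w) = \int[p1]_s f s.
  by rewrite [RHS]ge0_integral_pushforward.
apply: (@le_trans _ _ (\int[p2]_s f s)).
  apply: ge0_le_measure_integral => // A mA.
  rewrite /p1 /p2 /= /pushforward /mscale /m1 /mrestr /= setIC EFinM -Il.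
  exact: density.
by rewrite ge0_integral_mscale //= ge0_integral_distribution.
Qed.

End Averaging.

(** * Integral of the kernel [(|x - a| + b)^-(1 + e)] *)

Section PowerKernel.
Variable R : realType.
Implicit Types (a b e x : R).

Lemma is_derive_powR_shift b e x : 0 < x + b ->
  is_derive x 1 (fun y => (y + b) `^ e) (e * (x + b) `^ (e - 1)).
Proof.
move=> xb.
have h : is_derive x 1 (fun y : R => y + b) 1.
  rewrite -[X in is_derive _ _ _ X]addr0; exact: is_deriveD.
have := @is_derive1_comp _ (fun y => y `^ e) (fun y => y + b) x _ _ (is_derive1_powR e xb) h.
by rewrite mulr1.
Qed.

Lemma cvg_powR_shift b e : 0 < e -> (x + b) `^ (- e) @[x --> +oo] --> (0 : R).
Proof.
move=> e0; apply/cvgrPdist_lt => eps eps0; near=> x.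
have xb : eps `^ (- e^-1) < x + b.
  by rewrite -ltrBlDr; near: x; apply: nbhs_pinfty_gt; rewrite num_real.
have xb0 : 0 < x + b by apply: le_lt_trans xb; exact: powR_ge0.
rewrite sub0r normrN ger0_norm ?powR_ge0 // powRN invf_plt ?posrE ?powR_gt0 //.
have -> : eps^-1 = (eps `^ (- e^-1)) `^ e.
  by rewrite -powRrM mulNr mulVf ?gt_eqF // powR_inv1 // ltW.
by apply: gt0_ltr_powR => //; rewrite nnegrE ?powR_ge0 // ltW.
Unshelve. all: end_near. Qed.

Lemma continuous_powR_abs b e : 0 < b -> continuous (fun x : R => (`|x| + b) `^ e).
Proof.
move=> b0 x.
have xb : 0 < `|x| + b by rewrite ltr_wpDl.
have h1 : {for `|x| + b, continuous (fun y : R => y `^ e)}.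
  apply: differentiable_continuous; apply/derivable1_diffP.
  by apply: derivable_powR; rewrite in_itv /= andbT.
apply: (@continuous_comp _ _ _ (fun x : R => `|x| + b) (fun y => y `^ e)) => //.
by apply: cvgD; [exact: norm_continuous|exact: cvg_cst].
Qed.

Lemma integral_powR_shift b e : 0 < b -> 0 < e ->
  (\int[lebesgue_measure]_(x in `[0%R, +oo[) ((`|x| + b) `^ (- (1 + e)))%:E
   = (e^-1 * b `^ (- e))%:E)%E.
Proof.
move=> b0 e0.
rewrite (@ge0_continuous_FTC2y _ _ (fun x => - e^-1 * (x + b) `^ (- e)) 0 0).
- by rewrite -[LHS]/((0 - (- e^-1 * (0 + b) `^ (- e)))%:E) [0 + b]add0r sub0r mulNr opprK.
- by move=> x _; exact: powR_ge0.
- by apply: continuous_subspaceT; exact: continuous_powR_abs.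
- rewrite -[X in _ --> X](mulr0 (- e^-1)); apply: cvgMr.
  exact: cvg_powR_shift.
- move=> x x0; have xb : 0 < x + b by rewrite addr_gt0.
  by apply: derivableM => //; have [] := is_derive_powR_shift (- e) xb.
- apply: cvg_at_right_filter; apply: cvgMr.
  have xb : 0 < 0 + b by rewrite add0r.
  have [h _] := is_derive_powR_shift (- e) xb.
  have hc : {for 0, continuous (fun x : R => (x + b) `^ (- e))}.
    by apply: differentiable_continuous; apply/derivable1_diffP.
  exact: hc.
- move=> x; rewrite in_itv /= andbT => x0.
  have xb : 0 < x + b by rewrite addr_gt0.
  have h := is_derive_powR_shift (- e) xb.
  have h2 : is_derive x 1 (fun y => - e^-1 * (y + b) `^ (- e)) (- e^-1 * (- e * (x + b) `^ (- e - 1))).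
    exact: is_deriveZ.
  rewrite derive1E derive_val ger0_norm ?ltW // mulrA mulrNN mulVf ?gt_eqF // mul1r.
  by congr (_ `^ _); ring.
Qed.

Lemma integral_powR_kernel a b e : 0 < b -> 0 < e ->
  (\int[lebesgue_measure]_x ((`|x - a| + b) `^ (- (1 + e)))%:E
   = (2 * (e^-1 * b `^ (- e)))%:E)%E.
Proof.
move=> b0 e0.
have hF (x : R) : is_derive x 1 (fun y : R => y + - a) 1.
  rewrite -[X in is_derive _ _ _ X]addr0; exact: is_deriveD.
have F1 : derive1 (fun y : R => y + - a) = cst 1.
  by apply/funext => x; rewrite derive1E; have := hF x => h; rewrite derive_val.
have -> : (\int[lebesgue_measure]_x ((`|x - a| + b) `^ (- (1 + e)))%:E =
  \int[lebesgue_measure]_x ((`|x| + b) `^ (- (1 + e)))%:E)%E.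
  rewrite [RHS](@increasing_ge0_integration_by_substitutionT _ (fun y => y + - a)) //.
  - by apply: eq_integral => x _ /=; rewrite F1 /= mulr1.
  - by move=> x y /=; rewrite ltrD2r.
  - by rewrite F1; move=> x; exact: cst_continuous.
  - by rewrite F1; exact: is_cvg_cst.
  - by rewrite F1; exact: is_cvg_cst.
  - exact: cvg_addrr_Ny.
  - exact: cvg_addrr.
  - exact: continuous_powR_abs.
  - by move=> x; exact: powR_ge0.
rewrite ge0_symfun_integralT; first last.
- by move=> x /=; rewrite normrN.
- exact: continuous_powR_abs.
- by move=> x; exact: powR_ge0.
have -> : [set x : R | 0 <= x] = `[0, +oo[%classic.
  by apply/seteqP; split => x /=; rewrite in_itv /= andbT.
by rewrite integral_powR_shift // EFinM.
Qed.

End PowerKernel.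

(** * Mean of the kernel under a bounded conditional density *)

Lemma lebesgue_measure_segment (R : realType) (x y : R) : x < y ->
  lebesgue_measure (`[x, y]%classic : set R) = (y - x)%:E.
Proof. by move=> xy; rewrite lebesgue_measure_itv /= lte_fin xy. Qed.

Section AveragingKernel.
Context d d' (Omega : measurableType d) (S : measurableType d') (R : realType)
  (P : probability Omega R).
Variables (V : {mfun Omega >-> R}) (W : {mfun Omega >-> S}) (C : R).
Hypothesis C_ge0 : 0 <= C.
Hypothesis density : forall I A, measurable I -> measurable A ->
  (P (V @^-1` I `&` W @^-1` A) <= C%:E * lebesgue_measure I * P (W @^-1` A))%E.
Variables (a b g : S -> R) (eta e : R).
Hypotheses (ma : measurable_fun setT a) (mb : measurable_fun setT b)
  (mg : measurable_fun setT g).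
Hypotheses (eta_gt0 : 0 < eta) (b_ge : forall s, eta <= b s)
  (g_ge0 : forall s, 0 <= g s) (e_gt0 : 0 < e) (e_le1 : e <= 1).

Let f v s := (`|v - a s| + b s) `^ (- (1 + e)) * g s.

Let f_ge0 v s : 0 <= f v s.
Proof. by rewrite mulr_ge0 ?powR_ge0. Qed.

Let mf : measurable_fun setT (fun x : R * S => f x.1 x.2).
Proof.
have m2 : measurable_fun setT (snd : R * S -> S) by exact: measurable_snd.
have m1 : measurable_fun setT (fst : R * S -> R) by exact: measurable_fst.
apply: measurable_funM; last exact: (measurableT_comp mg).
apply: (measurableT_comp (measurable_powR _)).
apply: measurable_funD; last exact: (measurableT_comp mb).
apply: (measurableT_comp (@normr_measurable R setT)) => //.
by apply: measurable_funB => //; exact: (measurableT_comp ma).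
Qed.

(* The kernel varies by a bounded factor on the scale [eta], so it may be replaced by its
   mean over a window of length [eta], for which only the conditional law of [V] matters. *)
Let near_le (u v : R) s : u <= v <= u + eta -> f u s <= 4 * f v s.
Proof.
move=> /andP[uv vu]; rewrite /f mulrA ler_wpM2r // !powRN.
have b0 : 0 < b s := lt_le_trans eta_gt0 (b_ge s).
have p0 (x : R) : 0 < `|x - a s| + b s by rewrite ltr_wpDl.
rewrite ler_pdivlMr ?powR_gt0 // mulrC ler_pdivrMr ?powR_gt0 //.
have h : `|v - a s| + b s <= 2 * (`|u - a s| + b s).
  have : `|v - a s| <= `|u - a s| + eta.
    have -> : v - a s = (u - a s) + (v - u) by ring.
    apply: (le_trans (ler_normD _ _)); rewrite lerD2l ger0_norm; lra.
  have := b_ge s; have := normr_ge0 (u - a s); lra.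
(* The factor 4 bounds [2^(1 + e)], as [e <= 1]. *)
apply: (@le_trans _ _ ((2 * (`|u - a s| + b s)) `^ (1 + e))).
  by apply: ge0_ler_powR; rewrite ?nnegrE ?addr_ge0 ?mulr_ge0 ?(ltW e_gt0) // ?(ltW (p0 _)) // ltW.
rewrite powRM ?(ltW (p0 _)) // ler_wpM2r ?powR_ge0 //.
rewrite (_ : 4 = 2 `^ 2%:R); last by rewrite powR_mulrn // expr2; lra.
by apply: ler_powR; rewrite ?ler1n // (_ : 2%:R = 1 + 1) // lerD2l.
Qed.

(** The condition is read in two ways. At fixed [w], the second variable runs over a window of
    length [eta] starting at [V w]; at fixed [v], the event [v - eta <= V <= v] has conditional
    probability at most [C * eta]. Tonelli passes from one reading to the other. *)
Let h (x : Omega * R) : \bar R :=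
  if (x.2 - eta <= V x.1) && (V x.1 <= x.2) then (f x.2 (W x.1))%:E else 0%E.

Let h_ge0 x : (0 <= h x)%E.
Proof. by rewrite /h; case: ifP; rewrite ?lee_fin. Qed.

Let mfW : measurable_fun setT (fun x : Omega * R => (f x.2 (W x.1))%:E).
Proof.
apply/measurable_EFinP.
pose G (x : Omega * R) : R * S := (x.2, W x.1).
apply: (@measurableT_comp _ _ _ _ _ _ (fun y : R * S => f y.1 y.2) _ G) => //.
apply/measurable_fun_pairP; split; first exact: measurable_snd.
exact: (measurableT_comp (measurable_funPT W) measurable_fst).
Qed.

Let mh : measurable_fun setT h.
Proof.
apply: measurable_fun_ifT => //; apply: measurable_and; apply: measurable_fun_ler.
- apply: measurable_funB => //; exact: measurable_snd.
- exact: (measurableT_comp (measurable_funPT V) measurable_fst).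
- exact: (measurableT_comp (measurable_funPT V) measurable_fst).
- exact: measurable_snd.
Qed.

(** [8 C / e] is the product of [4 / eta] for the window average, [C * eta] for the conditional
    probability of the window and [2 / e] from the integral of the kernel over the line. *)
Lemma ge0_integral_density_kernel :
  (\int[P]_w ((`|V w - a (W w)| + b (W w)) `^ (- (1 + e)) * g (W w))%:E
  <= (8 * C / e)%:E * \int[P]_w (b (W w) `^ (- e) * g (W w))%:E)%E.
Proof.
have mfVW : measurable_fun setT (fun w => f (V w) (W w)).
  pose G w : R * S := (V w, W w).
  apply: (@measurableT_comp _ _ _ _ _ _ (fun y : R * S => f y.1 y.2) _ G) => //.
  by apply/measurable_fun_pairP; split; exact: measurable_funPT.
have mhv w : measurable_fun setT (fun v => h (w, v)).
  exact: (measurableT_comp mh (measurable_pair1 w)).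
have step1 w : ((f (V w) (W w))%:E <= (4 / eta)%:E * \int[lebesgue_measure]_v h (w, v))%E.
  pose D := `[V w, V w + eta]%classic.
  have le1 : ((f (V w) (W w) / 4 * eta)%:E <= \int[lebesgue_measure]_(v in D) h (w, v))%E.
    have -> : (f (V w) (W w) / 4 * eta)%:E = (\int[lebesgue_measure]_(v in D) (cst (f (V w) (W w) / 4)%:E) v)%E.
      have Dl : (lebesgue_measure D = eta%:E)%E.
        rewrite /D lebesgue_measure_segment ?ltrDl //; congr EFin; ring.
      by rewrite integral_cst ?[RHS](congr1 (mule _) Dl) //; exact: measurable_itv.
    apply: ge0_le_integral => //.
    - exact: measurable_itv.
    - by move=> v _; rewrite lee_fin divr_ge0.
    - exact: measurable_funTS (mhv w).
    - move=> v; rewrite /D /= in_itv /= => /andP[v1 v2]; rewrite /h /= v1.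
      have -> : v - eta <= V w by lra.
      by rewrite lee_fin ler_pdivrMr // mulrC near_le // v1.
  have le2 := le_trans le1 (ge0_subset_integral lebesgue_measure
     (measurable_itv _ : measurable D) measurableT (mhv w) (fun _ _ => h_ge0 _) (@subsetT _ D)).
  have -> : (f (V w) (W w))%:E = ((4 / eta)%:E * (f (V w) (W w) / 4 * eta)%:E)%E.
    by rewrite -EFinM; congr (_%:E); field; rewrite gt_eqF.
  by apply: lee_wpmul2l => //; rewrite lee_fin divr_ge0 // ltW.
have mF w : measurable_fun setT (fun v => (f v (W w))%:E).
  exact: (measurableT_comp mfW (measurable_pair1 w)).
have mG v : measurable_fun setT (fun w => (f v (W w))%:E).
  exact: (measurableT_comp mfW (measurable_pair2 v)).
apply: (@le_trans _ _ (\int[P]_w ((4 / eta)%:E * \int[lebesgue_measure]_v h (w, v)))%E).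
  apply: ge0_le_integral => //.
  - by move=> w _; rewrite lee_fin; exact: f_ge0.
  - by apply/measurable_EFinP; exact: mfVW.
  - apply: measurable_funeM.  exact: (@measurable_fun_fubini_tonelli_F _ _ _ _ R lebesgue_measure h mh h_ge0).
  - by move=> w _; exact: step1.
rewrite ge0_integralZl //; last 3 first.
- exact: (@measurable_fun_fubini_tonelli_F _ _ _ _ R lebesgue_measure h mh h_ge0).
- by move=> w _; apply: integral_ge0.
- by rewrite lee_fin divr_ge0 // ltW.
rewrite (@fubini_tonelli _ _ _ _ R P lebesgue_measure h mh h_ge0).
apply: (@le_trans _ _ ((4 / eta)%:E * \int[lebesgue_measure]_v
   ((C * eta)%:E * \int[P]_w (f v (W w))%:E))%E).
  apply: lee_wpmul2l; first by rewrite lee_fin divr_ge0 // ltW.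
  apply: ge0_le_integral => //.
  - by move=> v _; apply: integral_ge0.
  - exact: (@measurable_fun_fubini_tonelli_G _ _ _ _ R P h mh h_ge0).
  - apply: measurable_funeM.
    by apply: (@measurable_fun_fubini_tonelli_G _ _ _ _ R P _ mfW) => x; rewrite lee_fin.
  move=> v _; pose I := `[v - eta, v]%classic.
  have -> : (\int[P]_w h (w, v) = \int[P]_(w in V @^-1` I) (f v (W w))%:E)%E.
    rewrite [RHS]integral_mkcond; apply: eq_integral => w _.
    by rewrite /h /patch /= mem_setE /I /=; congr (if _ then _ else _); rewrite in_itv.
  apply: (ge0_integral_density C_ge0 density (f := fun s => (f v s)%:E)) => //.
  + exact: measurable_itv.
  + rewrite /I lebesgue_measure_segment ?ltrBlDr ?ltrDl //; congr EFin; ring.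
  + apply/measurable_EFinP; exact: (measurableT_comp mf (measurable_pair1 v)).
  + by move=> s; rewrite lee_fin.
have Fv_ge0 v : (0 <= \int[P]_w (f v (W w))%:E)%E.
  by apply: integral_ge0 => w _; rewrite lee_fin.
have -> : (\int[lebesgue_measure]_v ((C * eta)%:E * \int[P]_w (f v (W w))%:E)
   = (C * eta)%:E * \int[lebesgue_measure]_v \int[P]_w (f v (W w))%:E)%E.
  apply: ge0_integralZl => //; last by rewrite lee_fin mulr_ge0 // ltW.
  by apply: (@measurable_fun_fubini_tonelli_G _ _ _ _ R P _ mfW) => x; rewrite lee_fin.
rewrite -(@fubini_tonelli _ _ _ _ R P lebesgue_measure _ mfW) => [|x]; last by rewrite lee_fin.
have int_f w : (\int[lebesgue_measure]_v (f v (W w))%:E = (2 / e)%:E * (b (W w) `^ (- e) * g (W w))%:E)%E.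
  have bw : 0 < b (W w) := lt_le_trans eta_gt0 (b_ge (W w)).
  under eq_integral do rewrite EFinM.
  rewrite ge0_integralZr // ?lee_fin //.
  - by rewrite integral_powR_kernel // -!EFinM; congr EFin; ring.
  - apply/measurable_EFinP; apply: (measurableT_comp (measurable_powR _)).
    apply: measurable_funD; last exact: measurable_cst.
    apply: (measurableT_comp (@normr_measurable R setT)) => //.
    by apply: measurable_funB => //; exact: measurable_cst.
  - by move=> v _; rewrite lee_fin powR_ge0.
under eq_integral do rewrite int_f.
rewrite ge0_integralZl //; last 3 first.
- apply/measurable_EFinP; apply: measurable_funM.
    apply: (measurableT_comp (measurable_powR _)).
    exact: (measurableT_comp mb (measurable_funPT W)).
  exact: (measurableT_comp mg (measurable_funPT W)).
- by move=> w _; rewrite lee_fin mulr_ge0 ?powR_ge0.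
- by rewrite lee_fin divr_ge0 // ltW.
rewrite !muleA -!EFinM le_eqVlt; apply/orP; left; apply/eqP; congr (_%:E * _)%E.
by field; rewrite !gt_eqF.
Qed.
End AveragingKernel.

(** * Measurability of complex functions and of resolvent entries *)

Section ComplexMeasurability.
Context d (T : measurableType d) (R : realType).
Implicit Types f g : T -> R[i].

Definition cmeas f := measurable_fun setT (fun t => Re (f t)) /\
  measurable_fun setT (fun t => Im (f t)).

Lemma measurable_realV (u : T -> R) : measurable_fun setT u ->
  (forall t, 0 <= u t) -> measurable_fun setT (fun t => (u t)^-1).
Proof.
move=> mu u0; rewrite (_ : (fun t => _) = fun t => u t `^ (-1)).
  exact: (measurableT_comp (measurable_powR _) mu).
by apply/funext => t; rewrite powR_inv1.
Qed.

Lemma cmeas_real (u : T -> R) : measurable_fun setT u -> cmeas (fun t => (u t)%:C).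
Proof. by move=> mu; split => //=; exact: measurable_cst. Qed.

Lemma cmeas_cst (c : R[i]) : cmeas (fun=> c).
Proof. by split; exact: measurable_cst. Qed.

Lemma cmeasD f g : cmeas f -> cmeas g -> cmeas (fun t => f t + g t).
Proof.
move=> [f1 f2] [g1 g2]; split.
  by under eq_fun do rewrite cReD; exact: measurable_funD.
by under eq_fun do rewrite cImD; exact: measurable_funD.
Qed.

Lemma cmeasN f : cmeas f -> cmeas (fun t => - f t).
Proof.
move=> [f1 f2]; split.
  under eq_fun do rewrite cReN; exact: measurableT_comp.
under eq_fun do rewrite cImN; exact: measurableT_comp.
Qed.

Lemma cmeasM f g : cmeas f -> cmeas g -> cmeas (fun t => f t * g t).
Proof.
move=> [f1 f2] [g1 g2]; split.
  by under eq_fun do rewrite cReM; apply: measurable_funB; exact: measurable_funM.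
by under eq_fun do rewrite cImM; apply: measurable_funD; exact: measurable_funM.
Qed.

Lemma cmeas_nc2 f : cmeas f -> measurable_fun setT (fun t => nc (f t) ^+ 2).
Proof.
move=> [f1 f2]; under eq_fun do rewrite ncE2.
by apply: measurable_funD; exact: measurable_funX.
Qed.

Lemma cmeas_nc f : cmeas f -> measurable_fun setT (fun t => nc (f t)).
Proof.
move=> /cmeas_nc2 mf.
rewrite (_ : (fun t => _) = fun t => Num.sqrt (nc (f t) ^+ 2)).
  apply: (measurableT_comp _ mf); apply: continuous_measurable_fun.
  exact: sqrt_continuous.
by apply/funext => t; rewrite sqrtr_sqr ger0_norm // nc_ge0.
Qed.

Lemma cmeasV f : cmeas f -> cmeas (fun t => (f t)^-1).
Proof.
move=> mf; have [f1 f2] := mf.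
have mV : measurable_fun setT (fun t => (nc (f t) ^+ 2)^-1).
  by apply: measurable_realV; [exact: cmeas_nc2|move=> t; exact: sqr_ge0].
split.
  by under eq_fun do rewrite cReV; exact: measurable_funM.
under eq_fun do rewrite cImV; apply: measurable_funM => //.
exact: measurableT_comp.
Qed.

Lemma cmeas_sum (I : Type) (r : seq I) (F : I -> T -> R[i]) :
  (forall i, cmeas (F i)) -> cmeas (fun t => \sum_(i <- r) F i t).
Proof.
move=> mF; elim: r => [|i r IH].
  by under eq_fun do rewrite big_nil; exact: cmeas_cst.
by under eq_fun do rewrite big_cons; exact: cmeasD.
Qed.

Lemma cmeas_prod (I : Type) (r : seq I) (F : I -> T -> R[i]) :
  (forall i, cmeas (F i)) -> cmeas (fun t => \prod_(i <- r) F i t).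
Proof.
move=> mF; elim: r => [|i r IH].
  by under eq_fun do rewrite big_nil; exact: cmeas_cst.
by under eq_fun do rewrite big_cons; exact: cmeasM.
Qed.

Lemma cmeas_det n (M : T -> 'M[R[i]]_n) :
  (forall i j, cmeas (fun t => M t i j)) -> cmeas (fun t => \det (M t)).
Proof.
move=> mM; apply: cmeas_sum => s; apply: cmeasM; first exact: cmeas_cst.
by apply: cmeas_prod => i.
Qed.

(** By Cramer's rule an entry is a cofactor divided by the determinant, both polynomial in the
    entries of [h]. *)
Lemma cmeas_resolvent n (h : T -> 'I_n -> 'I_n -> R) (z : R[i]) i j :
  (forall i j, measurable_fun setT (fun t => h t i j)) ->
  (forall t, symf (h t)) -> 0 < Im z ->
  cmeas (fun t => resolvent (h t) z i j).
Proof.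
move=> mh hs z0.
rewrite (_ : (fun t => _) = fun t => (\det (cmx (h t) - z%:M))^-1 *
    ((-1) ^+ (j + i) * \det (row' j (col' i (cmx (h t) - z%:M))))); last first.
  by apply/funext => t; rewrite /resolvent /invmx resolvent_unit // mxE [\adj _ _ _]mxE.
have mM k l : cmeas (fun t => (h t k l)%:C - z *+ (k == l)).
  by apply: cmeasD; [exact: cmeas_real|exact: cmeas_cst].
apply: cmeasM.
  by apply/cmeasV/cmeas_det => k l; under eq_fun do rewrite !mxE.
apply: cmeasM; first exact: cmeas_cst.
by apply: cmeas_det => k l; under eq_fun do rewrite !mxE.
Qed.

End ComplexMeasurability.

(** * Averages of [b / |V + zeta|^2] and of [1 / |V + zeta|] *)

Section RankOneAveraging.
Context d d' (Omega : measurableType d) (S : measurableType d') (R : realType)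
  (P : probability Omega R).
Variables (V : {mfun Omega >-> R}) (W : {mfun Omega >-> S}) (C : R).
Hypothesis C_ge0 : 0 <= C.
Hypothesis density : forall I A, measurable I -> measurable A ->
  (P (V @^-1` I `&` W @^-1` A) <= C%:E * lebesgue_measure I * P (W @^-1` A))%E.
Variables (a b g : S -> R) (eta : R).
Hypotheses (ma : measurable_fun setT a) (mb : measurable_fun setT b)
  (mg : measurable_fun setT g).
Hypotheses (eta_gt0 : 0 < eta) (b_ge : forall s, eta <= b s)
  (g_ge0 : forall s, 0 <= g s).

Local Notation zeta s := (a s +i* - b s : R[i]).

Let b_gt0 s : 0 < b s := lt_le_trans eta_gt0 (b_ge s).

Let q_gt0 (v : R) s : 0 < `|v + a s| + b s.
Proof. by rewrite ltr_wpDl. Qed.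

Let q_le (v : R) s : `|v + a s| + b s <= 2 * nc (v%:C + zeta s).
Proof.
have := Re_le_nc (v%:C + zeta s); have := Im_le_nc (v%:C + zeta s).
rewrite /= add0r normrN (gtr0_norm (b_gt0 s)).
set x := Num.sqrt _; lra.
Qed.

Let n_gt0 v s : 0 < nc (v%:C + zeta s).
Proof. by have := q_gt0 v s; have := q_le v s; lra. Qed.

Let nV_le v s : (nc (v%:C + zeta s))^-1 <= 2 * (`|v - - a s| + b s)^-1.
Proof.
have q0 := q_gt0 v s; have n0 := n_gt0 v s; have := q_le v s; rewrite opprK => h.
by rewrite ler_pdivlMr // mulrC ler_pdivrMr.
Qed.

Let pt1 v s : b s / nc (v%:C + zeta s) ^+ 2 * g s
  <= (`|v - - a s| + b s) `^ (- (1 + 1)) * (4 * b s * g s).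
Proof.
have h := nV_le v s; have q0 := q_gt0 v s; rewrite -[a s]opprK in q0.
rewrite -[1 + 1]/(2%:R) powR_invn ?(ltW q0) // -!exprVn.
have n0 : 0 <= (nc (v%:C + zeta s))^-1 by rewrite invr_ge0 ltW.
have : (nc (v%:C + zeta s))^-1 ^+ 2 <= (2 * (`|v - - a s| + b s)^-1) ^+ 2.
  by rewrite lerXn2r // nnegrE // mulr_ge0 // invr_ge0 ltW.
rewrite exprMn => h2.
have bg : 0 <= b s * g s by rewrite mulr_ge0 // ltW.
apply: le_trans (_ : b s * g s * (2 ^+ 2 * (`|v - - a s| + b s)^-1 ^+ 2) <= _).
  by rewrite mulrAC ler_wpM2l.
by rewrite le_eqVlt; apply/orP; left; apply/eqP; ring.
Qed.

(** [1 / (|v| + b)] is not integrable at infinity; [u <= 1 + u^(1 + e)] trades it for a power that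
    is. *)
Let pt2 e v s : 0 < e -> e <= 1 -> (nc (v%:C + zeta s))^-1 * g s
  <= g s + (`|v - - a s| + b s) `^ (- (1 + e)) * (4 * g s).
Proof.
move=> e0 e1; have h := nV_le v s; have q0 := q_gt0 v s; rewrite -[a s]opprK in q0.
have n0 : 0 <= (nc (v%:C + zeta s))^-1 by rewrite invr_ge0 ltW.
move: (_^-1) h n0 => x h n0.
have h1 : x <= 1 + x `^ (1 + e).
  have [x1|x1] := leP x 1; first by rewrite (le_trans x1) // lerDl powR_ge0.
  by rewrite (le_trans (le1r_powR (ltW x1) (_ : 1 <= 1 + e))) ?lerDr ?lerDl // ltW.
have h2 : x `^ (1 + e) <= 4 * (`|v - - a s| + b s) `^ (- (1 + e)).
  have q0' : 0 <= (`|v - - a s| + b s)^-1 by rewrite invr_ge0 ltW.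
  apply: (@le_trans _ _ ((2 * (`|v - - a s| + b s)^-1) `^ (1 + e))).
    by apply: ge0_ler_powR; rewrite ?nnegrE ?mulr_ge0 // addr_ge0 // ltW.
  rewrite powRM // -(powR_inv1 (ltW q0)) -powRrM mulN1r ler_wpM2r ?powR_ge0 //.
  rewrite (_ : 4 = 2 `^ 2%:R); last by rewrite powR_mulrn // expr2; ring.
  by apply: ler_powR; rewrite ?ler1n // (_ : 2%:R = 1 + 1) // lerD2l.
have h3 : x <= 1 + 4 * (`|v - - a s| + b s) `^ (- (1 + e)).
  by apply: (le_trans h1); rewrite lerD2l.
apply: (le_trans (ler_wpM2r (g_ge0 s) h3)).
by rewrite le_eqVlt; apply/orP; left; apply/eqP; ring.
Qed.

Let mma : measurable_fun setT (fun s => - a s).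
Proof. exact: measurableT_comp. Qed.

Let mzeta : cmeas (fun w => (V w)%:C + zeta (W w)).
Proof.
apply: cmeasD; first by apply: cmeas_real; exact: measurable_funPT.
split => /=; first exact: measurableT_comp ma (measurable_funPT W).
by apply: measurableT_comp => //; exact: measurableT_comp mb (measurable_funPT W).
Qed.

Let mq : measurable_fun setT (fun w => `|V w - - a (W w)| + b (W w)).
Proof.
apply: measurable_funD; last exact: measurableT_comp mb (measurable_funPT W).
apply: (measurableT_comp (@normr_measurable R setT)) => //.
apply: measurable_funB; first exact: measurable_funPT.
exact: measurableT_comp mma (measurable_funPT W).
Qed.

(** The kernel is used with [e = 1]. Its mean costs [1 / b], which the numerator [b] cancels, so the
    bound is uniform in [eta]. In [32 = 8 * 4], the 4 comes from [|v + a| + b <= 2 |v + zeta|],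
    squared. *)
Lemma integral_Im_rank_one :
  (\int[P]_w (b (W w) / nc ((V w)%:C + zeta (W w)) ^+ 2 * g (W w))%:E
   <= (32 * C)%:E * \int[P]_w (g (W w))%:E)%E.
Proof.
pose g' s := 4 * b s * g s.
have mg' : measurable_fun setT g'.
  by apply: measurable_funM => //; apply: measurable_funM => //; exact: measurable_cst.
have g'0 s : 0 <= g' s by rewrite !mulr_ge0 // ltW.
have := ge0_integral_density_kernel C_ge0 density mma mb mg' eta_gt0 b_ge g'0 ltr01 (lexx 1).
set L := (X in (X <= _)%E); set U := (X in (_ <= X)%E) => h.
have leL : (\int[P]_w (b (W w) / nc ((V w)%:C + zeta (W w)) ^+ 2 * g (W w))%:E <= L)%E.
  apply: ge0_le_integral => //.
  - by move=> w _; rewrite lee_fin !mulr_ge0 ?invr_ge0 ?sqr_ge0 // ltW.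
  - apply/measurable_EFinP; apply: measurable_funM; last exact: measurableT_comp mg (measurable_funPT W).
    apply: measurable_funM; first exact: measurableT_comp mb (measurable_funPT W).
    apply: measurable_realV; last by move=> t; exact: sqr_ge0.
    exact: cmeas_nc2.
  - apply/measurable_EFinP; apply: measurable_funM; last exact: measurableT_comp mg' (measurable_funPT W).
    by apply: (measurableT_comp (measurable_powR _)); exact: mq.
  by move=> w _; rewrite lee_fin; exact: pt1.
apply: (le_trans leL); apply: (le_trans h); rewrite /U.
have -> : (fun w => (b (W w) `^ (- 1) * g' (W w))%:E) = fun w => (4%:E * (g (W w))%:E)%E.
  by apply/funext => w; rewrite powR_inv1 ?(ltW (b_gt0 _)) // /g' -EFinM; congr EFin; field; rewrite gt_eqF.
rewrite ge0_integralZl //; last 2 first.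
- by apply/measurable_EFinP; exact: measurableT_comp mg (measurable_funPT W).
- by move=> w _; rewrite lee_fin.
by rewrite muleA -EFinM le_eqVlt; apply/orP; left; apply/eqP; congr (_%:E * _)%E; field.
Qed.

(** Here no numerator cancels [b^(-e)]; it is bounded by [eta^(-e)], as [b >= eta]. *)
Lemma integral_nc_rank_one e : 0 < e -> e <= 1 ->
  (\int[P]_w ((nc ((V w)%:C + zeta (W w)))^-1 * g (W w))%:E
   <= (1 + 32 * C / e * eta `^ (- e))%:E * \int[P]_w (g (W w))%:E)%E.
Proof.
move=> e0 e1; pose g' s := 4 * g s.
have mg' : measurable_fun setT g'.
  by apply: measurable_funM => //; exact: measurable_cst.
have g'0 s : 0 <= g' s by rewrite !mulr_ge0 // ltW.
have mgW : measurable_fun setT (fun w => g (W w)) by exact: measurableT_comp mg (measurable_funPT W).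
have mg'W : measurable_fun setT (fun w => g' (W w)) by exact: measurableT_comp mg' (measurable_funPT W).
have := ge0_integral_density_kernel C_ge0 density mma mb mg' eta_gt0 b_ge g'0 e0 e1.
set L := (X in (X <= _)%E); set U := (X in (_ <= X)%E) => h.
have mL : measurable_fun setT (fun w => ((`|V w - - a (W w)| + b (W w)) `^ (- (1 + e)) * g' (W w))%:E).
  apply/measurable_EFinP; apply: measurable_funM => //.
  by apply: (measurableT_comp (measurable_powR _)); exact: mq.
have leL : (\int[P]_w ((nc ((V w)%:C + zeta (W w)))^-1 * g (W w))%:E <=
    \int[P]_w (g (W w))%:E + L)%E.
  rewrite -ge0_integralD //; last 3 first.
  - by move=> w _; rewrite lee_fin.
  - exact/measurable_EFinP.
  - by move=> w _; rewrite lee_fin mulr_ge0 // powR_ge0.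
  apply: ge0_le_integral => //.
  - by move=> w _; rewrite lee_fin mulr_ge0 // invr_ge0 nc_ge0.
  - apply/measurable_EFinP; apply: measurable_funM => //.
    apply: measurable_realV; last by move=> t; exact: nc_ge0.
    exact: cmeas_nc.
  - by apply: emeasurable_funD => //; exact/measurable_EFinP.
  by move=> w _; rewrite -EFinD lee_fin; exact: pt2.
have Ig0 : (0 <= \int[P]_w (g (W w))%:E)%E by apply: integral_ge0 => w _; rewrite lee_fin.
have c0 : 0 <= 32 * C / e * eta `^ (- e).
  by rewrite !mulr_ge0 ?invr_ge0 ?powR_ge0 // ltW.
apply: (le_trans leL); rewrite EFinD ge0_muleDl ?lee_fin // mul1e.
apply: leeD2l; apply: (le_trans h); rewrite /U.
apply: (@le_trans _ _ ((8 * C / e)%:E * ((4 * eta `^ (- e))%:E * \int[P]_w (g (W w))%:E))%E).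
  apply: lee_wpmul2l; first by rewrite lee_fin !mulr_ge0 // invr_ge0 ltW.
  rewrite -ge0_integralZl //; last 3 first.
  - exact/measurable_EFinP.
  - by move=> w _; rewrite lee_fin.
  - by rewrite lee_fin mulr_ge0 // powR_ge0.
  apply: ge0_le_integral => //.
  - by move=> w _; rewrite lee_fin mulr_ge0 // powR_ge0.
  - apply/measurable_EFinP; apply: measurable_funM => //.
    apply: (measurableT_comp (measurable_powR _)).
    exact: measurableT_comp mb (measurable_funPT W).
  - by apply: measurable_funeM; exact/measurable_EFinP.
  move=> w _; rewrite -EFinM lee_fin /g' mulrA ler_wpM2r // mulrC ler_wpM2l //.
  rewrite !powRN lef_pV2 ?posrE ?powR_gt0 //.
  by apply: ge0_ler_powR; rewrite ?nnegrE // ltW.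
rewrite muleA -EFinM le_eqVlt; apply/orP; left; apply/eqP; congr (_%:E * _)%E; ring.
Qed.

End RankOneAveraging.

(** * Wegner and Minami estimates *)

Section DiagonalPotential.
Variables (R : realType) (n : nat).
Implicit Types (A : 'I_n -> 'I_n -> R) (v : 'I_n -> R).

Definition with_diag A v i j : R := A i j + v i *+ (i == j).
Definition erase x v i := if i == x then 0 else v i.

Lemma with_diag_sym A v : symf A -> symf (with_diag A v).
Proof. by move=> As i j; rewrite /with_diag As eq_sym; case: eqP => [->|]. Qed.

Lemma with_diag_erase A x v :
  with_diag A v = add_site (with_diag A (erase x v)) x (v x).
Proof.
apply/funext => i; apply/funext => j; rewrite /add_site /with_diag /erase.
have [->|ix] := eqVneq i x; last by rewrite mulr0n addr0.
by rewrite eq_sym; case: eqP => _; rewrite ?mulr0n ?mul0rn ?addr0.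
Qed.

Lemma measurable_with_diag d (S : measurableType d) (A : S -> 'I_n -> 'I_n -> R)
    (u : S -> 'I_n -> R) :
  (forall i j, measurable_fun setT (fun s => A s i j)) ->
  (forall i, measurable_fun setT (fun s => u s i)) ->
  forall i j, measurable_fun setT (fun s => with_diag (A s) (u s) i j).
Proof.
move=> mA mu i j; apply: measurable_funD => //.
by case: eqP => _; [exact: mu|exact: measurable_cst].
Qed.

End DiagonalPotential.

Section Anderson.
Context d (Omega : measurableType d) (R : realType) (P : probability Omega R).
Variables (n : nat) (V : 'I_n -> Omega -> R) (C : R).
Hypothesis C_ge0 : 0 <= C.
Hypothesis mV : forall x, measurable_fun setT (V x).
Hypothesis density : forall (x : 'I_n) (I : set R), measurable I ->
  forall A, gen_sigma [set y | y != x] V A ->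
  (P (V x @^-1` I `&` A) <= C%:E * lebesgue_measure I * P A)%E.
Variable z : R[i].
Hypothesis z_gt0 : 0 < Im z.

(** The density hypothesis concerns events generated by the other sites. With this sigma-algebra put
    on the points of [Omega] and the identity as the random variable [W x], it becomes the
    hypothesis of the averaging lemmas on a pair [V], [W]. *)
Definition off_site (x : 'I_n) : Type := g_sigma_algebraType
  (\bigcup_(i in [set y | y != x]) [set V i @^-1` A | A in (@measurable _ R)]).
HB.instance Definition _ x := Measurable.on (off_site x).

Lemma measurable_off_site x y : y != x ->
  measurable_fun setT (V y : off_site x -> R).
Proof.
move=> yx _ B mB; rewrite setTI; apply: sub_sigma_algebra.
by exists y => //; exists B.
Qed.

Let W x : Omega -> off_site x := id.

Let mW x : measurable_fun setT (W x).
Proof.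
move=> _ B mB; rewrite setTI; rewrite -[X in measurable X]/(B).
suff : gen_sigma [set y | y != x] V `<=` measurable by apply.
apply: smallest_sub; first exact: sigma_algebra_measurable.
move=> _ [y _ [D mD <-]]; rewrite -[X in measurable X]setTI; exact: mV.
Qed.
HB.instance Definition _ x := isMeasurableFun.Build _ _ _ _ (V x) (mV x).
HB.instance Definition _ x := isMeasurableFun.Build _ _ _ _ (W x) (@mW x).

Let densityW x I (A : set (off_site x)) : measurable I -> measurable A ->
  (P (V x @^-1` I `&` W x @^-1` A) <= C%:E * lebesgue_measure I * P (W x @^-1` A))%E.
Proof. by move=> mI mA; exact: density. Qed.

Section OneSite.
Variables (x : 'I_n) (k : off_site x -> 'I_n -> 'I_n -> R).
Hypotheses (mk : forall i j, measurable_fun setT (fun s => k s i j))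
  (ks : forall s, symf (k s)).
Variable g : off_site x -> R.
Hypotheses (mg : measurable_fun setT g) (g_ge0 : forall s, 0 <= g s).
Let G (w : Omega) := resolvent (add_site (k w) x (V x w)) z.

Let mzeta : cmeas (fun s : off_site x => (resolvent (k s) z x x)^-1).
Proof. by apply: cmeasV; exact: cmeas_resolvent. Qed.

Let complexE (c : R[i]) : Re c +i* - - Im c = c.
Proof. by case: c => u v; rewrite opprK. Qed.

Lemma spectral_averaging_Im :
  (\int[P]_w (Im (G w x x) * g w)%:E <= (32 * C)%:E * \int[P]_w (g w)%:E)%E.
Proof.
have [mRe mIm] := mzeta.
have mIm' : measurable_fun setT (fun s => - Im (resolvent (k s) z x x)^-1).
  exact: measurableT_comp.
have := integral_Im_rank_one C_ge0 (@densityW x) mRe mIm' mg z_gt0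
  (fun s => ImV_resolvent_diag (ks s) z_gt0 x) g_ge0.
congr (_ <= _)%E; apply: eq_integral => w _.
by rewrite Im_resolvent_add_site_diag // complexE.
Qed.

Lemma spectral_averaging_nc e : 0 < e -> e <= 1 ->
  (\int[P]_w (nc (G w x x) * g w)%:E
   <= (1 + 32 * C / e * Im z `^ (- e))%:E * \int[P]_w (g w)%:E)%E.
Proof.
move=> e0 e1; have [mRe mIm] := mzeta.
have mIm' : measurable_fun setT (fun s => - Im (resolvent (k s) z x x)^-1).
  exact: measurableT_comp.
have := integral_nc_rank_one C_ge0 (@densityW x) mRe mIm' mg z_gt0
  (fun s => ImV_resolvent_diag (ks s) z_gt0 x) g_ge0 e0 e1.
congr (_ <= _)%E; apply: eq_integral => w _.
by rewrite nc_resolvent_add_site_diag // complexE.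
Qed.

End OneSite.

Variable A : 'I_n -> 'I_n -> R.
Hypothesis As : symf A.

Local Notation H v := (with_diag A v).
Local Notation v w := (fun i => V i w).
Local Notation G w := (resolvent (H (v w)) z).

Let measurable_erase x (y : 'I_n) :
  measurable_fun setT (fun s : off_site x => erase x (v s) y).
Proof.
rewrite /erase; case: eqVneq => [_|yx]; first exact: measurable_cst.
exact: measurable_off_site.
Qed.

Let measurable_H d' (T : measurableType d') (u : T -> 'I_n -> R) :
  (forall i, measurable_fun setT (fun t => u t i)) ->
  forall i j, measurable_fun setT (fun t => H (u t) i j).
Proof. by apply: measurable_with_diag => i j; exact: measurable_cst. Qed.

Let measurable_erase2 x y (i : 'I_n) :
  measurable_fun setT (fun s : off_site y => erase y (erase x (v s)) i).
Proof.
rewrite /erase; case: eqVneq => [_|iy]; first exact: measurable_cst.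
case: eqVneq => _; first exact: measurable_cst.
exact: measurable_off_site.
Qed.

Let mG x i j : cmeas (fun s : off_site x => resolvent (H (erase x (v s))) z i j).
Proof.
apply: cmeas_resolvent => // [k l|s]; last exact: with_diag_sym.
by apply: measurable_H => m; exact: measurable_erase.
Qed.

Let int1 : (\int[P]_w (1%:E : \bar R) = 1)%E.
Proof. rewrite integral_cst // mul1e; exact: probability_setT. Qed.

Lemma wegner x : (\int[P]_w (Im (G w x x))%:E <= (32 * C)%:E)%E.
Proof.
have mk := measurable_H (@measurable_erase x).
have := spectral_averaging_Im mk (fun s => with_diag_sym _ As) (measurable_cst (1 : R)) (fun=> ler01).
rewrite int1 mule1; congr (_ <= _)%E; apply: eq_integral => w _.
by rewrite /= mulr1 -with_diag_erase.
Qed.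

Let GE x w : G w = resolvent (add_site (H (erase x (v w))) x (V x w)) z.
Proof. by rewrite -with_diag_erase. Qed.

Let mGo i j : cmeas (fun w => G w i j).
Proof.
apply: cmeas_resolvent => // [k l|w]; last exact: with_diag_sym.
exact: measurable_H.
Qed.

Let mEG x i j : cmeas (fun w : Omega => resolvent (H (erase x (v w))) z i j).
Proof.
have [m1 m2] := mG x i j.
by split; [exact: measurableT_comp m1 (@mW x)|exact: measurableT_comp m2 (@mW x)].
Qed.

Let erase2 x y w : x != y -> H (erase x (v w)) =
  add_site (H (erase y (erase x (v w)))) y (V y w).
Proof.
move=> xy; rewrite [LHS](with_diag_erase _ y); congr (add_site _ y _).
by rewrite /erase eq_sym (negPf xy).
Qed.

(** By [minor_Im_le], up to [(Im G_xy)^2] the factor at [y] may be computed with the potential at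
    [x] erased. It is then free of [V x], and the two sites are averaged one after the other. The
    error stays on the right until it is summed over [y] by Ward. *)
Lemma minami x y : x != y ->
  (\int[P]_w (Im (G w x x) * Im (G w y y))%:E
   <= ((32 * C) ^+ 2)%:E + \int[P]_w (Im (G w x y) ^+ 2)%:E)%E.
Proof.
move=> xy; pose g w := Im (resolvent (H (erase x (v w))) z y y).
have g0 w : 0 <= g w by apply: Im_resolvent_ge0 => //; exact: with_diag_sym.
have G0 i w : 0 <= Im (G w i i) by apply: Im_resolvent_ge0 => //; exact: with_diag_sym.
have mIm i j : measurable_fun setT (fun w => Im (G w i j)) by have [] := mGo i j.
have mg : measurable_fun setT g by have [] := mEG x y y.
apply: (@le_trans _ _ (\int[P]_w (Im (G w x x) * g w)%:E + \int[P]_w (Im (G w x y) ^+ 2)%:E)%E).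
  rewrite -ge0_integralD //; last 4 first.
  - by move=> w _; rewrite lee_fin mulr_ge0.
  - by apply/measurable_EFinP; exact: measurable_funM.
  - by move=> w _; rewrite lee_fin sqr_ge0.
  - by apply/measurable_EFinP; exact: measurable_funX.
  apply: ge0_le_integral => //.
  - by move=> w _; rewrite lee_fin mulr_ge0.
  - by apply/measurable_EFinP; exact: measurable_funM.
  - apply: emeasurable_funD; apply/measurable_EFinP.
      exact: measurable_funM.
    exact: measurable_funX.
  move=> w _; rewrite -EFinD lee_fin -lerBlDr /g (GE x).
  by apply: minor_Im_le => //; exact: with_diag_sym.
apply: leeD2r.
have mk := measurable_H (@measurable_erase x).
have [_ mg'] := mG x y y.
have := spectral_averaging_Im mk (fun s => with_diag_sym _ As) mg' g0.
under eq_integral do rewrite -with_diag_erase.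
move=> /le_trans; apply; rewrite expr2 (EFinM (32 * C) (32 * C)); apply: lee_wpmul2l.
  by rewrite lee_fin mulr_ge0.
have mk2 := measurable_H (@measurable_erase2 x y).
have := spectral_averaging_Im mk2 (fun s => with_diag_sym _ As) (measurable_cst (1 : R)) (fun=> ler01).
rewrite int1 mule1; congr (_ <= _)%E; apply: eq_integral => w _.
by rewrite /= mulr1 -erase2.
Qed.

(** After the average over [V x], the remaining factor [K] is itself [1 / |V y + gamma|] with
    [gamma] free of both [V x] and [V y]; the second average has the same form as the first. *)
Lemma minor_moment x y e : x != y -> 0 < e -> e <= 1 ->
  (\int[P]_w (nc (G w x x * G w y y - G w x y ^+ 2))%:E
   <= ((1 + 32 * C / e * Im z `^ (- e)) ^+ 2)%:E)%E.
Proof.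
move=> xy e0 e1; set L := 1 + _.
have L0 : 0 <= L by rewrite /L addr_ge0 // !mulr_ge0 ?invr_ge0 ?powR_ge0 // ltW.
pose K w := let g := resolvent (H (erase x (v w))) z in
  nc (g y y - g x y ^+ 2 / g x x).
have mK : measurable_fun setT (fun w : off_site x => K w).
  apply: cmeas_nc; apply: cmeasD; first exact: mG.
  apply: cmeasN; apply: cmeasM; last by apply: cmeasV; exact: mG.
  rewrite (_ : (fun _ => _) = fun w : off_site x =>
     resolvent (H (erase x (v w))) z x y * resolvent (H (erase x (v w))) z x y) //.
  by apply: cmeasM; exact: mG.
have K0 w : 0 <= K w by exact: nc_ge0.
have -> : (\int[P]_w (nc (G w x x * G w y y - G w x y ^+ 2))%:E =
   \int[P]_w (nc (G w x x) * K w)%:E)%E.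
  apply: eq_integral => w _; congr EFin; rewrite (GE x) minor_resolvent ?Normc.normcM //.
  exact: with_diag_sym.
have mk := measurable_H (@measurable_erase x).
have := spectral_averaging_nc mk (fun s => with_diag_sym _ As) mK K0 e0 e1.
under eq_integral do rewrite -with_diag_erase.
move=> /le_trans; apply; rewrite expr2 (EFinM L L); apply: lee_wpmul2l; first by rewrite lee_fin.
have mk2 := measurable_H (@measurable_erase2 x y).
pose h (w : off_site y) := H (erase y (erase x (v w))).
have hs w : symf (h w) by exact: with_diag_sym.
have mh2 i j : cmeas (fun w => resolvent (h w) z i j).
  by apply: cmeas_resolvent => //; exact: mk2.
have mgamma : cmeas (fun w => schur_gamma (h w) z x y).
  apply: cmeasV; apply: cmeasD => //; apply: cmeasN; apply: cmeasM; last exact: cmeasV.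
  rewrite (_ : (fun _ => _) = fun w => resolvent (h w) z x y * resolvent (h w) z x y) //.
  exact: cmeasM.
have [mRe mIm] := mgamma.
have mIm' : measurable_fun setT (fun s => - Im (schur_gamma (h s) z x y)).
  exact: measurableT_comp.
have := integral_nc_rank_one C_ge0 (@densityW y) mRe mIm' (measurable_cst (1 : R)) z_gt0
  (fun s => Im_schur_gamma (hs s) z_gt0 xy) (fun=> ler01) e0 e1.
rewrite int1 mule1; congr (_ <= _)%E; apply: eq_integral => w _.
rewrite /= mulr1 /K (erase2 _ xy) schur_add_site //; last exact: with_diag_sym.
by case: (schur_gamma _ _ _ _) => a b; rewrite opprK.
Qed.

End Anderson.

(** * Independence along the flow *)

Section PiSystems.
Context d (Omega : measurableType d) (R : realType) (P : probability Omega R).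

Let indep_sigma_l (G : set (set Omega)) (B : set Omega) :
  setI_closed G -> G setT -> G `<=` measurable -> measurable B ->
  (forall A, G A -> P (A `&` B) = P A * P B)%E ->
  forall A, <<s G >> A -> (P (A `&` B) = P A * P B)%E.
Proof.
move=> GI GT Gm mB GB A sA.
have PB0 : 0 <= fine (P B) by rewrite fine_ge0.
have PBE : ((fine (P B))%:E = P B)%E by rewrite fineK // fin_num_measure.
pose k : {nonneg R} := NngNum PB0.
pose m1 : {measure set Omega -> \bar R} := mrestr P mB.
pose m2 : {measure set Omega -> \bar R} := mscale k P.
suff : m1 A = m2 A by rewrite /m1 /m2 /= /mrestr /mscale /= PBE muleC.
apply: (@g_sigma_algebra_measure_unique _ R _ G Gm (fun=> setT)) => //.
- by rewrite bigcup_const //; exists 0%N.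
- by move=> A' GA'; rewrite /m1 /m2 /= /mrestr /mscale /= PBE muleC GB.
- by move=> _; rewrite /m1 /= /mrestr setTI (le_lt_trans (probability_le1 P mB)) // ltry.
Qed.

Lemma indep_pi_systems (G1 G2 : set (set Omega)) :
  setI_closed G1 -> setI_closed G2 -> G1 setT -> G2 setT ->
  G1 `<=` measurable -> G2 `<=` measurable ->
  (forall A B, G1 A -> G2 B -> P (A `&` B) = P A * P B)%E ->
  forall A B, <<s G1 >> A -> <<s G2 >> B -> (P (A `&` B) = P A * P B)%E.
Proof.
move=> I1 I2 T1 T2 M1 M2 h A B sA sB.
have mA : measurable A by move: A sA; apply: smallest_sub => //; exact: sigma_algebra_measurable.
rewrite setIC muleC; apply: (indep_sigma_l I2 T2 M2 mA _ sB) => B' GB'.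
rewrite setIC muleC; apply: (indep_sigma_l I1 T1 M1 (M2 _ GB') _ sA) => A' GA'.
exact: h.
Qed.

End PiSystems.

(** * Increments of a Brownian motion *)

Definition increment (R : realType) (Omega : Type) (b : R -> Omega -> R) (s D : R)
  (w : Omega) : R := b (s + D) w - b s w.

Section BrownianIncrement.
Context d (Omega : measurableType d) (R : realType) (P : probability Omega R).
Variables (b : R -> Omega -> R) (s D : R).
Hypothesis bm : std_BM P b.
Hypotheses (s_ge0 : 0 <= s) (D_gt0 : 0 < D).

Local Notation X := (increment b s D).

Lemma BM_increment_law (A : set R) : measurable A ->
  P (X @^-1` A) = normal_prob 0 (Num.sqrt D) A.
Proof.
have [_ _ _ h _] := bm => mA.
have sD : s < s + D by rewrite ltrDl.
have e : s + D - s = D by rewrite addrC addKr.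
by have := h s (s + D) s_ge0 sD A mA; rewrite e.
Qed.

(** For [s > 0], [b s] is the increment over [[0, s]] because [b 0 = 0]. Independence is given for
    strictly increasing times, so [s = 0] is treated apart: there [b s] is constant and its events
    are trivial. *)
Lemma BM_increment_indep (A A' : set R) : measurable A -> measurable A' ->
  (P (b s @^-1` A `&` X @^-1` A')
   = P (b s @^-1` A) * P (X @^-1` A'))%E.
Proof.
have [b0 _ _ _ h] := bm => mA mA'.
move: s_ge0; rewrite le_eqVlt => /orP[/eqP s0|s0].
  have [A0|A0] := pselect (A 0).
    have -> : b s @^-1` A = setT.
      by apply/seteqP; split => w //= _; rewrite -s0 b0.
    by rewrite setTI (_ : P setT = 1%E) ?mul1e //; exact: probability_setT.
  have -> : b s @^-1` A = set0.
    by apply/seteqP; split => w //=; rewrite -s0 b0.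
  by rewrite set0I measure0 mul0e.
pose tau (i : 'I_3) : R := nth 0 [:: 0; s; s + D] i.
have t0 : 0 <= tau ord0 by [].
have tm (i : 'I_2) : tau (widen_ord (leqnSn 2) i) < tau (lift ord0 i).
  case: i => [[|[|//]] hi]; rewrite /tau /=; first exact: s0.
  by rewrite ltrDl.
pose Ai (i : 'I_2) := if i == ord0 then b s @^-1` A else X @^-1` A'.
have := h 2%N tau t0 tm [:: ord0; ord_max] Ai isT.
rewrite bigcap_seq !big_cons !big_nil setIT mule1 /Ai /=; apply => j.
rewrite !inE => /orP[] /eqP -> /=; split => //; apply: sub_sigma_algebra.
  exists tt => //; exists A => //.
  by rewrite /tau /=; apply/seteqP; split => w /=; rewrite b0 subr0.
by exists tt => //; exists A'.
Qed.

End BrownianIncrement.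

Section FlowIndependence.
Context d (Omega : measurableType d) (R : realType) (P : probability Omega R).
Variables (C : R) (n : nat) (T : 'I_n -> 'I_n -> Omega -> R) (V : 'I_n -> Omega -> R)
  (B : 'I_n -> 'I_n -> R -> Omega -> R).
Hypothesis hyps : flow_hyps P C T V B.
Variables (s D : R).
Hypotheses (s_ge0 : 0 <= s) (D_gt0 : 0 < D).

Implicit Types (p : 'I_n * 'I_n) (I : 'I_n * 'I_n -> set R).

Local Notation sT := (gen_sigma setT (fun ij : 'I_n * 'I_n => T ij.1 ij.2)).
Local Notation sV := (gen_sigma setT V).
Local Notation X p := (increment (B p.1 p.2) s D).
Local Notation Bs p := (B p.1 p.2 s).

(* Only the pairs with [p.1 <= p.2] carry a Brownian motion, see [flow_ok]. *)
Definition rect (AT AV : set Omega) I I' : set Omega :=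
  AT `&` AV `&`
  \bigcap_(p in [set p : 'I_n * 'I_n | (p.1 <= p.2)%N]) (Bs p @^-1` (I p) `&` X p @^-1` (I' p)).

Local Notation mI I := (forall p : 'I_n * 'I_n, measurable (I p : set R)).

Let gen_sigmaI (J : Type) (Y : J -> Omega -> R) : setI_closed (gen_sigma setT Y).
Proof.
move=> A A' mA mA'.
exact: (@measurableI _ (g_sigma_algebraType (\bigcup_(i in setT) [set Y i @^-1` A | A in (@measurable _ R)]))).
Qed.

Let gen_sigmaT (J : Type) (Y : J -> Omega -> R) : gen_sigma setT Y setT.
Proof.
exact: (@measurableT _ (g_sigma_algebraType (\bigcup_(i in setT) [set Y i @^-1` A | A in (@measurable _ R)]))).
Qed.

Local Notation ps := [seq p : 'I_n * 'I_n <- enum {: 'I_n * 'I_n} | (p.1 <= p.2)%N].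

Let mem_ps p : (p \in ps) = (p.1 <= p.2)%N.
Proof. by rewrite mem_filter mem_enum andbT. Qed.

Lemma slab_sigma p (J J' : set R) : measurable J -> measurable J' ->
  gen_sigma `[0, +oo[%classic (B p.1 p.2) (Bs p @^-1` J `&` X p @^-1` J').
Proof.
move=> mJ mJ'.
pose S := g_sigma_algebraType (\bigcup_(t in `[0, +oo[%classic) [set B p.1 p.2 t @^-1` A | A in (@measurable _ R)]).
have mB t : 0 <= t -> measurable_fun setT (B p.1 p.2 t : S -> R).
  move=> t0 _ Q mQ; rewrite setTI; apply: sub_sigma_algebra.
  by exists t; [rewrite /= in_itv /= t0|exists Q].
have mBs : measurable_fun setT (Bs p : S -> R) by exact: mB.
have mX : measurable_fun setT (X p : S -> R).
  by apply: measurable_funB; apply: mB; rewrite // addr_ge0 // ltW.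
apply: (@measurableI _ S).
  by have := mBs measurableT _ mJ; rewrite setTI.
by have := mX measurableT _ mJ'; rewrite setTI.
Qed.

Lemma increments_pairwise_indep (p q : 'I_n * 'I_n) (J J' : set R) :
  (p.1 <= p.2)%N -> (q.1 <= q.2)%N -> p != q -> measurable J -> measurable J' ->
  (P (X p @^-1` J `&` X q @^-1` J') = P (X p @^-1` J) * P (X q @^-1` J'))%E.
Proof.
move=> hp hq pq mJ mJ'; have [_ _ _ _ ind] := hyps.
pose A (j : option (option ('I_n * 'I_n))) := match j with
  | Some (Some r) => if r == p then X p @^-1` J else X q @^-1` J' | _ => setT end.
have := ind [:: Some (Some p); Some (Some q)] A.
rewrite bigcap_seq !big_cons !big_nil setIT mule1 /A eqxx eq_sym (negPf pq); apply.
  by rewrite /= inE andbT; apply: contraNneq pq => -[->].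
have slab r (J0 : set R) : measurable J0 -> gen_sigma `[0, +oo[%classic (B r.1 r.2) (X r @^-1` J0).
  by move=> mJ0; have := @slab_sigma r setT J0 measurableT mJ0; rewrite preimage_setT setTI.
move=> j; rewrite !inE => /orP[/eqP->|/eqP->] /=; split => //.
  by rewrite eqxx; exact: slab.
by rewrite eq_sym (negPf pq); exact: slab.
Qed.

(** [T], [V] and distinct Brownian motions factor by the joint independence hypothesis; within one
    motion, the value at [s] and the next increment factor by [BM_increment_indep]. *)
Lemma probability_rect AT AV I I' : sT AT -> sV AV -> mI I -> mI I' ->
  (P (rect AT AV I I') = P AT * (P AV *
    \prod_(p <- ps) (P (Bs p @^-1` (I p)) * P (X p @^-1` (I' p)))))%E.
Proof.
move=> hT hV hI hI'; have [_ _ _ bm ind] := hyps.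
pose A (j : option (option ('I_n * 'I_n))) := match j with
  | None => AT | Some None => AV
  | Some (Some p) => Bs p @^-1` (I p) `&` X p @^-1` (I' p) end.
have := ind (None :: Some None :: [seq Some (Some p) | p <- ps]) A.
rewrite bigcap_seq !big_cons !big_map -bigcap_seq /= => h.
have -> : rect AT AV I I' = AT `&` (AV `&` \bigcap_(p in [set` ps]) A (Some (Some p))).
  rewrite /rect -setIA (_ : [set` ps] = [set p : 'I_n * 'I_n | (p.1 <= p.2)%N]) //.
  by apply/seteqP; split => p /=; rewrite mem_ps.
rewrite h; first last.
- move=> j; rewrite !inE => /orP[/eqP->|/orP[/eqP->|/mapP[p]]] //.
  rewrite mem_ps => hp ->; split => //=.
  exact: slab_sigma.
- apply/and3P; split.
  + by rewrite inE /=; apply/mapP => -[].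
  + by apply/mapP => -[].
  + rewrite map_inj_uniq => [|p q [] //]; apply: filter_uniq; exact: enum_uniq.
congr (_ * (_ * _))%E; apply: eq_big_seq => p; rewrite mem_ps => hp.
exact: (BM_increment_indep (bm _ _ hp)).
Qed.

Lemma rectI AT AV AT' AV' I1 I1' I2 I2' :
  rect AT AV I1 I2 `&` rect AT' AV' I1' I2' =
  rect (AT `&` AT') (AV `&` AV') (fun p => I1 p `&` I1' p) (fun p => I2 p `&` I2' p).
Proof.
apply/seteqP; split => w /=.
  move=> [[[h1 h2] h3] [[h1' h2'] h3']]; split=> // p hp.
  by have [? ?] := h3 p hp; have [? ?] := h3' p hp.
move=> [[[h1 h1'] [h2 h2']] h3]; split; (split; first by []) => p hp;
  by have [[? ?] [? ?]] := h3 p hp.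
Qed.

Local Notation all_sets := (fun=> setT).

(** The past consists of [T], [V] and the noise at time [s], which determine both [H_0] and [H_s].
    In [environment_rects] the potential is left out, so that it can be averaged against the
    rest. *)
Definition past_rects : set (set Omega) :=
  [set A | exists AT AV I, [/\ sT AT, sV AV, mI I & A = rect AT AV I all_sets]].
Definition environment_rects : set (set Omega) :=
  [set A | exists AT I, [/\ sT AT, mI I & A = rect AT setT I all_sets]].
Definition increment_rects : set (set Omega) :=
  [set A | exists2 I, mI I & A = rect setT setT all_sets I].

Let sTT : sT setT. Proof. exact: gen_sigmaT. Qed.
Let sVT : sV setT. Proof. exact: gen_sigmaT. Qed.

Let mall : mI all_sets. Proof. by move=> p; exact: measurableT. Qed.

Let all_setsI : (fun p : 'I_n * 'I_n => setT `&` setT : set R) = all_sets.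
Proof. by apply/funext => p; rewrite setTI. Qed.

Let rectT : rect setT setT all_sets all_sets = setT.
Proof. by apply/seteqP; split. Qed.

Let mrect AT AV I I' : sT AT -> sV AV -> mI I -> mI I' -> measurable (rect AT AV I I').
Proof.
have [[mT _] mV _ bm _] := hyps => hT hV hI hI'.
have sub (J : Type) (Y : J -> Omega -> R) : (forall j, measurable_fun setT (Y j)) ->
    gen_sigma setT Y `<=` measurable.
  move=> mY; apply: smallest_sub; first exact: sigma_algebra_measurable.
  move=> _ [j _ [Q mQ <-]]; rewrite -[Z in measurable Z]setTI; exact: mY.
apply: measurableI; first by apply: measurableI; [apply: (sub _ _ _ _ hT)|apply: (sub _ _ _ _ hV)].
rewrite (_ : bigcap _ _ = \bigcap_(p in [set` ps]) (Bs p @^-1` (I p) `&` X p @^-1` (I' p))); last first.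
  by congr bigcap; apply/seteqP; split => p /=; rewrite mem_ps.
rewrite bigcap_seq big_seq; apply: (big_ind measurable) => // [A A' mA mA'|p].
  exact: measurableI.
rewrite mem_ps => hp; have [_ _ mB _ _] := bm _ _ hp.
apply: measurableI.
  by rewrite -[Z in measurable Z]setTI; exact: mB.
rewrite -[Z in measurable Z]setTI.
by apply: (measurable_funB (mB (s + D)) (mB s)).
Qed.

Let prodE I I' : (\prod_(p <- ps) (P (Bs p @^-1` (I p)) * P (X p @^-1` (I' p))) =
  (\prod_(p <- ps) P (Bs p @^-1` (I p))) * \prod_(p <- ps) P (X p @^-1` (I' p)))%E.
Proof. by rewrite big_split. Qed.

Let PT : (P setT = 1)%E. Proof. exact: probability_setT. Qed.

Let prod1 (Y : 'I_n * 'I_n -> Omega -> R) :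
  (\prod_(p <- ps) P (Y p @^-1` setT) = 1)%E.
Proof. by rewrite big1 // => p _; rewrite preimage_setT PT. Qed.

Lemma past_increment_indep A A' : <<s past_rects >> A -> <<s increment_rects >> A' ->
  (P (A `&` A') = P A * P A')%E.
Proof.
apply: indep_pi_systems.
- move=> _ _ [AT [AV [I [hT hV hI ->]]]] [AT' [AV' [I' [hT' hV' hI' ->]]]].
  exists (AT `&` AT'), (AV `&` AV'), (fun p => I p `&` I' p).
  rewrite rectI all_setsI; split => //; [exact: gen_sigmaI|exact: gen_sigmaI|].
  by move=> p; exact: measurableI.
- move=> _ _ [I hI ->] [I' hI' ->]; exists (fun p => I p `&` I' p).
    by move=> p; exact: measurableI.
  by rewrite rectI all_setsI !setTI.
- by exists setT, setT, all_sets; split => //; exact: gen_sigmaT.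
- by exists all_sets.
- by move=> _ [AT [AV [I [hT hV hI ->]]]]; exact: mrect.
- by move=> _ [I hI ->]; apply: mrect => //; exact: gen_sigmaT.
- move=> _ _ [AT [AV [I [hT hV hI ->]]]] [I' hI' ->].
  rewrite rectI !setIT (_ : (fun p => I p `&` setT) = I); last by apply/funext => p; rewrite setIT.
  rewrite (_ : (fun p => setT `&` I' p) = I'); last by apply/funext => p; rewrite setTI.
  rewrite !probability_rect // !prodE !prod1 PT !mule1 !mul1e.
  by rewrite !muleA.
Qed.

Lemma potential_environment_indep A A' : sV A -> <<s environment_rects >> A' ->
  (P (A `&` A') = P A * P A')%E.
Proof.
move=> hA; apply: (@indep_pi_systems _ _ _ _ sV); last exact: sub_sigma_algebra.
- exact: gen_sigmaI.
- move=> _ _ [AT [I [hT hI ->]]] [AT' [I' [hT' hI' ->]]].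
  exists (AT `&` AT'), (fun p => I p `&` I' p).
  rewrite rectI all_setsI setTI; split => //; first exact: gen_sigmaI.
  by move=> p; exact: measurableI.
- exact: gen_sigmaT.
- by exists setT, all_sets; split.
- move=> A1 hA1; rewrite (_ : A1 = rect setT A1 all_sets all_sets); first exact: mrect.
  by apply/seteqP; split => [w h|w [[]]].
- by move=> _ [AT [I [hT hI ->]]]; exact: mrect.
- move=> AV _ hV [AT [I [hT hI ->]]].
  have -> : AV `&` rect AT setT I all_sets = rect AT AV I all_sets.
    by apply/seteqP; split => [w [h1 [[h2 _] h3]]|w [[h1 h2] h3]].
  rewrite !probability_rect // !prodE !prod1 PT !mule1 !mul1e.
  by rewrite muleCA.
Qed.

Lemma past_rects_measurable : past_rects `<=` measurable.
Proof. by move=> _ [AT [AV [I [hT hV hI ->]]]]; exact: mrect. Qed.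

Lemma environment_rects_measurable : environment_rects `<=` measurable.
Proof. by move=> _ [AT [I [hT hI ->]]]; exact: mrect. Qed.

Lemma increment_rects_measurable : increment_rects `<=` measurable.
Proof. by move=> _ [I hI ->]; exact: mrect. Qed.

Lemma past_rect AT AV I : sT AT -> sV AV -> mI I -> past_rects (rect AT AV I all_sets).
Proof. by move=> hT hV hI; exists AT, AV, I. Qed.

Lemma past_rectV Q : sV Q -> past_rects Q.
Proof.
move=> hQ; have -> : Q = rect setT Q all_sets all_sets.
  by apply/seteqP; split => [w h|w [[]]].
exact: past_rect.
Qed.

Lemma environment_rectT Q : sT Q -> environment_rects Q.
Proof.
move=> hQ; exists Q, all_sets; split => //.
by apply/seteqP; split => [w h|w [[]]].
Qed.

Let only p (Q : set R) q : set R := if q == p then Q else setT.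

Let monly p (Q : set R) : measurable Q -> mI (only p Q).
Proof. by move=> mQ q; rewrite /only; case: eqP. Qed.

Lemma environment_rectB p (Q : set R) : (p.1 <= p.2)%N -> measurable Q ->
  environment_rects (Bs p @^-1` Q).
Proof.
move=> hp mQ; exists setT, (only p Q); split => //; first exact: monly.
apply/seteqP; split => [w h|w [_ /(_ p hp)]]; last by rewrite /only /= eqxx => -[].
by split => // q hq; split => //; rewrite /only; case: eqP => // ->.
Qed.

Lemma environment_sub_past : environment_rects `<=` past_rects.
Proof. by move=> _ [AT [I [hT hI ->]]]; exact: past_rect. Qed.

Lemma increment_rectX p (Q : set R) : (p.1 <= p.2)%N -> measurable Q ->
  increment_rects (X p @^-1` Q).
Proof.
move=> hp mQ; exists (only p Q); first exact: monly.
apply/seteqP; split => [w h|w [_ /(_ p hp)]]; last by rewrite /only /= eqxx => -[].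
by split => // q hq; split => //; rewrite /only; case: eqP => // ->.
Qed.

End FlowIndependence.

(** * Moments of a normal variable *)

Section Density.
Variable R : realType.
Local Notation mu := (@lebesgue_measure R).

(** Layer cake: [f x] is the Lebesgue measure of [[0, f x[], so Tonelli reduces the claim to sets of
    the form [u < f x], where it is the hypothesis on [nu]. *)
Lemma ge0_integral_pdf (nu : {sigma_finite_measure set R -> \bar R}) (p f : R -> R) :
  measurable_fun setT p -> (forall x, 0 <= p x) ->
  (forall A, measurable A -> nu A = \int[mu]_(x in A) (p x)%:E)%E ->
  measurable_fun setT f -> (forall x, 0 <= f x) ->
  (\int[nu]_x (f x)%:E = \int[mu]_x (p x * f x)%:E)%E.
Proof.
move=> mp p0 nuE mf f0.
pose I (x : R * measurableTypeR R) : \bar R := if (0 <= x.2) && (x.2 < f x.1) then 1%E else 0%E.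
have I0 x : (0 <= I x)%E by rewrite /I; case: ifP.
have m1 : measurable_fun setT (fst : measurableTypeR R * measurableTypeR R -> _) by exact: measurable_fst.
have m2 : measurable_fun setT (snd : measurableTypeR R * measurableTypeR R -> _) by exact: measurable_snd.
have mI : measurable_fun setT I.
  apply: measurable_fun_ifT => //; apply: measurable_and.
    by apply: measurable_fun_ler => //; exact: measurable_cst.
  by apply: measurable_fun_ltr => //; exact: measurableT_comp.
pose J (x : measurableTypeR R * measurableTypeR R) : \bar R := ((p x.1)%:E * I x)%E.
have J0 x : (0 <= J x)%E by rewrite mule_ge0 // lee_fin.
have mJ : measurable_fun setT J.
  apply: emeasurable_funM => //; apply/measurable_EFinP; exact: measurableT_comp.
have Iu x : (\int[mu]_u I (x, u) = (f x)%:E)%E.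
  have -> : (f x)%:E = mu `[0, f x[%classic.
    rewrite lebesgue_measure_itv /= lte_fin; have := f0 x.
    by rewrite le_eqVlt => /orP[/eqP<-|->]; rewrite ?ltxx // oppr0 adde0.
  rewrite -[RHS]mul1e -integral_cst //.
  rewrite [RHS]integral_mkcond; apply: eq_integral => u _.
  by rewrite /I /patch mem_setE in_itv.
transitivity (\int[nu]_x \int[mu]_u I (x, u))%E.
  by apply: eq_integral => x _; rewrite Iu.
rewrite (@fubini_tonelli _ _ _ _ R nu mu I mI I0).
have -> : (\int[mu]_u \int[nu]_x I (x, u) = \int[mu]_u \int[mu]_x J (x, u))%E.
  apply: eq_integral => u _.
  pose A := [set x | (0 <= u) && (u < f x)].
  have mA : measurable A.
    have := measurableT_comp mI (measurable_pair2 u) measurableT (emeasurable_set1 1%E).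
    rewrite setTI; congr (measurable _); apply/seteqP; split => x /=; rewrite /A /I /=.
      by case: ifP => // _ /eqP; rewrite eq_sym onee_eq0.
    by move=> ->.
  transitivity (nu A).
    rewrite -[RHS]mul1e -integral_cst // [RHS]integral_mkcond; apply: eq_integral => x _.
    by rewrite /I /patch /A mem_setE.
  rewrite nuE // integral_mkcond; apply: eq_integral => x _.
  have [xA|xA] := pselect (A x).
    by rewrite patchT ?inE // /J /I /=; move: (xA) => /= ->; rewrite mule1.
  by rewrite patchN ?notin_setE // /J /I /= ifF ?mule0 //; exact/negP.
rewrite -(@fubini_tonelli _ _ _ _ R mu mu J mJ J0).
apply: eq_integral => x _; rewrite /J /= ge0_integralZl //.
- by rewrite Iu -EFinM.
- exact: measurableT_comp mI (measurable_pair1 x).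
- by rewrite lee_fin.
Qed.

End Density.

Section NormalMoments.
Variables (R : realType) (s : R).
Hypothesis s_gt0 : 0 < s.
Local Notation mu := (@lebesgue_measure R).

Lemma expR_ge_quadratic (u : R) : 0 <= u -> 1 + u + u ^+ 2 / 4 <= expR u.
Proof.
move=> u0; have -> : 1 + u + u ^+ 2 / 4 = (1 + u / 2) ^+ 2 by field.
have -> : expR u = expR (u / 2) ^+ 2.
  by rewrite expr2 -expRD; congr expR; field.
by rewrite lerXn2r ?nnegrE ?expR_ge0 ?addr_ge0 ?divr_ge0 // expR_ge1Dx.
Qed.

(** In the unit [q = |x| / s], the right-hand side dominates [64 + 16 q^2 + q^4] times [s^k]; 64 is
    the factor that gives [q^4] the coefficient 1. *)
Lemma normr_expn_le (x : R) k : (2 <= k <= 4)%N ->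
  `|x| ^+ k <= 64 * s ^+ k * expR (x ^+ 2 / (4 * s ^+ 2)).
Proof.
move=> k24; set u := _ / (4 * _).
have q0 : 0 <= `|x| / s by rewrite divr_ge0 // ltW.
set q := `|x| / s in q0.
have uE : u = q ^+ 2 / 4.
  by rewrite /u /q expr_div_n -normrX ger0_norm ?sqr_ge0 //; field; rewrite gt_eqF.
have -> : `|x| = q * s by rewrite /q mulfVK // gt_eqF.
have u0 : 0 <= u by rewrite uE divr_ge0 ?sqr_ge0.
rewrite exprMn mulrAC ler_pM2r ?exprn_gt0 //.
apply: (@le_trans _ _ (64 * (1 + u + u ^+ 2 / 4))); last first.
  by rewrite ler_pM2l // expR_ge_quadratic.
rewrite uE; have q2 := sqr_ge0 q; have q4 := sqr_ge0 (q ^+ 2).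
have := sqr_ge0 (q - q ^+ 2).
case: k k24 => [|[|[|[|[|k]]]]] // _ h.
- lra.
- have -> : q ^+ 3 = q * q ^+ 2 by rewrite exprS.
  rewrite (_ : (q - q ^+ 2) ^+ 2 = q ^+ 2 - 2 * (q * q ^+ 2) + (q ^+ 2) ^+ 2) in h; last by ring.
  rewrite (_ : (q ^+ 2 / 4) ^+ 2 = (q ^+ 2) ^+ 2 / 16); last by field.
  lra.
- rewrite (_ : q ^+ 4 = (q ^+ 2) ^+ 2); last by rewrite -exprM.
  rewrite (_ : (q ^+ 2 / 4) ^+ 2 = (q ^+ 2) ^+ 2 / 16); last by field.
  lra.
Qed.

(* The moments of variance [s^2] are thus controlled by the total mass of the density of
   variance [4 s^2], with no integration by parts. *)
Lemma normal_pdf_scale (x : R) :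
  normal_pdf 0 s x * expR (x ^+ 2 / (4 * s ^+ 2)) <= 2 * normal_pdf 0 (2 * s) x.
Proof.
have s0 : s != 0 by rewrite gt_eqF.
have s20 : 2 * s != 0 by rewrite mulf_neq0.
rewrite !normal_pdfE //.
have -> : normal_peak s = 2 * normal_peak (2 * s).
  rewrite /normal_peak (_ : (2 * s) ^+ 2 * pi *+ 2 = 2 ^+ 2 * (s ^+ 2 * pi *+ 2)); last by ring.
  rewrite sqrtrM ?sqr_ge0 // sqrtr_sqr ger0_norm // invfM mulrA divff ?mul1r //.
rewrite -!mulrA ler_pM2l // ler_wpM2l ?normal_peak_ge0 //.
rewrite /normal_fun -expRD ler_expR subr0.
have x2 := sqr_ge0 x; have s2 : 0 < s ^+ 2 by rewrite exprn_gt0.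
rewrite -subr_ge0 (_ : _ - _ = x ^+ 2 / (8 * s ^+ 2)); last by field.
by rewrite divr_ge0 // mulr_ge0 // ltW.
Qed.

Lemma normal_moment k : (2 <= k <= 4)%N ->
  (\int[mu]_x (normal_pdf 0 s x * `|x| ^+ k)%:E <= (128 * s ^+ k)%:E)%E.
Proof.
move=> k24.
have mX : measurable_fun setT (fun x : R => `|x| ^+ k).
  by apply: measurable_funX; exact: normr_measurable.
apply: (@le_trans _ _ (\int[mu]_x ((128 * s ^+ k)%:E * (normal_pdf 0 (2 * s) x)%:E))%E).
  apply: ge0_le_integral => //.
  - by move=> x _; rewrite lee_fin mulr_ge0 ?exprn_ge0 // normal_pdf_ge0.
  - apply/measurable_EFinP; apply: measurable_funM => //; exact: measurable_normal_pdf.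
  - apply: measurable_funeM; apply/measurable_EFinP; exact: measurable_normal_pdf.
  move=> x _; rewrite -EFinM lee_fin.
  apply: le_trans (ler_wpM2l (normal_pdf_ge0 0 s x) (normr_expn_le x k24)) _.
  rewrite mulrCA (_ : 128 * s ^+ k = 64 * s ^+ k * 2); last by ring.
  by rewrite -[leRHS]mulrA ler_wpM2l ?normal_pdf_scale // mulr_ge0 // exprn_ge0 // ltW.
rewrite ge0_integralZl //.
- by rewrite integral_normal_pdf mule1.
- apply/measurable_EFinP; exact: measurable_normal_pdf.
- by move=> x _; rewrite lee_fin normal_pdf_ge0.
- by rewrite lee_fin mulr_ge0 // exprn_ge0 // ltW.
Qed.

End NormalMoments.

Section NormalVariable.
Context d (Omega : measurableType d) (R : realType) (P : probability Omega R).
Variables (X : {mfun Omega >-> R}) (s : R).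
Hypothesis s_gt0 : 0 < s.
Hypothesis lawX : forall A : set R, measurable A -> P (X @^-1` A) = normal_prob 0 s A.
Local Notation mu := (@lebesgue_measure R).

Let ge0_integral_law (f : R -> R) : measurable_fun setT f -> (forall x, 0 <= f x) ->
  (\int[P]_w (f (X w))%:E = \int[mu]_x (normal_pdf 0 s x * f x)%:E)%E.
Proof.
move=> mf f0.
rewrite -(@ge0_integral_pdf _ (distribution P X)) //.
- by rewrite ge0_integral_distribution //; exact/measurable_EFinP.
- exact: measurable_normal_pdf.
- by move=> x; exact: normal_pdf_ge0.
Qed.

Lemma normal_variable_moment k : (2 <= k <= 4)%N ->
  (\int[P]_w (`|X w| ^+ k)%:E <= (128 * s ^+ k)%:E)%E.
Proof.
move=> k24; rewrite (ge0_integral_law (f := fun x => `|x| ^+ k)) //.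
- exact: normal_moment.
- by apply: measurable_funX; exact: normr_measurable.

Qed.

Lemma integrable_normal_variable : P.-integrable setT (EFin \o X).
Proof.
have mX : measurable_fun setT X by exact: measurable_funPT.
apply/integrableP; split; first exact/measurable_EFinP.
have m2 : measurable_fun setT (fun w => `|X w| ^+ 2).
  by apply: measurable_funX; exact: measurableT_comp.
apply: (@le_lt_trans _ _ (\int[P]_w (1%:E + (`|X w| ^+ 2)%:E))%E).
  apply: ge0_le_integral => //.
  - by apply: measurableT_comp => //; exact/measurable_EFinP.
  - by apply: emeasurable_funD; [exact: measurable_cst|exact/measurable_EFinP].
  move=> w _ /=; rewrite -EFinD lee_fin.
  have := sqr_ge0 (1 - `|X w|); rewrite sqrrB expr1n mul1r; have := sqr_ge0 `|X w|; lra.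
rewrite ge0_integralD //; last exact/measurable_EFinP.
have -> : (\int[P]__ 1 = 1 :> \bar R)%E by rewrite integral_cst // mul1e; exact: probability_setT.
apply: (@le_lt_trans _ _ (1 + (128 * s ^+ 2)%:E)%E).
  by rewrite leeD2l // normal_variable_moment.
by rewrite -EFinD ltry.
Qed.

Let integral_oppr (f : R -> R) : measurable_fun setT f -> (forall x, 0 <= f x) ->
  (\int[mu]_x (f (- x))%:E = \int[mu]_x (f x)%:E)%E.
Proof.
move=> mf f0.
pose N : measurableTypeR R -> measurableTypeR R := -%R.
have mN : measurable_fun setT N by exact: oppr_measurable.
transitivity (\int[pushforward mu N]_x (f x)%:E)%E.
  have mf0 : measurable_fun [set: R] (EFin \o f) by exact/measurable_EFinP.
  have mf1 : measurable_fun [set: measurableTypeR R] (EFin \o f) by move=> mD Y mY; exact: (mf0 mD Y mY).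
  have fz : {in setT, forall y : measurableTypeR R, (0 <= (EFin \o f) y)%E} by move=> y _; rewrite lee_fin.
  by rewrite (@ge0_integral_pushforward _ _ _ _ _ N mN mu setT (EFin \o f) measurableT mf1 fz).
by apply: eq_measure_integral => A mA _; exact: lebesgue_measureN.
Qed.

(** The density is even, so the positive and negative parts have equal integrals; integrability
    makes these finite, and they cancel. *)
Lemma normal_variable_mean : (\int[P]_w (X w)%:E = 0)%E.
Proof.
pose f (x : R) := Num.max x 0; pose g (x : R) := Num.max (- x) 0.
have mf : measurable_fun setT f by apply: measurable_maxr => //.
have mg : measurable_fun setT g by apply: measurable_maxr => //; exact: oppr_measurable.
have f0 x : 0 <= f x by rewrite /f le_max lexx orbT.
have g0 x : 0 <= g x by rewrite /g le_max lexx orbT.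
have e : (\int[P]_w (f (X w))%:E = \int[P]_w (g (X w))%:E)%E.
  rewrite !ge0_integral_law // -integral_oppr; first last.
  - by move=> x; rewrite mulr_ge0 // normal_pdf_ge0.
  - by apply: measurable_funM => //; exact: measurable_normal_pdf.
  apply: eq_integral => x _; congr (_%:E); rewrite /f /g; congr (_ * _).
  by rewrite !normal_pdfE ?gt_eqF // /normal_fun !subr0 sqrrN.
rewrite integralE.
have -> : (\int[P]_w (((fun w => (X w)%:E)^\+)%E w) = \int[P]_w (f (X w))%:E)%E.
  by apply: eq_integral => w _; rewrite funeposE -EFin_max.
have -> : (\int[P]_w (((fun w => (X w)%:E)^\-)%E w) = \int[P]_w (g (X w))%:E)%E.
  by apply: eq_integral => w _; rewrite funenegE -EFinN -EFin_max.
rewrite e subee // ge0_fin_numE; last by apply: integral_ge0 => w _; rewrite lee_fin.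
have /integrableP[_ h] := integrable_normal_variable.
have mX : measurable_fun setT X by exact: measurable_funPT.
apply: le_lt_trans h; apply: ge0_le_integral => //.
- by move=> w _; rewrite lee_fin.
- by apply/measurable_EFinP; exact: measurableT_comp.
- by apply: measurableT_comp => //; exact/measurable_EFinP.
by move=> w _ /=; rewrite lee_fin /g ge_max normr_ge0 andbT -normrN ler_norm.
Qed.

End NormalVariable.

(** * Product of two independent variables, one of them centred *)

Section UncorrelatedProduct.
Context d (Omega : measurableType d) (R : realType) (P : probability Omega R).
Variables (X Y : {mfun Omega >-> R}).
Hypothesis indep : forall A B : set R, measurable A -> measurable B ->
  (P (X @^-1` A `&` Y @^-1` B) = P (X @^-1` A) * P (Y @^-1` B))%E.
Hypotheses (iX : P.-integrable setT (EFin \o X)) (iY : P.-integrable setT (EFin \o Y)).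
Hypothesis meanY : (\int[P]_w (Y w)%:E = 0)%E.

Let Z w := (X w, Y w).
Let mZ : measurable_fun setT Z.
Proof. by apply/measurable_fun_pairP; split; exact: measurable_funPT. Qed.
HB.instance Definition _ := isMeasurableFun.Build _ _ _ _ Z mZ.

Lemma integral_indep_mul0 : (\int[P]_w (X w * Y w)%:E = 0)%E.
Proof.
pose f (x : R * R) : \bar R := (x.1 * x.2)%:E.
have m12 : measurable_fun setT (fun x : R * R => x.1 * x.2).
  by apply: measurable_funM; [exact: measurable_fst|exact: measurable_snd].
have mf : measurable_fun setT f by exact/measurable_EFinP.
have mX : measurable_fun setT X by exact: measurable_funPT.
have mY : measurable_fun setT Y by exact: measurable_funPT.
have intf : P.-integrable setT (f \o Z).
  apply/integrableP; split; first exact: measurableT_comp.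
  have mabs : measurable_fun setT (fun x : R * R => `|f x|%E) by exact: measurableT_comp.
  have /= -> := ge0_integral_indep indep mabs (fun x => abse_ge0 (f x)).
  have /integrableP[_ hX] := iX; have /integrableP[_ hY] := iY.
  have -> : (\int[P]_w \int[P]_w' `|(X w * Y w')%:E| =
      (\int[P]_w `|(X w)%:E|) * \int[P]_w' `|(Y w')%:E|)%E.
    rewrite -ge0_integralZr //.
    - apply: eq_integral => w _; rewrite -ge0_integralZl //.
      + by apply: eq_integral => w' _; rewrite EFinM abseM.
      + by apply: measurableT_comp => //; exact/measurable_EFinP.
    - by apply: measurableT_comp => //; exact/measurable_EFinP.
    - by apply: integral_ge0.
  by apply: lte_mul_pinfty => //; [apply: integral_ge0|rewrite ge0_fin_numE //; apply: integral_ge0].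
have -> : (\int[P]_w (X w * Y w)%:E = integral (distribution P Z) setT f)%E.
  by rewrite integral_distribution.
have eqm A : measurable A -> distribution P Z A = (distribution P X \x distribution P Y)%E A.
  move=> mA; apply/esym; apply: product_measure_unique => // A' B' mA' mB'; exact: indep.
rewrite (eq_measure_integral (distribution P X \x distribution P Y)%E) => [|A mA _]; last exact: eqm.
have intf2 : (distribution P X \x distribution P Y)%E.-integrable setT f.
  apply/integrableP; split => //.
  have /integrableP[_] := @integrable_pushforward _ _ _ _ R Z mZ P setT f mf intf measurableT.
  by rewrite (eq_measure_integral (distribution P X \x distribution P Y)%E) => [|A mA _]; last exact: eqm.
rewrite -integral12_prod_meas1 // integral0_eq // => x _.
rewrite /fubini_F.
transitivity (\int[P]_w (x * Y w)%:E)%E.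
  rewrite (@integral_distribution _ _ _ _ R P Y (fun y => (x * y)%:E)) //.
    by apply/measurable_EFinP; exact: measurable_funM.
  by apply: (integrableZl _ x iY).
under eq_integral do rewrite EFinM.
by rewrite integralZl // meanY mule0.
Qed.

End UncorrelatedProduct.

(** * One step of the flow *)

Section SmoothedModulus.
Variable R : realType.
Implicit Types (g u : R[i]) (a : R).

Definition smooth_abs a g := Num.sqrt (nc g ^+ 2 + a ^+ 2).

Lemma smooth_abs_ge a g : 0 < a -> a <= smooth_abs a g.
Proof.
move=> a0; rewrite -[leLHS](ger0_norm (ltW a0)) -sqrtr_sqr ler_wsqrtr // lerDr.
exact: sqr_ge0.
Qed.

Lemma nc_le_smooth_abs a g : nc g <= smooth_abs a g.
Proof.
by rewrite -[leLHS](ger0_norm (nc_ge0 g)) -sqrtr_sqr ler_wsqrtr // lerDl sqr_ge0.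
Qed.

(** Concavity of the square root: [sqrt (p^2 + Y) <= p + Y / (2 p)] with
    [Y = 2 Re (conj g u) + |u|^2]. Only under [|u|^2] is [p] replaced by its lower bound [a]; the
    linear term must remain exact, since its mean has to vanish. *)
Lemma smooth_absD a g u : 0 < a ->
  smooth_abs a (g + u) <= smooth_abs a g
    + Re (conjc g / (smooth_abs a g)%:C * u) + nc u ^+ 2 / (2 * a).
Proof.
move=> a0; have p0 : 0 < smooth_abs a g := lt_le_trans a0 (smooth_abs_ge g a0).
set p := smooth_abs a g in p0 *.
have p2 : p ^+ 2 = nc g ^+ 2 + a ^+ 2.
  by rewrite sqr_sqrtr // addr_ge0 ?sqr_ge0.
have e1 : Re (conjc g / p%:C * u) = Re (conjc g * u) / p.
  by rewrite mulrAC mulrC -(fmorphV (real_complex R)) cRe_real mulrC.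
have e2 : nc (g + u) ^+ 2 = nc g ^+ 2 + 2 * Re (conjc g * u) + nc u ^+ 2.
  rewrite !ncE2 cReD cImD cReM cIm_conj cRe_conj; ring.
have := sqr_ge0 (nc (g + u)); rewrite e2 e1.
set Q := Re (conjc g * u); set U := nc u ^+ 2; set X := nc g ^+ 2 in p2 * => X0.
have U0 : 0 <= U := sqr_ge0 _.
have h1 : p + Q / p + U / (2 * p) <= p + Q / p + U / (2 * a).
  rewrite lerD2l ler_wpM2l // lef_pV2 ?posrE ?mulr_gt0 // ler_pM2l //.
  exact: smooth_abs_ge.
apply: le_trans h1; rewrite /smooth_abs e2 -/Q -/U -/X.
have -> : X + 2 * Q + U + a ^+ 2 = p ^+ 2 + (2 * Q + U) by rewrite p2; ring.
have -> : p + Q / p + U / (2 * p) = (2 * p ^+ 2 + (2 * Q + U)) / (2 * p).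
  by field; rewrite gt_eqF.
set Y := 2 * Q + U.
have Y0 : 0 <= 2 * p ^+ 2 + Y.
  by have := sqr_ge0 a; have := sqr_ge0 p; rewrite /Y; move: p2; lra.
have q0 : 0 <= (2 * p ^+ 2 + Y) / (2 * p) by rewrite divr_ge0 // mulr_ge0 // ltW.
rewrite -[leRHS](ger0_norm q0) -sqrtr_sqr ler_wsqrtr //.
rewrite expr_div_n ler_pdivlMr ?exprn_gt0 ?mulr_gt0 //.
rewrite -subr_ge0 (_ : _ - _ = Y ^+ 2) ?sqr_ge0 //; ring.
Qed.

End SmoothedModulus.

Lemma conj_scale (R : realType) (u : R) (w : R[i]) : conjc (u%:C * w) = u%:C * conjc w.
Proof. by case: w => b c; simpc. Qed.

Section Step.
Variables (R : realType) (n : nat).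
Variables (h : 'I_n -> 'I_n -> R) (z g0 : R[i]) (a : R) (x y : 'I_n).
Hypotheses (hs : symf h) (z_gt0 : 0 < Im z) (a_gt0 : 0 < a).
Local Notation G := (resolvent h z).

Let g := G x y - g0.
Let theta := conjc g / (smooth_abs a g)%:C.

Definition step_linear i j : R := - Re (theta * (G x i * G j y)).
(** The first term is the second-order part of the resolvent expansion, paired with the gradient
    [theta] of the smoothed modulus. The second is [|A|^2 / a] for the linear part [A]; it carries
    [1 / a] rather than [1 / (2 a)] because the remainder is split off by
    [(p + q)^2 <= 2 p^2 + 2 q^2]. *)
Definition step_quadratic i j k l : R :=
  Re (theta * (G x i * (G j k * G l y)))
  + a^-1 * Re ((G x i * G j y) * conjc (G x k * G l y)).

Let theta_le1 : nc theta <= 1.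
Proof.
have p0 : 0 < smooth_abs a g := lt_le_trans a_gt0 (smooth_abs_ge g a_gt0).
rewrite /theta Normc.normcM nc_conj Normc.normcV nc_real gtr0_norm //.
by rewrite ler_pdivrMr // mul1r nc_le_smooth_abs.
Qed.

Lemma step_inequality h' (S := \sum_i \sum_j `|h' i j - h i j|) : symf h' ->
  smooth_abs a (resolvent h' z x y - g0) <= smooth_abs a g
   + \sum_i \sum_j step_linear i j * (h' i j - h i j)
   + \sum_i \sum_j \sum_k \sum_l
       step_quadratic i j k l * ((h' i j - h i j) * (h' k l - h k l))
   + (S ^+ 3 / Im z ^+ 4 + S ^+ 4 / Im z ^+ 6 / a).
Proof.
move=> hs'; have [r2 [r3 /(_ x y)]] := resolvent_expand hs hs' z_gt0.
pose A := \sum_i \sum_j (h' i j - h i j)%:C * (G x i * G j y).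
pose B := \sum_i \sum_j \sum_k \sum_l
  (h' i j - h i j)%:C * (G x i * ((h' k l - h k l)%:C * (G j k * G l y))).
rewrite -/S -/A -/B => -[e1 e2 b2 b3].
set d := - A + r2 x y in e1.
have -> : resolvent h' z x y - g0 = g + d by rewrite -e1 /g; ring.
apply: (le_trans (smooth_absD _ _ a_gt0)); rewrite -/theta -!addrA lerD2l.
have -> : \sum_i \sum_j step_linear i j * (h' i j - h i j) = - Re (theta * A).
  rewrite /A mulr_sumr cRe_sum -sumrN; apply: eq_bigr => i _.
  rewrite mulr_sumr cRe_sum -sumrN; apply: eq_bigr => j _.
  by rewrite mulrCA cRe_real mulrC mulrN.
have -> : \sum_i \sum_j \sum_k \sum_l
       step_quadratic i j k l * ((h' i j - h i j) * (h' k l - h k l))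
   = Re (theta * B) + a^-1 * nc A ^+ 2.
  have -> : Re (theta * B) = \sum_i \sum_j \sum_k \sum_l
      Re (theta * (G x i * (G j k * G l y))) * ((h' i j - h i j) * (h' k l - h k l)).
    rewrite /B mulr_sumr cRe_sum; apply: eq_bigr => i _.
    rewrite mulr_sumr cRe_sum; apply: eq_bigr => j _.
    rewrite mulr_sumr cRe_sum; apply: eq_bigr => k _.
    rewrite mulr_sumr cRe_sum; apply: eq_bigr => l _.
    rewrite [RHS]mulrC -cRe_real rmorphM; congr Re; ring.
  have -> : nc A ^+ 2 = \sum_i \sum_j \sum_k \sum_l
      Re ((G x i * G j y) * conjc (G x k * G l y)) * ((h' i j - h i j) * (h' k l - h k l)).
    have -> : nc A ^+ 2 = Re (A * conjc A) by rewrite mul_conj_nc.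
    rewrite {1}/A mulr_suml cRe_sum; apply: eq_bigr => i _.
    rewrite mulr_suml cRe_sum; apply: eq_bigr => j _.
    rewrite /A rmorph_sum mulr_sumr cRe_sum; apply: eq_bigr => k _.
    rewrite rmorph_sum mulr_sumr cRe_sum; apply: eq_bigr => l _.
    rewrite -[LHS]/(Re ((h' i j - h i j)%:C * (G x i * G j y)
      * conjc ((h' k l - h k l)%:C * (G x k * G l y)))) conj_scale [RHS]mulrC -cRe_real rmorphM; congr Re; ring.
  rewrite mulr_sumr -big_split; apply: eq_bigr => i _ /=.
  rewrite mulr_sumr -big_split; apply: eq_bigr => j _ /=.
  rewrite mulr_sumr -big_split; apply: eq_bigr => k _ /=.
  rewrite mulr_sumr -big_split; apply: eq_bigr => l _ /=.
  by rewrite /step_quadratic mulrDl -[a^-1 * _ * _]mulrA.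
have t3 : - Re (theta * r3 x y) <= S ^+ 3 / Im z ^+ 4.
  apply: le_trans b3; rewrite -cReN; apply: (le_trans (ler_norm _)).
  apply: (le_trans (Re_le_nc _)); rewrite normcN Normc.normcM.
  by rewrite -[leRHS]mul1r ler_wpM2r ?nc_ge0.
have t2 : nc (r2 x y) ^+ 2 <= S ^+ 4 / Im z ^+ 6.
  apply: (@le_trans _ _ ((S ^+ 2 / Im z ^+ 3) ^+ 2)).
    by rewrite lerXn2r // nnegrE ?nc_ge0 // (le_trans (nc_ge0 _) b2).
  by rewrite expr_div_n -!exprM.
have t1 : nc d ^+ 2 / (2 * a) <= a^-1 * nc A ^+ 2 + nc (r2 x y) ^+ 2 / a.
  rewrite ler_pdivrMr ?mulr_gt0 //.
  have -> : (a^-1 * nc A ^+ 2 + nc (r2 x y) ^+ 2 / a) * (2 * a) = 2 * nc A ^+ 2 + 2 * nc (r2 x y) ^+ 2.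
    by field; rewrite gt_eqF.
  apply: (@le_trans _ _ ((nc A + nc (r2 x y)) ^+ 2)).
    rewrite lerXn2r // ?nnegrE ?addr_ge0 ?nc_ge0 //.
    by rewrite /d -(normcN A); exact: le_normcD.
  by rewrite -subr_ge0 (_ : _ - _ = (nc A - nc (r2 x y)) ^+ 2) ?sqr_ge0 //; ring.
have t4 : nc (r2 x y) ^+ 2 / a <= S ^+ 4 / Im z ^+ 6 / a by rewrite ler_pM2r ?invr_gt0.
have -> : Re (theta * d) = - Re (theta * A) + Re (theta * B) - Re (theta * r3 x y).
  by rewrite /d e2 !mulrDr !mulrN !cReD !cReN; ring.
lra.
Qed.

Lemma step_quadratic_le i j k l : `|step_quadratic i j k l|
  <= nc (G x i) * nc (G j k) * nc (G l y)
     + a^-1 * (nc (G x i) * nc (G j y) * (nc (G x k) * nc (G l y))).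
Proof.
apply: (le_trans (ler_normD _ _)); apply: lerD.
  apply: (le_trans (Re_le_nc _)); rewrite Normc.normcM -mulrA -!Normc.normcM -[leRHS]mul1r.
  by rewrite (Normc.normcM theta) ler_wpM2r ?nc_ge0.
rewrite normrM ger0_norm ?invr_ge0 ?(ltW a_gt0) // ler_wpM2l ?invr_ge0 ?(ltW a_gt0) //.
by apply: (le_trans (Re_le_nc _)); rewrite Normc.normcM nc_conj !Normc.normcM.
Qed.

End Step.

(** * Contraction of the quadratic term with the noise covariance *)

Section StepSum.
Variables (R : realType) (n : nat).
Variables (h : 'I_n -> 'I_n -> R) (z g0 : R[i]) (a : R) (x y : 'I_n).
Hypotheses (hs : symf h) (z_gt0 : 0 < Im z) (a_gt0 : 0 < a).
Local Notation G := (resolvent h z).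
Local Notation W i := (Im (G i i) / Im z).

(** The contractions [(k, l) = (i, j)] and [(k, l) = (j, i)] give [|G_xi G_ij G_jy|] and
    [|G_xi G_jj G_iy|], besides the terms with [1 / a]. After [2 p q <= p^2 + q^2], each sum over
    [i] and [j] is made of Ward sums [W], except for the sum of [|G_jj|]. *)
Definition step_bound : R :=
  (2^-1 + 2 / a) * (W x * W y) + 2^-1 * (\sum_i W i)
  + 2^-1 * (\sum_j nc (G j j)) * (W x + W y).

Local Notation M i j k l := (nc (G x i) * nc (G j k) * nc (G l y)
     + a^-1 * (nc (G x i) * nc (G j y) * (nc (G x k) * nc (G l y)))).

Let WE i : \sum_j nc (G j i) ^+ 2 = W i.
Proof. by rewrite -Ward //; apply: eq_bigr => j _; rewrite (resolvent_sym z hs). Qed.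

Let sumM : \sum_i \sum_j (M i j i j + M i j j i) <= step_bound.
Proof.
have e1 : \sum_i \sum_j nc (G x i) ^+ 2 * nc (G j y) ^+ 2 = W x * W y.
  rewrite -Ward // mulr_suml; apply: eq_bigr => i _.
  by rewrite -mulr_sumr WE.
have e2 : \sum_i \sum_j nc (G i j) ^+ 2 = \sum_i W i.
  by apply: eq_bigr => i _; rewrite Ward.
have e3 : \sum_i \sum_j (nc (G x i) ^+ 2 + nc (G i y) ^+ 2) * nc (G j j) =
    (\sum_j nc (G j j)) * (W x + W y).
  rewrite -(Ward hs z_gt0 x) -WE -big_split mulrC mulr_suml.
  by apply: eq_bigr => i _; rewrite mulr_sumr.
have e4 : \sum_i \sum_j nc (G x j) ^+ 2 * nc (G i y) ^+ 2 = W x * W y.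
  by rewrite exchange_big.
have -> : step_bound = (2^-1 + a^-1 + a^-1 * 2^-1) * (\sum_i \sum_j nc (G x i) ^+ 2 * nc (G j y) ^+ 2)
   + 2^-1 * (\sum_i \sum_j nc (G i j) ^+ 2)
   + 2^-1 * (\sum_i \sum_j (nc (G x i) ^+ 2 + nc (G i y) ^+ 2) * nc (G j j))
   + a^-1 * 2^-1 * (\sum_i \sum_j nc (G x j) ^+ 2 * nc (G i y) ^+ 2).
  by rewrite e1 e2 e3 e4 /step_bound; field; rewrite !gt_eqF.
rewrite !mulr_sumr -!big_split /=; apply: ler_sum => i _.
rewrite !mulr_sumr -!big_split /=; apply: ler_sum => j _.
rewrite (resolvent_sym z hs j i).
have am (p q : R) : p * q <= 2^-1 * p ^+ 2 + 2^-1 * q ^+ 2.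
  have e : 2^-1 * p ^+ 2 + 2^-1 * q ^+ 2 - p * q = 2^-1 * (p - q) ^+ 2 by field.
  by rewrite -subr_ge0 e mulr_ge0 ?sqr_ge0 // invr_ge0.
have a1 : nc (G x i) * nc (G i j) * nc (G j y) <=
   2^-1 * (nc (G x i) ^+ 2 * nc (G j y) ^+ 2) + 2^-1 * nc (G i j) ^+ 2.
  by rewrite -exprMn mulrAC am.
have a2 : nc (G x i) * nc (G j j) * nc (G i y) <=
   2^-1 * ((nc (G x i) ^+ 2 + nc (G i y) ^+ 2) * nc (G j j)).
  by rewrite mulrAC mulrA ler_wpM2r ?nc_ge0 // mulrDr am.
have a3 : a^-1 * (nc (G x i) * nc (G j y) * (nc (G x j) * nc (G i y))) <=
   a^-1 * (2^-1 * (nc (G x i) ^+ 2 * nc (G j y) ^+ 2) + 2^-1 * (nc (G x j) ^+ 2 * nc (G i y) ^+ 2)).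
  by rewrite ler_wpM2l ?invr_ge0 ?(ltW a_gt0) // -!exprMn am.
apply: le_trans (_ : _ <= 2^-1 * (nc (G x i) ^+ 2 * nc (G j y) ^+ 2) + 2^-1 * nc (G i j) ^+ 2
  + a^-1 * (nc (G x i) ^+ 2 * nc (G j y) ^+ 2) + (2^-1 * ((nc (G x i) ^+ 2 + nc (G i y) ^+ 2) * nc (G j j))
  + a^-1 * (2^-1 * (nc (G x i) ^+ 2 * nc (G j y) ^+ 2) + 2^-1 * (nc (G x j) ^+ 2 * nc (G i y) ^+ 2)))) _.
  apply: lerD; apply: lerD => //.
  by rewrite le_eqVlt; apply/orP; left; apply/eqP; ring.
by rewrite le_eqVlt; apply/orP; left; apply/eqP; ring.
Qed.

Lemma step_quadratic_sum_le (c : 'I_n -> 'I_n -> 'I_n -> 'I_n -> R) (K : R) :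
  0 <= K ->
  (forall i j k l, `|c i j k l| <=
     K * (((i == k) && (j == l))%:R + ((i == l) && (j == k))%:R)) ->
  \sum_i \sum_j \sum_k \sum_l step_quadratic h z g0 a x y i j k l * c i j k l
  <= K * step_bound.
Proof.
move=> K0 hc; apply: (@le_trans _ _ (K * \sum_i \sum_j (M i j i j + M i j j i))); last first.
  by rewrite ler_wpM2l // sumM.
rewrite mulr_sumr; apply: ler_sum => i _; rewrite mulr_sumr; apply: ler_sum => j _.
have M0 k l : 0 <= M i j k l by rewrite addr_ge0 ?mulr_ge0 ?invr_ge0 ?nc_ge0 // ltW.
apply: (@le_trans _ _ (\sum_k \sum_l
   (M i j k l * (K * (((i == k) && (j == l))%:R + ((i == l) && (j == k))%:R))))).
  apply: ler_sum => k _; apply: ler_sum => l _.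
  apply: (le_trans (ler_norm _)); rewrite normrM.
  by apply: ler_pM; rewrite ?normr_ge0 // step_quadratic_le.
have s1 : \sum_k \sum_l M i j k l * ((i == k) && (j == l))%:R = M i j i j.
  rewrite (bigD1 i) //= [X in _ + X]big1 => [|k ki]; last first.
    by rewrite big1 // => l _; rewrite eq_sym (negPf ki) mulr0.
  rewrite (bigD1 j) //= !eqxx mulr1 big1 ?addr0 // => l lj.
  by rewrite [j == l]eq_sym (negPf lj) andbF mulr0.
have s2 : \sum_k \sum_l M i j k l * ((i == l) && (j == k))%:R = M i j j i.
  rewrite (bigD1 j) //= [X in _ + X]big1 => [|k kj]; last first.
    by rewrite big1 // => l _; rewrite [j == k]eq_sym (negPf kj) andbF mulr0.
  rewrite (bigD1 i) //= !eqxx mulr1 big1 ?addr0 // => l li.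
  by rewrite [i == l]eq_sym (negPf li) mulr0.
rewrite -s1 -s2 -big_split mulr_sumr le_eqVlt; apply/orP; left; apply/eqP.
apply: eq_bigr => k _; rewrite -big_split mulr_sumr.
by apply: eq_bigr => l _ /=; ring.
Qed.

End StepSum.

Lemma measurable_smooth_abs d (T : measurableType d) (R : realType) (a : R)
    (f : T -> R[i]) : cmeas f -> measurable_fun setT (fun t => smooth_abs a (f t)).
Proof.
move=> mf; have m2 : measurable_fun setT (fun t => nc (f t) ^+ 2 + a ^+ 2).
  by apply: measurable_funD; [exact: cmeas_nc2|exact: measurable_cst].
apply: (measurableT_comp _ m2); apply: continuous_measurable_fun.
exact: sqrt_continuous.
Qed.

(** * Means of signed variables, and the mean growth over one step *)

Section Mean.
Context d (Omega : measurableType d) (R : realType) (P : probability Omega R).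
Implicit Types (f g : Omega -> R).

(** Integrability is bundled with the value because the linear and quadratic terms in the noise have
    no sign, and their integrals must be split. *)
Definition has_mean f (m : R) := P.-integrable setT (EFin \o f) /\
  (\int[P]_w (f w)%:E = m%:E)%E.

Lemma has_mean_cst (k : R) : has_mean (fun=> k) k.
Proof.
have e : (\int[P]_w (cst k%:E) w = k%:E)%E.
  by rewrite integral_cst // [X in (_ * X)%E]probability_setT mule1.
split=> //; apply/integrableP; split; first exact: measurable_cst.
rewrite (_ : (fun _ => _) = cst (`|k|%:E)) // integral_cst //.
by rewrite [X in (_ * X)%E]probability_setT mule1 ltry.
Qed.

Lemma has_meanD f g m n : has_mean f m -> has_mean g n ->
  has_mean (fun w => f w + g w) (m + n).
Proof.
move=> [i1 e1] [i2 e2]; split; first exact: (integrableD measurableT i1 i2).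
by under eq_integral do rewrite EFinD; rewrite integralD // e1 e2 EFinD.
Qed.

Lemma has_meanZ f m k : has_mean f m -> has_mean (fun w => k * f w) (k * m).
Proof.
move=> [i1 e1]; split; first exact: (integrableZl measurableT k i1).
by under eq_integral do rewrite EFinM; rewrite integralZl // e1 EFinM.
Qed.

Lemma has_mean_sum (I : Type) (r : seq I) (f : I -> Omega -> R) (m : I -> R) :
  (forall i, has_mean (f i) (m i)) ->
  has_mean (fun w => \sum_(i <- r) f i w) (\sum_(i <- r) m i).
Proof.
move=> h; elim: r => [|i r IH].
  rewrite big_nil (_ : (fun _ => _) = fun=> 0); first exact: has_mean_cst.
  by apply/funext => w; rewrite big_nil.
rewrite big_cons (_ : (fun _ => _) = fun w => f i w + \sum_(j <- r) f j w).
  exact: has_meanD.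
by apply/funext => w; rewrite big_cons.
Qed.

Lemma has_mean_measurable f m : has_mean f m -> measurable_fun setT f.
Proof. by move=> [/integrableP[/measurable_EFinP]]. Qed.

Lemma ge0_has_mean_le f (k : R) : measurable_fun setT f -> (forall w, 0 <= f w) ->
  (\int[P]_w (f w)%:E <= k%:E)%E -> exists2 m, has_mean f m & m <= k.
Proof.
move=> mf f0 fk; have I0 : (0 <= \int[P]_w (f w)%:E)%E by apply: integral_ge0 => w _; rewrite lee_fin.
have Ifin : (\int[P]_w (f w)%:E)%E \is a fin_num.
  by rewrite ge0_fin_numE // (le_lt_trans fk) // ltry.
exists (fine (\int[P]_w (f w)%:E)); last by rewrite -lee_fin fineK.
split; last by rewrite fineK.
apply/integrableP; split; first exact/measurable_EFinP.
under eq_integral do rewrite /= ger0_norm //.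
by rewrite (le_lt_trans fk) // ltry.
Qed.

End Mean.

Section IntegralStep.
Context d (Omega : measurableType d) (R : realType) (P : probability Omega R).
Variables (n : nat) (h : 'I_n -> 'I_n -> R) (z g0 : R[i]) (a : R) (x y : 'I_n).
Hypotheses (hs : symf h) (z_gt0 : 0 < Im z) (a_gt0 : 0 < a).
Variable F : 'I_n -> 'I_n -> Omega -> R.
Variables (c : 'I_n -> 'I_n -> 'I_n -> 'I_n -> R) (K r3 r4 : R).
Hypothesis Fs : forall i j w, F i j w = F j i w.
Hypothesis meanF : forall i j, has_mean P (F i j) 0.
Hypothesis covF : forall i j k l, has_mean P (fun w => F i j w * F k l w) (c i j k l).
Hypothesis K_ge0 : 0 <= K.
Hypothesis c_le : forall i j k l, `|c i j k l| <=
     K * (((i == k) && (j == l))%:R + ((i == l) && (j == k))%:R).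
Hypothesis S3 : (\int[P]_w ((\sum_i \sum_j `|F i j w|) ^+ 3)%:E <= r3%:E)%E.
Hypothesis S4 : (\int[P]_w ((\sum_i \sum_j `|F i j w|) ^+ 4)%:E <= r4%:E)%E.

Let S w := \sum_i \sum_j `|F i j w|.

Let mF i j : measurable_fun setT (F i j).
Proof. exact: has_mean_measurable (meanF i j). Qed.

Let mS : measurable_fun setT S.
Proof.
rewrite /S; apply: measurable_sum => i; apply: measurable_sum => j.
exact: measurableT_comp.
Qed.

Let S_ge0 w : 0 <= S w.
Proof. by apply: sumr_ge0 => i _; apply: sumr_ge0. Qed.

(** [h] and [g0] are deterministic here: this is the step conditional on the past. The linear term
    has mean 0, and the covariance bound turns the quadratic one into [K * step_bound]. *)
Lemma integral_step :
  (\int[P]_w (smooth_abs a (resolvent (fun i j => (h i j + F i j w)%R) z x y - g0))%:E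
   <= (smooth_abs a (resolvent h z x y - g0) + K * step_bound h z a x y
       + (r3 / Im z ^+ 4 + r4 / Im z ^+ 6 / a))%:E)%E.
Proof.
pose l := step_linear h z g0 a x y; pose m := step_quadratic h z g0 a x y.
have e0 : \sum_(i < n) \sum_(j < n) l i j * 0 = 0.
  by rewrite big1 // => i _; rewrite big1 // => j _; rewrite mulr0.
have hL : has_mean P (fun w => \sum_i \sum_j l i j * F i j w)
    (\sum_(i < n) \sum_(j < n) l i j * 0).
  by apply: has_mean_sum => i; apply: has_mean_sum => j; apply: has_meanZ.
rewrite e0 in hL.
have hQ : has_mean P (fun w => \sum_i \sum_j \sum_k \sum_l m i j k l * (F i j w * F k l w))
   (\sum_i \sum_j \sum_k \sum_l m i j k l * c i j k l).
  by do 4 (apply: has_mean_sum => ?); apply: has_meanZ.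
have [r3' h3 le3] : exists2 r, has_mean P (fun w => S w ^+ 3) r & r <= r3.
  apply: ge0_has_mean_le => //; first exact: measurable_funX.
  by move=> w; rewrite exprn_ge0.
have [r4' h4 le4] : exists2 r, has_mean P (fun w => S w ^+ 4) r & r <= r4.
  apply: ge0_has_mean_le => //; first exact: measurable_funX.
  by move=> w; rewrite exprn_ge0.
have hall := has_meanD (has_meanD (has_meanD (has_mean_cst P (smooth_abs a (resolvent h z x y - g0))) hL) hQ)
   (has_meanD (has_meanZ (Im z ^+ 4)^-1 h3) (has_meanZ (Im z ^+ 6 * a)^-1 h4)).
have [_ e] := hall.
apply: le_trans (_ : (_ <= (smooth_abs a (resolvent h z x y - g0) + 0 +
   \sum_i \sum_j \sum_k \sum_l m i j k l * c i j k l
   + ((Im z ^+ 4)^-1 * r3' + (Im z ^+ 6 * a)^-1 * r4'))%:E)%E) _.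
  rewrite -e; apply: ge0_le_integral => //.
  - by move=> w _; rewrite lee_fin; exact: sqrtr_ge0.
  - apply/measurable_EFinP.
    have mr : cmeas (fun w => resolvent (fun i j => h i j + F i j w) z x y - g0).
      apply: cmeasD; last exact: cmeas_cst.
      apply: cmeas_resolvent => // [i j|w i j]; last by rewrite hs Fs.
      by apply: measurable_funD => //; exact: measurable_cst.
    exact: measurable_smooth_abs.
  - by apply/measurable_EFinP; exact: has_mean_measurable hall.
  move=> w _; rewrite lee_fin.
  have hs' : symf (fun i j => h i j + F i j w) by move=> i j; rewrite hs Fs.
  have := step_inequality g0 x y hs z_gt0 a_gt0 hs'.
  rewrite -/l -/m.
  have Fe i j : h i j + F i j w - h i j = F i j w by ring.
  have -> : \sum_i \sum_j `|h i j + F i j w - h i j| = S w.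
    by apply: eq_bigr => i _; apply: eq_bigr => j _; rewrite Fe.
  have -> : \sum_i \sum_j l i j * (h i j + F i j w - h i j) = \sum_i \sum_j l i j * F i j w.
    by apply: eq_bigr => i _; apply: eq_bigr => j _; rewrite Fe.
  have -> : \sum_i \sum_j \sum_k \sum_l0
       m i j k l0 * ((h i j + F i j w - h i j) * (h k l0 + F k l0 w - h k l0)) =
       \sum_i \sum_j \sum_k \sum_l m i j k l * (F i j w * F k l w).
    apply: eq_bigr => i _; apply: eq_bigr => j _; apply: eq_bigr => k _.
    by apply: eq_bigr => l0 _; rewrite !Fe.
  move=> /le_trans; apply; rewrite lerD2l lerD //.
    by rewrite mulrC.
  by rewrite -mulrA -invfM mulrC.
rewrite lee_fin addr0; apply: lerD.
  by rewrite lerD2l; apply: step_quadratic_sum_le.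
rewrite mulrC; apply: lerD; first by rewrite ler_pM2r // invr_gt0 exprn_gt0.
by rewrite mulrC -[leRHS]mulrA -invfM ler_pM2r // invr_gt0 mulr_gt0 // exprn_gt0.
Qed.

End IntegralStep.

(** * Covariance and moments of the matrix noise *)

Section Noise.
Variables (R : realType) (n : nat).

Definition sorted_pair (i j : 'I_n) : 'I_n * 'I_n := if (i <= j)%N then (i, j) else (j, i).

Lemma sorted_pair_le i j : ((sorted_pair i j).1 <= (sorted_pair i j).2)%N.
Proof. by rewrite /sorted_pair; case: (leqP i j) => [|/ltnW]. Qed.

Lemma sorted_pairC i j : sorted_pair i j = sorted_pair j i.
Proof.
by rewrite /sorted_pair; case: (ltngtP i j) => [//|//|/val_inj ->].
Qed.

Lemma sorted_pair_inj i j k l : sorted_pair i j = sorted_pair k l ->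
  (i == k) && (j == l) || (i == l) && (j == k).
Proof.
by rewrite /sorted_pair; case: leqP => _; case: leqP => _ [-> ->]; rewrite !eqxx ?orbT.
Qed.

Definition goe_scale (i j : 'I_n) : R := Num.sqrt ((1 + (i == j)%:R) / n%:R).

Lemma goe_scale_ge0 i j : 0 <= goe_scale i j. Proof. exact: sqrtr_ge0. Qed.

Lemma goe_scaleC i j : goe_scale i j = goe_scale j i.
Proof. by rewrite /goe_scale eq_sym. Qed.

Lemma goe_scale_sqr i j : goe_scale i j ^+ 2 <= 2 / n%:R.
Proof.
rewrite sqr_sqrtr ?divr_ge0 ?addr_ge0 ?ler0n // ler_wpM2r ?invr_ge0 ?ler0n //.
by rewrite (_ : 2 = 1 + 1) // lerD2l; case: (i == j).
Qed.

Lemma goe_scaleM i j k l : goe_scale i j * goe_scale k l <= 2 / n%:R.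
Proof.
have h1 := goe_scale_sqr i j; have h2 := goe_scale_sqr k l.
have := sqr_ge0 (goe_scale i j - goe_scale k l); rewrite sqrrB; lra.
Qed.

Lemma goe_scale_le2 i j : goe_scale i j <= 2.
Proof.
have n1 : (1 <= n)%N by case: n i {j} => [[]|].
have h : goe_scale i j ^+ 2 <= 2 ^+ 2.
  apply: (le_trans (goe_scale_sqr i j)); rewrite ler_pdivrMr ?ltr0n // expr2.
  have n1R : 1 <= n%:R :> R by rewrite ler1n.
  lra.
by rewrite -(@ler_pXn2r _ 2) // nnegrE ?goe_scale_ge0.
Qed.

(** The sum is at most [#|I|] times its largest term. This crude constant is harmless: it enters
    only the error that vanishes with the step length. *)
Lemma exprn_sum_le (I : finType) (f : I -> R) k : (forall i, 0 <= f i) ->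
  (\sum_i f i) ^+ k.+1 <= #|I|%:R ^+ k.+1 * \sum_i f i ^+ k.+1.
Proof.
move=> f0; have s0 : 0 <= \sum_i f i by apply: sumr_ge0.
have S0 : 0 <= \sum_i f i ^+ k.+1 by apply: sumr_ge0 => i _; rewrite exprn_ge0.
have [I0|/card_gt0P[i0 _]] := posnP #|I|.
  rewrite (eq_bigl pred0) ?big_pred0_eq ?expr0n ?mulr_ge0 ?exprn_ge0 //.
  by move=> i; have := card0_eq I0 i; rewrite !inE.
pose m := [arg max_(i > i0 | true) f i]%O.
have hm j : f j <= f m by rewrite /m; case: arg_maxP => // i _ h; exact: h.
apply: (@le_trans _ _ ((#|I|%:R * f m) ^+ k.+1)).
  rewrite lerXn2r ?nnegrE ?mulr_ge0 ?ler0n //.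
  apply: (le_trans (ler_sum _ (fun i _ => hm i))).
  by rewrite sumr_const mulr_natl.
rewrite exprMn ler_wpM2l ?exprn_ge0 // (bigD1 m) //= lerDl.
by apply: sumr_ge0 => i _; rewrite exprn_ge0.
Qed.

End Noise.

Definition pack_mfun d d' (T : measurableType d) (S : measurableType d')
    (f : T -> S) (mf : measurable_fun setT f) : {mfun T >-> S} :=
  MeasurableFun.Pack (MeasurableFun.Class (isMeasurableFun.Build _ _ _ _ _ mf)).

Section FlowIncrement.
Context d (Omega : measurableType d) (R : realType) (P : probability Omega R).
Variables (C : R) (n : nat) (T : 'I_n -> 'I_n -> Omega -> R) (V : 'I_n -> Omega -> R)
  (B : 'I_n -> 'I_n -> R -> Omega -> R).
Hypothesis hyps : flow_hyps P C T V B.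
Variables (s D : R).
Hypotheses (s_ge0 : 0 <= s) (D_gt0 : 0 < D).

Definition noise_increment (i j : 'I_n) (w : Omega) : R :=
  goe_scale R i j *
  increment (B (sorted_pair i j).1 (sorted_pair i j).2) s D w.

Local Notation X p := (increment (B p.1 p.2) s D).
Local Notation F := noise_increment.
Local Notation ok p := (p.1 <= p.2)%N.

Let bm (p : 'I_n * 'I_n) : ok p -> std_BM P (B p.1 p.2).
Proof. by have [_ _ _ h _] := hyps; exact: h. Qed.

Let mX (p : 'I_n * 'I_n) : ok p -> measurable_fun setT (X p).
Proof. by move=> /bm [_ _ mB _ _]; apply: measurable_funB; exact: mB. Qed.

Let sqrtD_gt0 : 0 < Num.sqrt D. Proof. by rewrite sqrtr_gt0. Qed.

Let lawX (p : 'I_n * 'I_n) (hp : ok p) (A : set R) : measurable A ->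
  P (pack_mfun (mX hp) @^-1` A) = normal_prob 0 (Num.sqrt D) A.
Proof. exact: (BM_increment_law (bm hp) s_ge0 D_gt0). Qed.

Let momentX (p : 'I_n * 'I_n) k : ok p -> (2 <= k <= 4)%N ->
  (\int[P]_w (`|X p w| ^+ k)%:E <= (128 * Num.sqrt D ^+ k)%:E)%E.
Proof. by move=> hp; exact: (normal_variable_moment sqrtD_gt0 (lawX hp)). Qed.

Let meanX (p : 'I_n * 'I_n) : ok p -> has_mean P (X p) 0.
Proof.
move=> hp; split; first exact: (integrable_normal_variable sqrtD_gt0 (lawX hp)).
exact: (normal_variable_mean sqrtD_gt0 (lawX hp)).
Qed.

Let sqrX (p : 'I_n * 'I_n) : ok p ->
  exists2 v, has_mean P (fun w => X p w * X p w) v & 0 <= v <= 128 * D.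
Proof.
move=> hp; have := @momentX p 2 hp isT; rewrite (sqr_sqrtr (ltW D_gt0)) => h.
have [|w||m hm mle] := @ge0_has_mean_le _ _ _ P (fun w => X p w ^+ 2) (128 * D).
- by apply: measurable_funX; exact: mX.
- exact: sqr_ge0.
- by under eq_integral do rewrite -(real_normK (num_real _)).
exists m => //; rewrite mle andbT; have [_ e] := hm.
by rewrite -lee_fin -e; apply: integral_ge0 => w _; rewrite lee_fin sqr_ge0.
Qed.

Let crossX (p q : 'I_n * 'I_n) : ok p -> ok q -> p != q ->
  has_mean P (fun w => X p w * X q w) 0.
Proof.
move=> hp hq pq; have [vp [ip _] _] := sqrX hp; have [vq [iq _] _] := sqrX hq.
have [iXp _] := meanX hp; have [iXq mq] := meanX hq.
split; last first.
  apply: (@integral_indep_mul0 _ _ _ P (pack_mfun (mX hp)) (pack_mfun (mX hq))) => // A A' mA mA'.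
  exact: (increments_pairwise_indep hyps s_ge0 D_gt0 hp hq pq mA mA').
apply: (le_integrable measurableT _ _ (integrableD measurableT ip iq)).
  by apply/measurable_EFinP; apply: measurable_funM; exact: mX.
move=> w _.
rewrite -[leLHS]/((`|X p w * X q w|)%:E) -[leRHS]/((`|X p w * X p w + X q w * X q w|)%:E) lee_fin.
have := sqr_ge0 (`|X p w| - `|X q w|); rewrite normrM sqrrB !real_normK ?num_real // !expr2.
move: (sqr_ge0 (X p w)) (sqr_ge0 (X q w)); rewrite !expr2 => u0 v0 h.
rewrite (ger0_norm (addr_ge0 u0 v0)); move: h; rewrite -mulr_natl; lra.
Qed.

Lemma mean_noise_increment i j : has_mean P (F i j) 0.
Proof.
have := has_meanZ (goe_scale R i j) (meanX (sorted_pair_le i j)).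
by rewrite mulr0.
Qed.

Lemma noise_increment_sym i j w : F i j w = F j i w.
Proof. by rewrite /noise_increment goe_scaleC sorted_pairC. Qed.

(** Distinct sorted pairs are uncorrelated, and equal ones force [{i, j} = {k, l}]. In
    [256 = 2 * 128], the 2 bounds [n] times a product of two scales and 128 is the constant of the
    normal moments. *)
Lemma cov_noise_increment : exists c : 'I_n -> 'I_n -> 'I_n -> 'I_n -> R,
  (forall i j k l, has_mean P (fun w => F i j w * F k l w) (c i j k l)) /\
  (forall i j k l, `|c i j k l| <= 256 * D / n%:R *
     (((i == k) && (j == l))%:R + ((i == l) && (j == k))%:R)).
Proof.
pose v (p : 'I_n * 'I_n) : R := fine (\int[P]_w (X p w * X p w)%:E)%E.
have hv (p : 'I_n * 'I_n) : ok p ->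
    has_mean P (fun w => X p w * X p w) (v p) /\ 0 <= v p <= 128 * D.
  by move=> /sqrX[m hm mle]; have [_ e] := hm; rewrite /v e.
exists (fun i j k l => goe_scale R i j * goe_scale R k l *
  (if sorted_pair i j == sorted_pair k l then v (sorted_pair i j) else 0)).
split=> i j k l.
  have hp := sorted_pair_le i j; have hq := sorted_pair_le k l.
  rewrite (_ : (fun w => _) = fun w => goe_scale R i j * goe_scale R k l *
     (X (sorted_pair i j) w * X (sorted_pair k l) w)); last first.
    by apply/funext => w; rewrite /noise_increment; ring.
  apply: has_meanZ; case: eqVneq => [<-|pq]; first by have [] := hv _ hp.
  exact: crossX.
case: eqVneq => [e|_]; last first.
  by rewrite mulr0 normr0 mulr_ge0 ?addr_ge0 ?divr_ge0 ?mulr_ge0 // ltW.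
have [_ /andP[v0 v1]] := hv _ (sorted_pair_le i j).
rewrite ger0_norm ?mulr_ge0 ?goe_scale_ge0 //.
have K0 : 0 <= 256 * D / n%:R by rewrite divr_ge0 // mulr_ge0 // ltW.
apply: (@le_trans _ _ (256 * D / n%:R)).
  rewrite (_ : 256 * D / n%:R = 2 / n%:R * (128 * D)); last by ring.
  by apply: ler_pM; rewrite ?mulr_ge0 ?goe_scale_ge0 // goe_scaleM.
rewrite -[leLHS]mulr1 ler_wpM2l //.
by case/orP: (sorted_pair_inj e) => ->; rewrite ?lerDl ?lerDr.
Qed.

Definition noise_moment_const k : R :=
  (n * n)%:R ^+ k * ((n * n)%:R * (2 ^+ k * 128)).

Lemma moment_noise_increment k : (1 <= k <= 3)%N ->
  (\int[P]_w ((\sum_i \sum_j `|F i j w|)%R ^+ k.+1)%:E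
   <= (noise_moment_const k.+1 * Num.sqrt D ^+ k.+1)%:E)%E.
Proof.
move=> k13; have card : #|{: 'I_n * 'I_n}| = (n * n)%N by rewrite card_prod card_ord.
have mF i j : measurable_fun setT (F i j) := has_mean_measurable (mean_noise_increment i j).
pose A (p : 'I_n * 'I_n) w := `|F p.1 p.2 w|.
have A0 p w : 0 <= A p w by exact: normr_ge0.
have mA p : measurable_fun setT (A p) by apply: measurableT_comp => //; exact: mF.
apply: (@le_trans _ _ (\int[P]_w (((n * n)%:R ^+ k.+1)%:E * \sum_p (A p w ^+ k.+1)%:E))%E).
  apply: ge0_le_integral => //.
  - by move=> w _; rewrite lee_fin exprn_ge0 // sumr_ge0 // => i _; rewrite sumr_ge0.
  - apply/measurable_EFinP; apply: measurable_funX; apply: measurable_sum => i.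
    by apply: measurable_sum => j; exact: (mA (i, j)).
  - apply: measurable_funeM; apply: emeasurable_sum => p.
    by apply/measurable_EFinP; exact: measurable_funX.
  move=> w _; rewrite sumEFin -EFinM lee_fin pair_bigA /=.
  have := @exprn_sum_le R _ (fun p => A p w) k (fun p => normr_ge0 _).
  by rewrite card.
rewrite ge0_integralZl //; last 2 first.
- by apply: emeasurable_sum => p; apply/measurable_EFinP; exact: measurable_funX.
- by move=> w _; apply: sume_ge0 => p _; rewrite lee_fin exprn_ge0 ?A0.
rewrite /noise_moment_const -mulrA EFinM; apply: lee_wpmul2l; first by rewrite lee_fin exprn_ge0 ?A0.
rewrite ge0_integral_sum //; last 2 first.
- by move=> p; apply/measurable_EFinP; exact: measurable_funX.
- by move=> p w _; rewrite lee_fin exprn_ge0 ?A0.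
apply: (@le_trans _ _ (\sum_(p : 'I_n * 'I_n) (2 ^+ k.+1 * 128 * Num.sqrt D ^+ k.+1)%:E)%E).
  apply: lee_sum => p _; have hp := sorted_pair_le p.1 p.2.
  have mXk : measurable_fun setT (fun w => `|X (sorted_pair p.1 p.2) w| ^+ k.+1).
    by apply: measurable_funX; apply: measurableT_comp => //; exact: mX.
  apply: (@le_trans _ _ (\int[P]_w ((2 ^+ k.+1)%:E * (`|X (sorted_pair p.1 p.2) w| ^+ k.+1)%:E))%E).
    apply: ge0_le_integral => //.
    - by move=> w _; rewrite lee_fin exprn_ge0 ?A0.
    - by apply/measurable_EFinP; exact: measurable_funX.
    - by apply: measurable_funeM; apply/measurable_EFinP.
    move=> w _; rewrite -EFinM lee_fin /A /noise_increment normrM exprMn.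
    rewrite ler_wpM2r ?exprn_ge0 // ger0_norm ?goe_scale_ge0 //.
    by rewrite lerXn2r ?nnegrE ?goe_scale_ge0 // goe_scale_le2.
  rewrite ge0_integralZl //; last first.
    exact/measurable_EFinP.
  by rewrite -mulrA EFinM; apply: lee_wpmul2l; [rewrite lee_fin exprn_ge0|exact: momentX].
rewrite sumEFin lee_fin sumr_const card -mulr_natl le_eqVlt; apply/orP; left; apply/eqP.
ring.
Qed.

End FlowIncrement.

(** * Mean of the step bound over the potential *)

Section AndersonStep.
Context d (Omega : measurableType d) (R : realType) (P : probability Omega R).
Variables (n : nat) (V : 'I_n -> Omega -> R) (C : R).
Hypothesis C_ge0 : 0 <= C.
Hypothesis mV : forall x, measurable_fun setT (V x).
Hypothesis density : forall (x : 'I_n) (I : set R), measurable I ->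
  forall A, gen_sigma [set y | y != x] V A ->
  (P (V x @^-1` I `&` A) <= C%:E * lebesgue_measure I * P A)%E.
Variable z : R[i].
Hypothesis z_gt0 : 0 < Im z.
Variable A : 'I_n -> 'I_n -> R.
Hypothesis As : symf A.
Variables (a e : R).
Hypotheses (a_gt0 : 0 < a) (e_gt0 : 0 < e) (e_le1 : e <= 1).

Local Notation H w := (with_diag A (fun i => V i w)).
Local Notation G w := (resolvent (H w) z).
Local Notation W i w := (Im (G w i i) / Im z).
Local Notation C1 := (32 * C).
Local Notation Lam := (1 + 32 * C / e * Im z `^ (- e)).

Let Hs w : symf (H w). Proof. exact: with_diag_sym. Qed.

Let mG i j : cmeas (fun w => G w i j).
Proof.
apply: cmeas_resolvent => // k l; rewrite /with_diag.
apply: measurable_funD; first exact: measurable_cst.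
by case: eqP => _; [exact: mV|exact: measurable_cst].
Qed.

Let mIm i j : measurable_fun setT (fun w => Im (G w i j)). Proof. by have [] := mG i j. Qed.

Let mnc i j : measurable_fun setT (fun w => nc (G w i j)). Proof. exact: cmeas_nc. Qed.

Let Im_ge0 i w : 0 <= Im (G w i i). Proof. exact: Im_resolvent_ge0. Qed.

(** Ward turns the sum into [Im (G x x) / Im z], to which Wegner applies. This pays for the diagonal
    terms and for the off-diagonal errors of both sums below. *)
Let sum_nc2 x : (\sum_y \int[P]_w (nc (G w x y) ^+ 2)%:E <= (C1 / Im z)%:E)%E.
Proof.
rewrite -ge0_integral_sum //; last 2 first.
- by move=> y; apply/measurable_EFinP; exact: measurable_funX.
- by move=> y w _; rewrite lee_fin sqr_ge0.
have -> : (\int[P]_w (\sum_y (nc (G w x y) ^+ 2)%:E) =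
    \int[P]_w ((Im z)^-1%:E * (Im (G w x x))%:E))%E.
  by apply: eq_integral => w _; rewrite sumEFin Ward // mulrC EFinM.
rewrite ge0_integralZl //; last 3 first.
- exact/measurable_EFinP.
- by move=> w _; rewrite lee_fin.
- by rewrite lee_fin invr_ge0 ltW.
rewrite (mulrC C1) EFinM; apply: lee_wpmul2l; first by rewrite lee_fin invr_ge0 ltW.
exact: (wegner C_ge0 mV density z_gt0 As).
Qed.

Lemma sum_Im_Im x :
  (\sum_y \int[P]_w (Im (G w x x) * Im (G w y y))%:E <= (n%:R * C1 ^+ 2 + C1 / Im z)%:E)%E.
Proof.
apply: (@le_trans _ _ (\sum_(y < n) ((C1 ^+ 2)%:E + \int[P]_w (nc (G w x y) ^+ 2)%:E))%E).
  apply: lee_sum => y _; have [<-|xy] := eqVneq x y.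
    apply: (@le_trans _ _ (\int[P]_w (nc (G w x x) ^+ 2)%:E)%E); last first.
      by rewrite leeDr // lee_fin sqr_ge0.
    apply: ge0_le_integral => //.
    - by move=> w _; rewrite lee_fin mulr_ge0.
    - by apply/measurable_EFinP; exact: measurable_funM.
    - by apply/measurable_EFinP; exact: measurable_funX.
    by move=> w _; rewrite lee_fin ncE2 -expr2 lerDr sqr_ge0.
  apply: (le_trans (minami C_ge0 mV density z_gt0 As xy)); apply: leeD2l.
  apply: ge0_le_integral => //.
  - by move=> w _; rewrite lee_fin sqr_ge0.
  - by apply/measurable_EFinP; exact: measurable_funX.
  - by apply/measurable_EFinP; exact: measurable_funX.
  by move=> w _; rewrite lee_fin ncE2 lerDr sqr_ge0.
rewrite big_split /= sumEFin sumr_const card_ord -[_ *+ n]mulr_natl EFinD.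
by apply: leeD2l; exact: sum_nc2.
Qed.

(** Enlarging [Im G_yy] to [|G_yy|] costs a further [eta^(-e)], but the product then differs from
    the minor of [minor_moment] only by [G_yj^2]. *)
Lemma sum_nc_Im y :
  (\sum_j \int[P]_w (nc (G w j j) * Im (G w y y))%:E <= (n%:R * Lam ^+ 2 + C1 / Im z)%:E)%E.
Proof.
have mM j : cmeas (fun w => G w y y * G w j j - G w y j ^+ 2).
  apply: cmeasD; first exact: cmeasM.
  by apply: cmeasN; under eq_fun do rewrite expr2; exact: cmeasM.
apply: (@le_trans _ _ (\sum_(j < n) ((Lam ^+ 2)%:E + \int[P]_w (nc (G w y j) ^+ 2)%:E))%E).
  apply: lee_sum => j _; have [<-|yj] := eqVneq y j.
    apply: (@le_trans _ _ (\int[P]_w (nc (G w y y) ^+ 2)%:E)%E); last first.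
      by rewrite leeDr // lee_fin sqr_ge0.
    apply: ge0_le_integral => //.
    - by move=> w _; rewrite lee_fin mulr_ge0 ?nc_ge0.
    - by apply/measurable_EFinP; exact: measurable_funM.
    - by apply/measurable_EFinP; exact: measurable_funX.
    move=> w _; rewrite lee_fin expr2 ler_wpM2l ?nc_ge0 //.
    exact: le_trans (ler_norm _) (Im_le_nc _).
  apply: (@le_trans _ _ (\int[P]_w (nc (G w y y * G w j j - G w y j ^+ 2))%:E
      + \int[P]_w (nc (G w y j) ^+ 2)%:E)%E); last first.
    by apply: leeD2r; exact: (minor_moment C_ge0 mV density z_gt0 As yj).
  rewrite -ge0_integralD //; last 4 first.
  - by move=> w _; rewrite lee_fin nc_ge0.
  - by apply/measurable_EFinP; exact: cmeas_nc.
  - by move=> w _; rewrite lee_fin sqr_ge0.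
  - by apply/measurable_EFinP; exact: measurable_funX.
  apply: ge0_le_integral => //.
  - by move=> w _; rewrite lee_fin mulr_ge0 ?nc_ge0.
  - by apply/measurable_EFinP; exact: measurable_funM.
  - apply: emeasurable_funD; apply/measurable_EFinP; first exact: cmeas_nc.
    exact: measurable_funX.
  move=> w _; rewrite -EFinD lee_fin.
  apply: (@le_trans _ _ (nc (G w y y * G w j j))).
    rewrite Normc.normcM mulrC ler_wpM2r ?nc_ge0 //.
    exact: le_trans (ler_norm _) (Im_le_nc _).
  have -> : nc (G w y j) ^+ 2 = nc (G w y j ^+ 2) by rewrite !expr2 Normc.normcM.
  have e2 : G w y y * G w j j = (G w y y * G w j j - G w y j ^+ 2) + G w y j ^+ 2 by rewrite subrK.
  by rewrite {1}e2; exact: le_normcD.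
rewrite big_split /= sumEFin sumr_const card_ord -[_ *+ n]mulr_natl EFinD.
by apply: leeD2l; exact: sum_nc2.
Qed.

(** Line by line, the three terms of [step_bound] summed over [y]. In the last one, the sums with
    [W x] and with [W y] have the same bound, and adding them cancels the factor [1/2]. *)
Definition anderson_bound : R :=
  (2^-1 + 2 / a) * ((n%:R * C1 ^+ 2 + C1 / Im z) / Im z ^+ 2)
  + 2^-1 * (n%:R * (n%:R * (C1 / Im z)))
  + n%:R * ((n%:R * Lam ^+ 2 + C1 / Im z) / Im z).

Lemma anderson_step_bound x :
  (\int[P]_w (\sum_y step_bound (H w) z a x y)%:E <= anderson_bound%:E)%E.
Proof.
have W_ge0 i w : 0 <= W i w by rewrite divr_ge0 // ltW.
have mW i : measurable_fun setT (fun w => W i w).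
  by apply: measurable_funM => //; exact: measurable_cst.
pose f1 w := \sum_y Im (G w x x) * Im (G w y y).
pose f2 w := \sum_i Im (G w i i).
pose f3 w := \sum_y \sum_j (nc (G w j j) * Im (G w x x) + nc (G w j j) * Im (G w y y)).
have f1_ge0 w : 0 <= f1 w by apply: sumr_ge0 => y _; rewrite mulr_ge0.
have f2_ge0 w : 0 <= f2 w by apply: sumr_ge0.
have g_ge0 w y j : 0 <= nc (G w j j) * Im (G w y y) by rewrite mulr_ge0 ?nc_ge0.
have f3_ge0 w : 0 <= f3 w.
  by apply: sumr_ge0 => y _; apply: sumr_ge0 => j _; rewrite addr_ge0.
have mg y j : measurable_fun setT (fun w => nc (G w j j) * Im (G w y y)).
  exact: measurable_funM.
have mf1 : measurable_fun setT f1.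
  by apply: measurable_sum => y; exact: measurable_funM.
have mf2 : measurable_fun setT f2 by exact: measurable_sum.
have mf3 : measurable_fun setT f3.
  by apply: measurable_sum => y; apply: measurable_sum => j; exact: measurable_funD.
have i1 : (\int[P]_w (f1 w)%:E <= (n%:R * C1 ^+ 2 + C1 / Im z)%:E)%E.
  under eq_integral do rewrite /f1 -sumEFin.
  rewrite ge0_integral_sum // => [|y|y w _]; last by rewrite lee_fin mulr_ge0.
    exact: sum_Im_Im.
  by apply/measurable_EFinP; exact: measurable_funM.
have i2 : (\int[P]_w (f2 w)%:E <= (n%:R * C1)%:E)%E.
  under eq_integral do rewrite /f2 -sumEFin.
  rewrite ge0_integral_sum // => [|y|y w _]; last by rewrite lee_fin.
    apply: (@le_trans _ _ (\sum_(i < n) C1%:E)%E).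
      by apply: lee_sum => i _; exact: (wegner C_ge0 mV density z_gt0 As).
    by rewrite sumEFin sumr_const card_ord -[_ *+ n]mulr_natl.
  exact/measurable_EFinP.
have i3 : (\int[P]_w (f3 w)%:E <= (2 * n%:R * (n%:R * Lam ^+ 2 + C1 / Im z))%:E)%E.
  have -> : (\int[P]_w (f3 w)%:E = \sum_y (\sum_j \int[P]_w (nc (G w j j) * Im (G w x x))%:E
       + \sum_j \int[P]_w (nc (G w j j) * Im (G w y y))%:E))%E.
    under eq_integral do rewrite /f3 -sumEFin.
    rewrite ge0_integral_sum // => [|y|y w _]; first last.
    - by rewrite lee_fin sumr_ge0 // => j _; rewrite addr_ge0.
    - by apply/measurable_EFinP; apply: measurable_sum => j; exact: measurable_funD.
    apply: eq_bigr => y _; under eq_integral do rewrite -sumEFin.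
    rewrite ge0_integral_sum // => [|j|j w _]; first last.
    - by rewrite lee_fin addr_ge0.
    - by apply/measurable_EFinP; exact: measurable_funD.
    rewrite -big_split; apply: eq_bigr => j _ /=.
    under eq_integral do rewrite EFinD.
    by rewrite ge0_integralD // => [w _||w _|]; rewrite ?lee_fin //; exact/measurable_EFinP.
  apply: (@le_trans _ _ (\sum_(y < n) ((n%:R * Lam ^+ 2 + C1 / Im z) + (n%:R * Lam ^+ 2 + C1 / Im z))%:E)%E).
    by apply: lee_sum => y _; rewrite EFinD; apply: leeD; exact: sum_nc_Im.
  rewrite sumEFin sumr_const card_ord -[_ *+ n]mulr_natl lee_fin le_eqVlt.
  by apply/orP; left; apply/eqP; ring.
pose k1 := (2^-1 + 2 / a) / Im z ^+ 2; pose k2 := 2^-1 * n%:R / Im z.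
pose k3 := 2^-1 / Im z.
have k1_ge0 : 0 <= k1 by rewrite divr_ge0 ?sqr_ge0 // addr_ge0 ?divr_ge0 ?invr_ge0 // ltW.
have k2_ge0 : 0 <= k2 by rewrite divr_ge0 ?mulr_ge0 // ltW.
have k3_ge0 : 0 <= k3 by rewrite divr_ge0 // ltW.
have z0 : Im z != 0 by rewrite gt_eqF.
have -> : (\int[P]_w (\sum_y step_bound (H w) z a x y)%:E =
   \int[P]_w (k1%:E * (f1 w)%:E + (k2%:E * (f2 w)%:E + k3%:E * (f3 w)%:E)))%E.
  apply: eq_integral => w _; rewrite -!EFinM -!EFinD; congr EFin.
  have -> : k2 * f2 w = \sum_(y < n) 2^-1 * \sum_i W i w.
    rewrite sumr_const card_ord -[_ *+ n]mulr_natl -mulr_suml /k2 /f2; field.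
    by rewrite z0.
  rewrite /f1 /f3 !mulr_sumr -!big_split; apply: eq_bigr => y _ /=.
  rewrite /step_bound big_split /= -!mulr_sumr -!mulr_suml /k1 /k3.
  by field; rewrite z0 gt_eqF.
rewrite ge0_integralD //; last 4 first.
- by move=> w _; rewrite -EFinM lee_fin mulr_ge0.
- by apply: measurable_funeM; exact/measurable_EFinP.
- by move=> w _; rewrite -!EFinM -EFinD lee_fin addr_ge0 // mulr_ge0.
- by apply: emeasurable_funD; apply: measurable_funeM; exact/measurable_EFinP.
rewrite ge0_integralD //; last 4 first.
- by move=> w _; rewrite -EFinM lee_fin mulr_ge0.
- by apply: measurable_funeM; exact/measurable_EFinP.
- by move=> w _; rewrite -EFinM lee_fin mulr_ge0.
- by apply: measurable_funeM; exact/measurable_EFinP.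
have Z (k : R) (f : Omega -> R) : 0 <= k -> measurable_fun setT f -> (forall w, 0 <= f w) ->
   (\int[P]_w (k%:E * (f w)%:E) = k%:E * \int[P]_w (f w)%:E)%E.
  move=> k0 mf f0; apply: ge0_integralZl => //; first exact/measurable_EFinP.
  by move=> w _; rewrite lee_fin.
rewrite !Z //.
apply: (@le_trans _ _ (k1%:E * (n%:R * C1 ^+ 2 + C1 / Im z)%:E + (k2%:E * (n%:R * C1)%:E
   + k3%:E * (2 * n%:R * (n%:R * Lam ^+ 2 + C1 / Im z))%:E))%E).
  by apply: leeD; [|apply: leeD]; apply: lee_wpmul2l; rewrite ?lee_fin.
rewrite -!EFinM -!EFinD lee_fin le_eqVlt; apply/orP; left; apply/eqP.
rewrite /anderson_bound /k1 /k2 /k3; set L := Lam; field.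
by rewrite z0 gt_eqF.
Qed.

End AndersonStep.

(** * Freezing one of two independent sigma-algebras *)

Section IndependentSigmas.
Context d (Omega : measurableType d) (R : realType) (P : probability Omega R).
Variables G1 G2 : set (set Omega).
Hypotheses (mG1 : G1 `<=` measurable) (mG2 : G2 `<=` measurable).
Hypothesis indep : forall A A', <<s G1 >> A -> <<s G2 >> A' -> (P (A `&` A') = P A * P A')%E.

Let id_measurable (G : set (set Omega)) : G `<=` measurable ->
  measurable_fun setT (id : Omega -> g_sigma_algebraType G).
Proof.
move=> mG _ A mA; rewrite setTI -[Z in measurable Z]/A.
suff : <<s G >> `<=` measurable by apply.
by apply: smallest_sub => //; exact: sigma_algebra_measurable.
Qed.

Lemma ge0_integral_indep_sigma (f : g_sigma_algebraType G1 * g_sigma_algebraType G2 -> \bar R) :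
  measurable_fun setT f -> (forall s, 0 <= f s)%E ->
  (\int[P]_w f (w, w) = \int[P]_w \int[P]_w' f (w, w'))%E.
Proof.
move=> mf f0.
apply: (@ge0_integral_indep _ _ _ _ _ _ _ P
  (pack_mfun (id_measurable mG1)) (pack_mfun (id_measurable mG2))) => //.
Qed.

(** Both arguments of [f] are the same point, seen through two independent sigma-algebras.
    Independence replaces the second by a separate [w'], so an estimate with the first one frozen
    can be integrated. *)
Lemma integral_indep_sigma_le (f : g_sigma_algebraType G1 * g_sigma_algebraType G2 -> \bar R)
    (g : Omega -> \bar R) :
  measurable_fun setT f -> (forall s, 0 <= f s)%E -> measurable_fun setT g ->
  (forall w, \int[P]_w' f (w, w') <= g w)%E ->
  (\int[P]_w f (w, w) <= \int[P]_w g w)%E.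
Proof.
move=> mf f0 mg fg; rewrite ge0_integral_indep_sigma //.
apply: ge0_le_integral => //; first by move=> w _; exact: integral_ge0.
pose f' (p : g_sigma_algebraType G1 * Omega) := f (p.1, p.2).
have mf' : measurable_fun setT f'.
  apply: (measurableT_comp mf); apply/measurable_fun_pairP; split.
    exact: measurable_fst.
  exact: (measurableT_comp (id_measurable mG2) measurable_snd).
have := @measurable_fun_fubini_tonelli_F _ _ _ _ R P f' mf' (fun p => f0 _).
by move=> /measurableT_comp /(_ (id_measurable mG1)).
Qed.

End IndependentSigmas.

Section StepBound.
Variables (R : realType) (n : nat) (z : R[i]) (a : R).
Hypotheses (z_gt0 : 0 < Im z) (a_gt0 : 0 < a).

Lemma step_bound_ge0 (h : 'I_n -> 'I_n -> R) x y : symf h -> 0 <= step_bound h z a x y.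
Proof.
move=> hs; have W0 i : 0 <= Im (resolvent h z i i) / Im z.
  by rewrite divr_ge0 ?Im_resolvent_ge0 // ltW.
have a0 : 0 <= 2 / a by rewrite divr_ge0 // ltW.
rewrite /step_bound; apply: addr_ge0; first apply: addr_ge0.
- by apply: mulr_ge0; [rewrite addr_ge0|exact: mulr_ge0].
- by apply: mulr_ge0 => //; apply: sumr_ge0.
- apply: mulr_ge0; last exact: addr_ge0.
  by apply: mulr_ge0 => //; apply: sumr_ge0 => j _; exact: nc_ge0.
Qed.

Lemma measurable_step_bound d (S : measurableType d) (h : S -> 'I_n -> 'I_n -> R) x y :
  (forall i j, measurable_fun setT (fun s => h s i j)) -> (forall s, symf (h s)) ->
  measurable_fun setT (fun s => step_bound (h s) z a x y).
Proof.
move=> mh hs; have mG i j : cmeas (fun s => resolvent (h s) z i j) by exact: cmeas_resolvent.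
have mW i : measurable_fun setT (fun s => Im (resolvent (h s) z i i) / Im z).
  by apply: measurable_funM; [have [] := mG i i|exact: measurable_cst].
have mc (k : R) f : measurable_fun setT f -> measurable_fun setT (fun s : S => k * f s).
  by move=> mf; apply: measurable_funM => //; exact: measurable_cst.
apply: measurable_funD; first apply: measurable_funD.
- by apply: (mc _ (fun s => _)); exact: measurable_funM.
- by apply: (mc _ (fun s => _)); exact: measurable_sum.
- apply: measurable_funM; last exact: measurable_funD.
  by apply: (mc _ (fun s => _)); apply: measurable_sum => j; exact: cmeas_nc.
Qed.

End StepBound.

(** * The matrix flow: growth of the deviation over one step *)

Section Flow.
Context d (Omega : measurableType d) (R : realType) (P : probability Omega R).
Variables (C : R) (n : nat) (T : 'I_n -> 'I_n -> Omega -> R) (V : 'I_n -> Omega -> R)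
  (B : 'I_n -> 'I_n -> R -> Omega -> R).

(** This is [T + Phi_t] without the potential: it is independent of [V] and can be frozen while [V]
    is averaged. *)
Definition environment t w (i j : 'I_n) : R :=
  T i j w + goe_scale R i j * B (sorted_pair i j).1 (sorted_pair i j).2 t w.
Definition flow_matrix t w := with_diag (environment t w) (fun i => V i w).

(* [Green] reads the entry [y x] of the inverse; the matrix is symmetric. *)
Lemma Green_resolvent z t w x y : (forall i j w, T i j w = T j i w) ->
  Green T V B t z w x y = resolvent (flow_matrix t w) z x y.
Proof.
move=> Ts; have es : symf (environment t w).
  by move=> i j; rewrite /environment Ts goe_scaleC sorted_pairC.
have fs : symf (flow_matrix t w) by exact: with_diag_sym.
rewrite resolvent_sym // /Green /resolvent; congr (invmx (_ - _) _ _).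
apply/matrixP => i j; rewrite !mxE /flow_matrix /with_diag /environment /goe_scale /sorted_pair.
congr (_%:C); case: leqP => _ /=; case: eqP => _; rewrite ?mul1r ?mul0r ?mulr1n ?mulr0n ?addr0 //.
  by rewrite addrAC.
by rewrite addrAC.
Qed.

Hypothesis hyps : flow_hyps P C T V B.

Lemma environment_sym t w : symf (environment t w).
Proof.
by move=> i j; rewrite /environment goe_scaleC sorted_pairC; have [[_ ->]] := hyps.
Qed.

Lemma flow_matrix_sym t w : symf (flow_matrix t w).
Proof. by apply: with_diag_sym; exact: environment_sym. Qed.

Lemma flow_matrixD s D w i j :
  flow_matrix (s + D) w i j = flow_matrix s w i j + noise_increment B s D i j w.
Proof. by rewrite /flow_matrix /with_diag /environment /noise_increment /increment; ring. Qed.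

Lemma flow_matrix0 w i j : flow_matrix 0 w i j = with_diag (fun i j => T i j w) (fun i => V i w) i j.
Proof.
have [_ _ _ bm _] := hyps; have [b0 _ _ _ _] := bm _ _ (sorted_pair_le i j).
by rewrite /flow_matrix /with_diag /environment b0 mulr0 addr0.
Qed.

Lemma measurable_flow_matrix t i j : measurable_fun setT (fun w => flow_matrix t w i j).
Proof.
have [[mT _] mV _ bm _] := hyps; have [_ _ mB _ _] := bm _ _ (sorted_pair_le i j).
apply: measurable_funD; last by case: eqP => _; [exact: mV|exact: measurable_cst].
apply: measurable_funD; first exact: mT.
by apply: measurable_funM; [exact: measurable_cst|exact: mB].
Qed.

Lemma cmeas_flow_resolvent t z i j : 0 < Im z ->
  cmeas (fun w => resolvent (flow_matrix t w) z i j).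
Proof.
move=> z_gt0; apply: cmeas_resolvent => // [k l|w]; last exact: flow_matrix_sym.
exact: measurable_flow_matrix.
Qed.

Definition deviation z a x y t w : R :=
  smooth_abs a (resolvent (flow_matrix t w) z x y - resolvent (flow_matrix 0 w) z x y).

Lemma measurable_deviation z a x y t : 0 < Im z -> measurable_fun setT (deviation z a x y t).
Proof.
move=> z_gt0; apply: measurable_smooth_abs; apply: cmeasD; last apply: cmeasN;
  exact: cmeas_flow_resolvent.
Qed.

Definition step_error (z : R[i]) (a D : R) : R :=
  noise_moment_const R n 3 * Num.sqrt D ^+ 3 / Im z ^+ 4
  + noise_moment_const R n 4 * Num.sqrt D ^+ 4 / Im z ^+ 6 / a.

Section Measurability.
Variables (s D : R).
Hypotheses (s_ge0 : 0 <= s) (D_gt0 : 0 < D).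

Let EV := g_sigma_algebraType (environment_rects T B s D).
Let PV := g_sigma_algebraType (past_rects T V B s D).
Let IV := g_sigma_algebraType (increment_rects B s D).
Let VV := g_sigma_algebraType (\bigcup_(i in setT) [set V i @^-1` A | A in (@measurable _ R)]).

Let sigmaT i j Q : measurable Q ->
  gen_sigma setT (fun ij : 'I_n * 'I_n => T ij.1 ij.2) (T i j @^-1` Q).
Proof. by move=> mQ; apply: sub_sigma_algebra; exists (i, j) => //; exists Q. Qed.

Let environment_generated (G : set (set Omega)) : environment_rects T B s D `<=` G ->
  forall i j, measurable_fun setT (fun w : g_sigma_algebraType G => environment s w i j).
Proof.
move=> EG i j; apply: measurable_funD.
  move=> _ Q mQ; rewrite setTI; apply: sub_sigma_algebra; apply: EG.
  by apply: environment_rectT; exact: sigmaT.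
apply: measurable_funM; first exact: measurable_cst.
move=> _ Q mQ; rewrite setTI; apply: sub_sigma_algebra; apply: EG.
by apply: environment_rectB => //; exact: sorted_pair_le.
Qed.

Let mT i j : measurable_fun setT (T i j : PV -> R).
Proof.
move=> _ Q mQ; rewrite setTI; apply: sub_sigma_algebra; apply: environment_sub_past.
by apply: environment_rectT; exact: sigmaT.
Qed.

Let mV i : measurable_fun setT (V i : PV -> R).
Proof.
move=> _ Q mQ; rewrite setTI; apply: sub_sigma_algebra; apply: past_rectV.
by apply: sub_sigma_algebra; exists i => //; exists Q.
Qed.

Let mflow i j : measurable_fun setT (fun w : PV => flow_matrix s w i j).
Proof. by apply: measurable_with_diag => //; apply: environment_generated; exact: environment_sub_past. Qed.

Let mflow0 i j : measurable_fun setT (fun w : PV => flow_matrix 0 w i j).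
Proof.
under eq_fun do rewrite flow_matrix0.
exact: (@measurable_with_diag _ _ _ PV (fun w i j => T i j w) (fun w i => V i w) mT mV).
Qed.

Let mnoise i j : measurable_fun setT (noise_increment B s D i j : IV -> R).
Proof.
apply: measurable_funM; first exact: measurable_cst.
move=> _ Q mQ; rewrite setTI; apply: sub_sigma_algebra.
by apply: increment_rectX => //; exact: sorted_pair_le.
Qed.

Variables (z : R[i]) (a : R) (x y : 'I_n).
Hypotheses (z_gt0 : 0 < Im z) (a_gt0 : 0 < a).

Let step_fun (p : PV * IV) : R :=
  smooth_abs a (resolvent (fun i j => flow_matrix s p.1 i j + noise_increment B s D i j p.2) z x y
    - resolvent (flow_matrix 0 p.1) z x y).

Let mstep_fun : measurable_fun setT step_fun.
Proof.
apply: measurable_smooth_abs; apply: cmeasD; last apply: cmeasN.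
  apply: cmeas_resolvent => // [i j|p i j]; last first.
    by rewrite flow_matrix_sym noise_increment_sym.
  apply: measurable_funD; first exact: (measurableT_comp (mflow i j) measurable_fst).
  exact: (measurableT_comp (mnoise i j) measurable_snd).
apply: cmeas_resolvent => // [i j|p]; last exact: flow_matrix_sym.
exact: (measurableT_comp (mflow0 i j) measurable_fst).
Qed.

(** The past is frozen: [H_s] and the initial resolvent entry become the [h] and [g0] of
    [integral_step], and the increment over [[s, s + D]] is the noise. *)
Lemma deviation_step : (\int[P]_w (deviation z a x y (s + D) w)%:E <=
  \int[P]_w (deviation z a x y s w + 256 * D / n%:R * step_bound (flow_matrix s w) z a x y
     + step_error z a D)%:E)%E.
Proof.
have [c [covc cle]] := cov_noise_increment hyps s_ge0 D_gt0.
have flowE w : flow_matrix (s + D) w = fun i j => flow_matrix s w i j + noise_increment B s D i j w.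
  by apply/funext => i; apply/funext => j; rewrite flow_matrixD.
have := @integral_indep_sigma_le _ _ _ P _ _
  (past_rects_measurable hyps (s := s) (D := D)) (increment_rects_measurable hyps (s := s) (D := D))
  (past_increment_indep hyps s_ge0 D_gt0) (EFin \o step_fun)
  (fun w => (deviation z a x y s w + 256 * D / n%:R * step_bound (flow_matrix s w) z a x y
     + step_error z a D)%:E).
rewrite /step_fun /=.
under eq_integral do rewrite -flowE.
apply.
- exact/measurable_EFinP.
- by move=> p; rewrite lee_fin sqrtr_ge0.
- apply/measurable_EFinP; apply: measurable_funD => //; apply: measurable_funD.
    exact: measurable_deviation.
  apply: measurable_funM; first exact: measurable_cst.
  apply: measurable_step_bound => // [i j|w]; last exact: flow_matrix_sym.
  exact: measurable_flow_matrix.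
- move=> w; apply: (integral_step _ _ _ (flow_matrix_sym s w) z_gt0 a_gt0
    (noise_increment_sym B s D) (mean_noise_increment hyps s_ge0 D_gt0) covc _ cle).
  + by rewrite divr_ge0 // mulr_ge0 // ltW.
  + exact: (@moment_noise_increment _ _ _ _ _ _ _ _ _ hyps _ _ s_ge0 D_gt0 2).
  + exact: (@moment_noise_increment _ _ _ _ _ _ _ _ _ hyps _ _ s_ge0 D_gt0 3).
Qed.

Lemma flow_step_bound e : 0 < e -> e <= 1 ->
  (\int[P]_w (\sum_y step_bound (flow_matrix s w) z a x y)%:E
   <= (anderson_bound n `|C| z a e)%:E)%E.
Proof.
move=> e0 e1; have [[mT' Ts] mV' density bm ind] := hyps.
pose f (p : EV * VV) : R :=
  \sum_y step_bound (with_diag (environment s p.1) (fun i => V i p.2)) z a x y.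
have sym (p : EV * VV) : symf (with_diag (environment s p.1) (fun i => V i p.2)).
  by apply: with_diag_sym; exact: environment_sym.
have mf : measurable_fun setT f.
  apply: measurable_sum => y'; apply: measurable_step_bound => // i j.
  apply: (@measurable_with_diag _ _ _ _ (fun p : EV * VV => environment s p.1) (fun p i => V i p.2)).
    move=> k l; have menv : measurable_fun setT (fun w : EV => environment s w k l).
      exact: environment_generated.
    exact: (measurableT_comp menv measurable_fst).
  move=> k; have mVk : measurable_fun setT (V k : VV -> R).
    by move=> _ Q mQ; rewrite setTI; apply: sub_sigma_algebra; exists k => //; exists Q.
  exact: (measurableT_comp mVk measurable_snd).
have mG : \bigcup_(i in setT) [set V i @^-1` A | A in (@measurable _ R)] `<=` measurable.
  by move=> _ [i _ [Q mQ <-]]; rewrite -[Z in measurable Z]setTI; exact: mV'.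
have := @integral_indep_sigma_le _ _ _ P _ _
  (environment_rects_measurable hyps (s := s) (D := D)) mG _ (EFin \o f)
  (cst (anderson_bound n `|C| z a e)%:E).
have -> : (\int[P]_w cst (anderson_bound n `|C| z a e)%:E w = (anderson_bound n `|C| z a e)%:E)%E.
  by rewrite integral_cst // [X in (_ * X)%E]probability_setT mule1.
apply => //.
- move=> A A' hA hA'; rewrite setIC muleC.
  exact: (potential_environment_indep hyps s_ge0 D_gt0).
- exact/measurable_EFinP.
- by move=> p; rewrite lee_fin sumr_ge0 // => y' _; exact: step_bound_ge0.
(* [C] comes without a sign; [|C|] still satisfies the density bound and is nonnegative, as the
   averaging lemmas require. *)
- move=> w; have density' (x' : 'I_n) (I : set R) : measurable I ->
      forall A, gen_sigma [set y | y != x'] V A ->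
      (P (V x' @^-1` I `&` A) <= `|C|%:E * lebesgue_measure I * P A)%E.
    move=> mI A hA; apply: (le_trans (density x' I mI A hA)).
    by rewrite -!muleA lee_wpmul2r // ?mule_ge0 // lee_fin ler_norm.
  exact: (anderson_step_bound (normr_ge0 C) mV' density' z_gt0 (environment_sym s w) a_gt0 e0 e1 x).
Qed.

End Measurability.

End Flow.

(** * Letting the step length tend to zero *)

Section Iteration.
Context d (Omega : measurableType d) (R : realType) (P : probability Omega R).
Variables (C : R) (n : nat) (T : 'I_n -> 'I_n -> Omega -> R) (V : 'I_n -> Omega -> R)
  (B : 'I_n -> 'I_n -> R -> Omega -> R).
Hypothesis hyps : flow_hyps P C T V B.
Variables (z : R[i]) (a e : R) (x : 'I_n).
Hypotheses (z_gt0 : 0 < Im z) (a_gt0 : 0 < a) (e_gt0 : 0 < e) (e_le1 : e <= 1).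

Local Notation dev := (deviation T V B z a x).
Local Notation bound := (anderson_bound n `|C| z a e).
Local Notation err := (step_error n z a).

Let total s := (\sum_y \int[P]_w (dev y s w)%:E)%E.

Let dev_ge0 y s w : 0 <= dev y s w. Proof. exact: sqrtr_ge0. Qed.
Let mdev y s : measurable_fun setT (dev y s). Proof. exact: (measurable_deviation hyps). Qed.

Let n_gt0 : 0 < n%:R :> R. Proof. by rewrite ltr0n; case: n x => [[]|]. Qed.

Lemma noise_moment_const_ge0 k : 0 <= noise_moment_const R n k.
Proof.
by rewrite /noise_moment_const; apply: mulr_ge0; [|apply: mulr_ge0 => //; apply: mulr_ge0];
  rewrite ?exprn_ge0.
Qed.

Let err_ge0 D : 0 <= err D.
Proof.
have mm k : 0 <= noise_moment_const R n k * Num.sqrt D ^+ k.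
  by rewrite mulr_ge0 ?noise_moment_const_ge0 ?exprn_ge0.
have z0 := ltW z_gt0; have a0 := ltW a_gt0.
by apply: addr_ge0; [|apply: divr_ge0 => //]; apply: divr_ge0 => //; exact: exprn_ge0.
Qed.

Let total_step s D : 0 <= s -> 0 < D ->
  (total (s + D) <= total s + (256 * D / n%:R * bound + n%:R * err D)%:E)%E.
Proof.
move=> s0 D0; pose k := 256 * D / n%:R.
have k0 : 0 <= k by rewrite divr_ge0 ?mulr_ge0 ?(ltW n_gt0) // ltW.
pose sb y w := step_bound (flow_matrix T V B s w) z a x y.
have sb0 y w : 0 <= sb y w by apply: step_bound_ge0 => //; exact: (flow_matrix_sym hyps).
have msb y : measurable_fun setT (sb y).
  apply: measurable_step_bound => // [i j|w]; last exact: (flow_matrix_sym hyps).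
  exact: (measurable_flow_matrix hyps).
apply: (@le_trans _ _ (\sum_y (\int[P]_w (dev y s w)%:E + (k%:E * \int[P]_w (sb y w)%:E + (err D)%:E)))%E).
  apply: lee_sum => y _; apply: (le_trans (deviation_step hyps s0 D0 x y z_gt0 a_gt0)).
  rewrite le_eqVlt; apply/orP; left; apply/eqP.
  under eq_integral do rewrite -/(sb y _) -addrA EFinD EFinD EFinM.
  rewrite ge0_integralD //; last 4 first.
  - by move=> w _; rewrite lee_fin.
  - exact/measurable_EFinP.
  - by move=> w _; rewrite -EFinM -EFinD lee_fin addr_ge0 // mulr_ge0 ?sb0.
  - apply: emeasurable_funD; last exact: measurable_cst.
    by apply: measurable_funeM; exact/measurable_EFinP.
  rewrite ge0_integralD //; last 3 first.
  - by move=> w _; rewrite -EFinM lee_fin mulr_ge0.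
  - by apply: measurable_funeM; exact/measurable_EFinP.
  - by move=> w _; rewrite lee_fin.
  rewrite ge0_integralZl //; last 2 first.
  - exact/measurable_EFinP.
  - by move=> w _; rewrite lee_fin.
  congr (_ + (_ + _))%E; rewrite integral_cst //.
  by rewrite [X in (_ * X)%E]probability_setT mule1.
rewrite big_split /=; apply: leeD2l; rewrite big_split /= [leRHS]EFinD; apply: leeD; last first.
  by rewrite sumEFin sumr_const card_ord -[_ *+ n]mulr_natl.
rewrite -ge0_sume_distrr; last by move=> y _; apply: integral_ge0 => w _; rewrite lee_fin.
rewrite [leRHS]EFinM; apply: lee_wpmul2l; rewrite ?lee_fin // -ge0_integral_sum //.
- under eq_integral do rewrite sumEFin.
  exact: (flow_step_bound hyps s0 D0 x z_gt0 a_gt0 e_gt0 e_le1).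
- by move=> y; exact/measurable_EFinP.
- by move=> y w _; rewrite lee_fin.
Qed.

Let total0 : (total 0 = (n%:R * a)%:E)%E.
Proof.
rewrite /total (eq_bigr (fun=> a%:E)) => [|y _].
  by rewrite sumEFin sumr_const card_ord -[_ *+ n]mulr_natl.
under eq_integral do rewrite /deviation subrr /smooth_abs ncE2 /= expr0n /= !add0r sqrtr_sqr gtr0_norm //.
by rewrite integral_cst // [X in (_ * X)%E]probability_setT mule1.
Qed.

Let total_iter D k : 0 < D ->
  (total (k%:R * D) <=
   (n%:R * a + k%:R * (256 * D / n%:R * bound + n%:R * err D))%:E)%E.
Proof.
move=> D0; set X := 256 * D / n%:R * bound + n%:R * err D.
elim: k => [|k IH]; first by rewrite !mul0r addr0 total0.
rewrite -natr1 !mulrDl !mul1r addrA [leRHS]EFinD.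
apply: (le_trans (total_step _ D0)); first by rewrite mulr_ge0 // ltW.
exact: leeD2r.
Qed.

Lemma deviation_sum_le t : 0 <= t ->
  (\sum_y \int[P]_w (deviation T V B z a x y t w)%:E
   <= (n%:R * a + 256 * t / n%:R * bound)%:E)%E.
Proof.
rewrite le_eqVlt => /orP[/eqP<-|t0]; first by rewrite [leLHS]total0 mulr0 !mul0r addr0.
apply/lee_addgt0Pr => r r0.
pose M k := noise_moment_const R n k.
(* With [q = sqrt (t / K)], the accumulated error of [K] steps is at most [L * q]: it is of third
   order in [q], and [K q^2 = t] uses up two of the three factors. *)
pose L := n%:R * t * (M 3 / Im z ^+ 4 + M 4 / Im z ^+ 6 / a).
have M0 k : 0 <= M k by exact: noise_moment_const_ge0.
have z4 : 0 < Im z ^+ 4 by rewrite exprn_gt0.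
have z6 : 0 < Im z ^+ 6 by rewrite exprn_gt0.
have h3 : 0 <= M 3 / Im z ^+ 4 by rewrite divr_ge0 // ltW.
have h4 : 0 <= M 4 / Im z ^+ 6 / a by rewrite !divr_ge0 // ltW.
have L0 : 0 <= L by rewrite mulr_ge0 ?addr_ge0 // mulr_ge0 // ltW.
(* [q <= 1] puts the fourth-order term below the same bound, and [q <= r / (L + 1)] gives
   [L * q <= r]. *)
pose q0 := Num.min 1 (r / (L + 1)).
have q00 : 0 < q0 by rewrite lt_min ltr01 divr_gt0 // ltr_wpDl.
(* The successor makes [K] positive and larger than [t / q0^2], so that [t / K <= q0^2]. *)
pose K := (Num.truncn (t / q0 ^+ 2)).+1.
have K0 : 0 < K%:R :> R by rewrite ltr0n.
have D0 : 0 < t / K%:R by rewrite divr_gt0.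
have := total_iter K D0; rewrite mulrC divfK ?gt_eqF // => /le_trans; apply.
rewrite -EFinD lee_fin -addrA lerD2l mulrDr lerD //.
  rewrite le_eqVlt; apply/orP; left; apply/eqP; set b := bound; field.
  by rewrite !gt_eqF.
pose q := Num.sqrt (t / K%:R).
have q_ge0 : 0 <= q by exact: sqrtr_ge0.
have qq : q ^+ 2 = t / K%:R by rewrite sqr_sqrtr // ltW.
have qle : q <= q0.
  rewrite -(@ler_pXn2r _ 2) ?nnegrE ?(ltW q00) // qq ler_pdivrMr // mulrC -ler_pdivrMr ?exprn_gt0 //.
  exact/ltW/truncnS_gt.
have q1 : q <= 1 by rewrite (le_trans qle) // ge_min lexx.
have Kt : K%:R * q ^+ 2 = t by rewrite qq mulrC divfK // gt_eqF.
apply: (@le_trans _ _ (L * q)).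
  rewrite /step_error -/q -/(M 3) -/(M 4).
  have -> : K%:R * (n%:R * (M 3 * q ^+ 3 / Im z ^+ 4 + M 4 * q ^+ 4 / Im z ^+ 6 / a))
     = n%:R * (K%:R * q ^+ 2) * (M 3 / Im z ^+ 4 + M 4 / Im z ^+ 6 / a * q) * q.
    by field; rewrite !gt_eqF.
  rewrite Kt /L ler_wpM2r // ler_wpM2l ?mulr_ge0 ?(ltW n_gt0) ?(ltW t0) // lerD2l.
  by rewrite -[leRHS]mulr1 ler_wpM2l.
apply: (@le_trans _ _ (L * (r / (L + 1)))).
  by rewrite ler_wpM2l // (le_trans qle) // ge_min lexx orbT.
rewrite mulrA ler_pdivrMr ?ltr_wpDl // mulrDr mulr1 mulrC lerDl ltW //.
Qed.

End Iteration.

(** * Choice of the constants *)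

Section Constants.
Variable R : realType.

Lemma powR_le_add1 (m s : R) : 0 < m -> 0 <= s -> s <= 1 -> m `^ (- s) <= 1 + m^-1.
Proof.
move=> m0 s0 s1; have mi : 0 < m^-1 by rewrite invr_gt0.
have [m1|m1] := leP 1 m.
  apply: (@le_trans _ _ (m `^ 0)); first by rewrite ler_powR // oppr_le0.
  by rewrite powRr0 lerDl ltW.
apply: (@le_trans _ _ (m `^ (-1))); last by rewrite powR_inv1 ?(ltW m0) // lerDr.
apply: ger_powR; first by rewrite m0 ltW.
by rewrite lerN2.
Qed.

(** In [eta^(-2 e) = N^(2 e) (N eta)^(-2 e)], the first factor is absorbed by [N^(-c/2)] since
    [2 e <= c/2], the second by [1 + 1 / (N eta)] since [2 e <= 1]. *)
Lemma powR_rescale (N eta c e : R) : 1 <= N -> 0 < eta -> 0 < e -> 2 * e <= 1 -> 2 * e <= c / 2 ->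
  N `^ (- (c / 2)) * (eta `^ (- e)) ^+ 2 <= 1 + (N * eta)^-1.
Proof.
move=> N1 eta0 e0 e1 ec; have N0 : 0 < N by rewrite (lt_le_trans ltr01).
have -> : (eta `^ (- e)) ^+ 2 = N `^ (2 * e) * (N * eta) `^ (- (2 * e)).
  rewrite powRM ?ltW // mulrA -powRD ?subrr ?powRr0 ?mul1r; last by rewrite (gt_eqF N0) implybT.
  rewrite expr2 -powRD; first by congr (_ `^ _); ring.
  by rewrite (gt_eqF eta0) implybT.
rewrite mulrA -powRD; last by rewrite (gt_eqF N0) implybT.
apply: (@le_trans _ _ (1 * (N * eta) `^ (- (2 * e)))).
  rewrite ler_wpM2r ?powR_ge0 // -[leRHS](powRr0 N) ler_powR //; lra.
rewrite mul1r; apply: powR_le_add1 => //; first by rewrite mulr_gt0.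
lra.
Qed.

Definition final_const (C1 K : R) : R :=
  1 + 256 * (3 * C1 ^+ 2 + 3 * C1 + C1 + 2 + 4 * K ^+ 2 + C1).

(** Used with [r = 1 / (N eta)], [p = eta^(-e)] and [K = C1 / e]. Writing [1 / eta] as [n r] gathers
    all powers of [n] into [t n <= a^2]. One of these two factors [a] absorbs the [1 / a] of the
    smoothing and the [p^2]; the other is the decay in the conclusion. *)
Lemma final_bound (a r t n C1 K p : R) : 0 < a -> a <= 1 -> 0 < r -> 0 < n -> 0 <= C1 ->
  0 <= K -> 0 <= t -> 0 <= p -> t * n <= a ^+ 2 -> a * p ^+ 2 <= 1 + r ->
  n^-1 * (n * a + 256 * t / n *
    ((2^-1 + 2 / a) * ((n * C1 ^+ 2 + C1 * (n * r)) * (n * r) ^+ 2)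
    + 2^-1 * (n * (n * (C1 * (n * r)))) + n * ((n * (1 + K * p) ^+ 2 + C1 * (n * r)) * (n * r))))
  <= final_const C1 K * a * (1 + r + r ^+ 3).
Proof.
move=> a0 a1 r0 n0 C10 K0 t0 p0 tn ap.
pose X := (2^-1 + 2 / a) * (r ^+ 2 * (C1 ^+ 2 + C1 * r)) + 2^-1 * (C1 * r)
  + r * ((1 + K * p) ^+ 2 + C1 * r).
have -> : n^-1 * (n * a + 256 * t / n *
    ((2^-1 + 2 / a) * ((n * C1 ^+ 2 + C1 * (n * r)) * (n * r) ^+ 2)
    + 2^-1 * (n * (n * (C1 * (n * r)))) + n * ((n * (1 + K * p) ^+ 2 + C1 * (n * r)) * (n * r))))
  = a + 256 * (t * n) * X.
  by rewrite /X; field; rewrite !gt_eqF.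
have ai : 0 <= 2 / a by rewrite divr_ge0 // ltW.
have r0' := ltW r0; have a0' := ltW a0.
have Y0 : 0 <= r ^+ 2 * (C1 ^+ 2 + C1 * r) by rewrite mulr_ge0 ?addr_ge0 ?exprn_ge0 ?mulr_ge0.
have X0 : 0 <= X.
  apply: addr_ge0; first apply: addr_ge0.
  - by apply: mulr_ge0 => //; exact: addr_ge0.
  - by rewrite !mulr_ge0.
  - by apply: mulr_ge0 => //; rewrite addr_ge0 ?sqr_ge0 ?mulr_ge0.
apply: (@le_trans _ _ (a + 256 * a ^+ 2 * X)).
  by rewrite lerD2l ler_wpM2r // ler_wpM2l.
have aX : a ^+ 2 * X <= a * (3 * (r ^+ 2 * (C1 ^+ 2 + C1 * r)) + C1 * r
    + r * (2 + 2 * K ^+ 2 * (1 + r) + C1 * r)).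
  have -> : a ^+ 2 * X = a * ((a / 2 + 2) * (r ^+ 2 * (C1 ^+ 2 + C1 * r)) + a * (2^-1 * (C1 * r))
     + r * (a * (1 + K * p) ^+ 2 + a * (C1 * r))).
    by rewrite /X; field; rewrite gt_eqF.
  have C1r : 0 <= C1 * r by rewrite mulr_ge0.
  have ac : a * (C1 * r) <= C1 * r by rewrite -[leRHS]mul1r ler_wpM2r.
  apply: ler_wpM2l => //; apply: lerD; first apply: lerD.
  - by rewrite ler_wpM2r //; lra.
  - apply: le_trans ac; rewrite ler_wpM2l // -[leRHS]mul1r ler_wpM2r //; lra.
  - apply: ler_wpM2l => //; apply: lerD => //.
    have := sqr_ge0 (1 - K * p); have -> : 2 * K ^+ 2 * (1 + r) = 2 * (K ^+ 2 * (1 + r)) by ring.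
    have : K ^+ 2 * (a * p ^+ 2) <= K ^+ 2 * (1 + r) by rewrite ler_wpM2l // sqr_ge0.
    have -> : (1 - K * p) ^+ 2 = 2 * (1 + K ^+ 2 * p ^+ 2) - (1 + K * p) ^+ 2 by ring.
    move=> h1; rewrite subr_ge0 => h2.
    have := ler_wpM2l a0' h2.
    have -> : a * (2 * (1 + K ^+ 2 * p ^+ 2)) = 2 * a + 2 * (K ^+ 2 * (a * p ^+ 2)) by ring.
    lra.
pose S := 1 + r + r ^+ 3.
have r3 : 0 <= r ^+ 3 by rewrite exprn_ge0.
have S1 : 1 <= S by rewrite /S; lra.
have Sr : r <= S by rewrite /S; lra.
have Sr3 : r ^+ 3 <= S by rewrite /S; lra.
(* The target has no [r^2]; it is recovered from [2 r^2 <= r + r^3]. *)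
have Sr2 : r ^+ 2 <= S.
  have : 0 <= r * (r - 1) ^+ 2 by rewrite mulr_ge0 // sqr_ge0.
  have : 0 <= r ^+ 2 by rewrite sqr_ge0.
  have -> : r * (r - 1) ^+ 2 = r ^+ 3 - 2 * r ^+ 2 + r by ring.
  rewrite /S; lra.
rewrite -/S -mulrA.
have -> : a + 256 * (a ^+ 2 * X) = a * 1 + 256 * (a ^+ 2 * X) by rewrite mulr1.
apply: (@le_trans _ _ (a * S + 256 * (a * (3 * (C1 ^+ 2 * S + C1 * S) + C1 * S
    + (2 * S + 2 * K ^+ 2 * (S + S) + C1 * S))))).
  apply: lerD; first by rewrite ler_wpM2l.
  rewrite ler_wpM2l // (le_trans aX) // ler_wpM2l //.
  have -> : 3 * (r ^+ 2 * (C1 ^+ 2 + C1 * r)) + C1 * r + r * (2 + 2 * K ^+ 2 * (1 + r) + C1 * r)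
    = 3 * (C1 ^+ 2 * r ^+ 2 + C1 * r ^+ 3) + C1 * r
      + (2 * r + 2 * K ^+ 2 * (r + r ^+ 2) + C1 * r ^+ 2) by ring.
  have CC : 0 <= C1 ^+ 2 := sqr_ge0 _; have KK : 0 <= 2 * K ^+ 2 by rewrite mulr_ge0 // sqr_ge0.
  repeat (apply: lerD || apply: ler_wpM2l) => //.
by rewrite le_eqVlt; apply/orP; left; apply/eqP; rewrite /final_const; ring.
Qed.

End Constants.

Theorem theorem2p2 (R : realType) :
  forall c : R, 0 < c -> forall C_V : R, exists C : R,
  forall (N : nat) (d : measure_display) (Omega : measurableType d)
    (P : probability Omega R) (T : 'I_N -> 'I_N -> Omega -> R)
    (V : 'I_N -> Omega -> R) (B : 'I_N -> 'I_N -> R -> Omega -> R),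
  flow_hyps P C_V T V B ->
  forall (t E eta : R) (x : 'I_N),
  0 <= t -> t <= N%:R `^ (- (1 + c)) -> 0 < eta ->
  ((N%:R)^-1%:E * \sum_(y < N)
      \int[P]_w (Normc.normc (Green T V B t (Complex E eta) w x y
                              - Green T V B 0 (Complex E eta) w x y))%:E
   <= (C * N%:R `^ (- (c / 2))
        * (1 + (N%:R * eta)^-1 + ((N%:R * eta) ^+ 3)^-1))%:E)%E.
Proof.
(* [e] is the largest value with [2 e <= 1] and [2 e <= c / 2]; it depends on [c] only, hence so
   does the constant, apart from [C_V]. *)
move=> c c0 C_V; pose e := Num.min 2^-1 (c / 4).
have e0 : 0 < e by rewrite lt_min invr_gt0 ltr0n divr_gt0.
have e1 : 2 * e <= 1 by have : e <= 2^-1; [rewrite ge_min lexx|lra].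
have ec : 2 * e <= c / 2 by have : e <= c / 4; [rewrite ge_min lexx orbT|lra].
pose C1 := 32 * `|C_V|; exists (final_const C1 (C1 / e)).
move=> N d Omega P T V B hyps t E eta x t0 tN eta0.
have N0 : 0 < N%:R :> R by rewrite ltr0n (leq_ltn_trans _ (ltn_ord x)).
have N1 : 1 <= N%:R :> R by move: N0; rewrite ltr0n ler1n.
pose z := Complex E eta; have z0 : 0 < Im z by [].
pose a := N%:R `^ (- (c / 2)); have a0 : 0 < a by exact: powR_gt0.
have a1 : a <= 1 by rewrite -[leRHS](powRr0 N%:R) ler_powR //; lra.
have Ts : forall i j w, T i j w = T j i w by have [[_ Ts] _ _ _ _] := hyps.
have C10 : 0 <= C1 by rewrite mulr_ge0.
have Ninv0 : (0 <= N%:R^-1%:E :> \bar R)%E by rewrite lee_fin invr_ge0 ltW.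
apply: (@le_trans _ _ (N%:R^-1%:E * \sum_(y < N) \int[P]_w (deviation T V B z a x y t w)%:E)%E).
  apply: lee_wpmul2l => //; apply: lee_sum => y _; apply: ge0_le_integral => //.
  - by move=> w _; rewrite lee_fin nc_ge0.
  - apply/measurable_EFinP; apply: cmeas_nc.
    under eq_fun do rewrite !Green_resolvent //.
    by apply: cmeasD; last apply: cmeasN; exact: (cmeas_flow_resolvent hyps).
  - by apply/measurable_EFinP; exact: (measurable_deviation hyps).
  - by move=> w _; rewrite lee_fin !Green_resolvent //; exact: nc_le_smooth_abs.
have e1' : e <= 1 by lra.
apply: (le_trans (lee_wpmul2l Ninv0 (deviation_sum_le hyps x z0 a0 e0 e1' t0))).
rewrite -EFinM lee_fin.
pose r := (N%:R * eta)^-1; have r0 : 0 < r by rewrite invr_gt0 mulr_gt0.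
have etaE : eta^-1 = N%:R * r by rewrite /r invfM mulrA divff ?mul1r // gt_eqF.
have tN2 : t * N%:R <= a ^+ 2.
  apply: (@le_trans _ _ (N%:R `^ (- (1 + c)) * N%:R)); first by rewrite ler_wpM2r // ltW.
  rewrite -{2}(powRr1 (ltW N0)) /a expr2 -!powRD ?(gt_eqF N0) ?implybT // le_eqVlt.
  by apply/orP; left; apply/eqP; congr (_ `^ _); field.
have := final_bound a0 a1 r0 N0 C10 (divr_ge0 C10 (ltW e0)) t0 (powR_ge0 eta (- e)) tN2
  (powR_rescale N1 eta0 e0 e1 ec).
rewrite -!exprVn -/r -!etaE /anderson_bound -/C1 /=.
by rewrite (exprVn eta).
Qed.
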